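(* Let $p \ge 1$ be an integer, let $\Theta \in H^\infty_{\mathcal{B}(\mathbb{C}^p)}(\mathbb{D})$ be an inner multiplier, let $\mathcal{Q}_\Theta = H^2_{\mathbb{C}^p}(\mathbb{D}) \ominus \Theta H^2_{\mathbb{C}^p}(\mathbb{D})$, and let $T$ be a bounded linear operator on $\mathcal{Q}_\Theta$. Then $T$ is compact if and only if the sequence $\{S_\Theta^{*m} T S_\Theta^{m}\}_{m \ge 1}$ converges in operator norm.
   Context: $\mathbb{D}$ is the open unit disc and $\mathbb{T}$ the unit circle. $\mathcal{B}(\mathbb{C}^p)$ denotes the linear operators on $\mathbb{C}^p$. $H^2_{\mathbb{C}^p}(\mathbb{D})$ is the $\mathbb{C}^p$-valued Hardy space over $\mathbb{D}$, and $H^\infty_{\mathcal{B}(\mathbb{C}^p)}(\mathbb{D})$ is the space of bounded holomorphic $\mathcal{B}(\mathbb{C}^p)$-valued functions on $\mathbb{D}$. A function $\Theta \in H^\infty_{\mathcal{B}(\mathbb{C}^p)}(\mathbb{D})$ is an inner multiplier if its radial boundary values $\Theta(e^{i\theta})$ are isometries on $\mathbb{C}^p$ for almost every $e^{i\theta} \in \mathbb{T}$. $T_z$ is the operator of multiplication by $z$ on $H^2_{\mathbb{C}^p}(\mathbb{D})$, $P_{\mathcal{Q}_\Theta}$ is the orthogonal projection of $H^2_{\mathbb{C}^p}(\mathbb{D})$ onto $\mathcal{Q}_\Theta$, and $S_\Theta = P_{\mathcal{Q}_\Theta} T_z|_{\mathcal{Q}_\Theta}$ is the model operator on $\mathcal{Q}_\Theta$.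 *)

(* Defs.v *)
From mathcomp Require Import all_boot all_order all_algebra.
From mathcomp Require Import all_classical all_reals all_analysis.
From mathcomp Require Import complex.

Set Implicit Arguments.
Unset Strict Implicit.
Unset Printing Implicit Defensive.

Import Order.TTheory GRing.Theory Num.Theory.
Import numFieldNormedType.Exports.

Local Open Scope classical_set_scope.
Local Open Scope ring_scope.
Local Open Scope complex_scope.

Section euclidean.
Context {R : realType} {p : nat}.

Definition cvdot (x y : 'cV[R[i]]_p) : R[i] := \sum_(i < p) x i 0 * (y i 0)^*.

(* The library norm on matrices is the sup norm, hence this Euclidean norm. *)
Definition cvnorm (x : 'cV[R[i]]_p) : R := Num.sqrt (complex.Re (cvdot x x)).

End euclidean.

Definition disc (R : realType) : Type := {w : R[i] | `|w| < 1}.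

(* Functions on the disc are functions out of the subtype [disc R], so that
   they are equal in Rocq as soon as they agree on the disc. *)
Definition discfun (R : realType) (p : nat) : Type := disc R -> 'cV[R[i]]_p.

Section hardy.
Context {R : realType} {p : nat}.
Implicit Types (a : nat -> 'cV[R[i]]_p) (f g h : discfun R p).

Definition power_series_of a f : Prop := forall (w : disc R) (i : 'I_p),
  series (fun n => a n i 0 * sval w ^+ n : R[i]^o) @ \oo --> (f w i 0 : R[i]^o).

Definition square_summable a : Prop :=
  cvgn (series (fun n => cvnorm (a n) ^+ 2 : R^o)).

Definition hardy2 : set (discfun R p) :=
  [set f | exists2 a, square_summable a & power_series_of a f].

(* The power series coefficients of f (they are unique); junk value 0 when f
   has no power series expansion on the disc. *)
Definition coefs f : nat -> 'cV[R[i]]_p :=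
  xget (fun=> 0) [set a | power_series_of a f].

Definition hdot f g : R[i] :=
  limn (series (fun n => cvdot (coefs f n) (coefs g n) : R[i]^o)).

Definition hnorm f : R := Num.sqrt (complex.Re (hdot f f)).

Definition mulz f : discfun R p := fun w => sval w *: f w.

End hardy.

(* An operator on a subspace Q of hardy2 is represented by a total function on
   [discfun R p] whose values outside Q are irrelevant; every notion below only
   depends on its restriction to Q. *)
Section operators.
Context {R : realType} {p : nat}.
Implicit Types (Q : set (discfun R p)) (A : discfun R p -> discfun R p).

Definition bounded_operator Q A : Prop :=
  [/\ forall f, Q f -> Q (A f),
      forall (c : R[i]) f g, Q f -> Q g -> A (c *: f + g) = c *: A f + A g &
      exists M : R, forall f, Q f -> hnorm (A f) <= M * hnorm f].

(* Orthogonal projection of f onto Q: the unique g in Q with f - g _|_ Q. *)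
Definition orth_proj Q (f : discfun R p) : discfun R p :=
  xget 0 [set g | Q g /\ forall h, Q h -> hdot (f - g) h = 0].

(* Hilbert space adjoint of an operator A on Q. *)
Definition adjoint Q A (g : discfun R p) : discfun R p :=
  xget 0 [set h | Q h /\ forall f, Q f -> hdot (A f) g = hdot f h].

Definition opnorm Q A : \bar R :=
  ereal_sup [set (hnorm (A f))%:E | f in [set f | Q f /\ hnorm f <= 1]].

Definition opnorm_cvg Q (A : nat -> discfun R p -> discfun R p) : Prop :=
  exists2 L, bounded_operator Q L &
    opnorm Q (fun f => A m f - L f) @[m --> \oo] --> 0%E.

Definition compact_operator Q A : Prop :=
  forall u : nat -> discfun R p,
    (forall n, Q (u n)) -> (exists M : R, forall n, hnorm (u n) <= M) ->
  exists2 k : nat -> nat, {homo k : m n / (m < n)%N} &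
  exists2 g, Q g & hnorm (A (u (k n)) - g) @[n --> \oo] --> (0 : R).

End operators.

Section inner.
Context {R : realType} {p : nat}.
(* Only the values of Theta on the open unit disc are relevant below. *)
Implicit Type Theta : R[i] -> 'M[R[i]]_p.

Definition hardy_infty Theta : Prop :=
  (forall (i j : 'I_p) (w : R[i]), `|w| < 1 ->
     derivable (fun v : R[i]^o => Theta v i j : R[i]^o) w 1) /\
  (exists M : R, forall (w : R[i]) (x : 'cV[R[i]]_p), `|w| < 1 ->
     cvnorm (Theta w *m x) <= M * cvnorm x).

Definition radial_limit Theta (t : R) (U : 'M[R[i]]_p) : Prop :=
  forall i j : 'I_p,
    (Theta ((r * cos t) +i* (r * sin t)) i j : R[i]^o) @[r --> (1 : R)^'-]
      --> (U i j : R[i]^o).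

Definition isometric (U : 'M[R[i]]_p) : Prop :=
  forall x : 'cV[R[i]]_p, cvnorm (U *m x) = cvnorm x.

Definition inner_multiplier Theta : Prop :=
  hardy_infty Theta /\
  {ae (@lebesgue_measure R), forall t : R, 0 <= t <= pi *+ 2 ->
     exists2 U, radial_limit Theta t U & isometric U}.

Definition mul_by Theta (f : discfun R p) : discfun R p :=
  fun w => Theta (sval w) *m f w.

Definition model_space Theta : set (discfun R p) :=
  [set f | hardy2 f /\ forall g, hardy2 g -> hdot f (mul_by Theta g) = 0].

Definition model_operator Theta (f : discfun R p) : discfun R p :=
  orth_proj (model_space Theta) (mulz f).

End inner.

(* Main.v *)
Require Import Defs.
From HB Require Import structures.
From mathcomp Require Import all_boot all_order all_algebra.
From mathcomp Require Import all_classical all_reals all_analysis.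
From mathcomp Require Import complex lra ring.

Set Implicit Arguments.
Unset Strict Implicit.
Unset Printing Implicit Defensive.

Import Order.TTheory GRing.Theory Num.Theory.
Import numFieldNormedType.Exports.

Local Open Scope classical_set_scope.
Local Open Scope ring_scope.
Local Open Scope complex_scope.

(** Write [Q] for the model space, [P] for the projection onto it and [S] for the
    model operator. On Taylor coefficients [T_z] is the shift of square summable
    sequences. [Q] is invariant under the backward shift, so [S*] is the
    backward shift restricted to [Q], and [S^m] is [P T_z^m] restricted to [Q].

    Both sequences of powers tend to [0] strongly. For [S*^m] these are tails of
    convergent series ([iter_Bk_cvg0]). For [S^m] it suffices that
    [P (v z^n) -> 0] for a vector [v] ([P2_single_cvg0]): the boundary values of
    [Theta] are isometries of a finite dimensional space, hence unitary, so the
    squares of the norms of the [A_j^* v] sum up to that of [v], where the [A_j]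
    are the Taylor coefficients of [Theta]; therefore [v z^n] is close to
    [Theta q] for the polynomial [q] with coefficients [A_(n-j)^* v], and [P]
    kills [Theta q].

    If [T] is compact then [S*^m T S^m] tends to [0] in norm. Otherwise there are
    vectors [f_m] of the unit ball for which [S*^m T S^m f_m] stays away from [0]; the
    vectors [S^m f_m] are bounded, so a subsequence of [T S^m f_m] converges to
    some [g], and [S*^m g -> 0] is a contradiction ([compact2_compression]).

    Conversely, [S*^m T S^m f -> 0] for every [f], so a norm limit must be [0].
    The operator [E = 1 - S^m S*^m] is [P] applied to the truncation to the first
    [m] coefficients, hence it is of finite rank, and
    [T = S^m (S*^m T S^m) S*^m + (T E + E T - E T E)], so that [T] is a norm
    limit of operators of finite rank. In the form used here
    ([compression_estimate]): up to a small multiple of the norm of [v], the norm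
    of [T v] is controlled by finitely many coefficients of [v] and [T v]. Along
    an ultrafilter the coefficients of a bounded sequence and of its image
    converge, so the image is Cauchy along that filter
    ([compression_compact2]).

    This argument takes place in the space [l2] of coefficients. Two facts of
    function theory lead there. A bounded holomorphic function on the disc is
    the sum of its Taylor series ([hol_power_series]): Goursat's theorem is proved
    on rectangles and transported by the exponential, which turns rectangles
    into annuli, so that means over circles do not depend on the radius. And
    multiplication by [Theta] is isometric on polynomials, with the companion
    identity for the transposes ([inner_poly_isometry], [inner_tr_isometry]):
    Parseval's identity on circles of radius [r < 1], then dominated convergence
    as [r -> 1]. *)

(** * Complex numbers over a real type *)

Notation cabs := ComplexField.Normc.normc.

Local Notation Re := (@complex.Re _).
Local Notation Im := (@complex.Im _).

Section complex_numbers.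
Variable R : realType.
Implicit Types (x y z w : R[i]) (r s t : R).

Lemma normC_cabs z : `|z| = (cabs z)%:C. Proof. by []. Qed.

Lemma cabs_ge0 z : 0 <= cabs z.
Proof. by case: z => a b /=; rewrite sqrtr_ge0. Qed.

Lemma cabs0 : cabs (0 : R[i]) = 0.
Proof. exact: ComplexField.Normc.normc0. Qed.

Lemma cabs1 : cabs (1 : R[i]) = 1.
Proof. exact: ComplexField.Normc.normc1. Qed.

Lemma cabsD z w : cabs (z + w) <= cabs z + cabs w.
Proof. exact: le_normcD. Qed.

Lemma cabsM z w : cabs (z * w) = cabs z * cabs w.
Proof. exact: ComplexField.Normc.normcM. Qed.

Lemma cabsV z : cabs z^-1 = (cabs z)^-1.
Proof. exact: ComplexField.Normc.normcV. Qed.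

Lemma cabsN z : cabs (- z) = cabs z.
Proof. exact: normcN. Qed.

Lemma cabsB z w : cabs (z - w) = cabs (w - z).
Proof. by rewrite -cabsN opprB. Qed.

Lemma cabsX z n : cabs (z ^+ n) = cabs z ^+ n.
Proof.
elim: n => [|n IH]; first by rewrite !expr0 cabs1.
by rewrite !exprS cabsM IH.
Qed.

Lemma cabs_eq0 z : cabs z = 0 -> z = 0.
Proof. exact: ComplexField.Normc.eq0_normc. Qed.

Lemma cabs_gt0 z : z != 0 -> 0 < cabs z.
Proof.
move=> z0; rewrite lt_neqAle cabs_ge0 andbT eq_sym.
by apply: contra z0 => /eqP/cabs_eq0 ->.
Qed.

Lemma cabs_sum (I : Type) (s : seq I) (P : pred I) (F : I -> R[i]) :
  cabs (\sum_(i <- s | P i) F i) <= \sum_(i <- s | P i) cabs (F i).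
Proof.
elim/big_ind2 : _ => [|x r y s' h1 h2|//]; first by rewrite cabs0.
by rewrite (le_trans (cabsD _ _))// lerD.
Qed.

Lemma cabs_real r : cabs (r%:C : R[i]) = `|r|.
Proof. by rewrite /= expr0n/= addr0 sqrtr_sqr. Qed.

Lemma cabs_sqr z : cabs z ^+ 2 = Re z ^+ 2 + Im z ^+ 2.
Proof. by case: z => a b /=; rewrite sqr_sqrtr// addr_ge0 ?sqr_ge0. Qed.

Lemma Re_le_cabs z : `|Re z| <= cabs z.
Proof.
case: z => a b /=; rewrite -sqrtr_sqr ler_sqrt ?addr_ge0 ?sqr_ge0//.
by rewrite lerDl sqr_ge0.
Qed.

Lemma Im_le_cabs z : `|Im z| <= cabs z.
Proof.
case: z => a b /=; rewrite -sqrtr_sqr ler_sqrt ?addr_ge0 ?sqr_ge0//.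
by rewrite lerDr sqr_ge0.
Qed.

Lemma cabs_le_ReIm z : cabs z <= `|Re z| + `|Im z|.
Proof.
have -> : z = (Re z)%:C + 'i * (Im z)%:C by rewrite -complexE.
apply: le_trans (cabsD _ _) _; rewrite cabsM !cabs_real.
rewrite (_ : cabs 'i = 1); last by rewrite /= expr0n expr1n add0r sqrtr1.
by rewrite mul1r; case: z => a b /=; rewrite !(mul0r, mulr0, addr0, add0r, subr0, mul1r).
Qed.

Lemma ReD z w : Re (z + w) = Re z + Re w. Proof. by case: z; case: w. Qed.
Lemma ImD z w : Im (z + w) = Im z + Im w. Proof. by case: z; case: w. Qed.
Lemma ReN z : Re (- z) = - Re z. Proof. by case: z. Qed.
Lemma ImN z : Im (- z) = - Im z. Proof. by case: z. Qed.
Lemma ReB z w : Re (z - w) = Re z - Re w. Proof. by rewrite ReD ReN. Qed.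
Lemma ImB z w : Im (z - w) = Im z - Im w. Proof. by rewrite ImD ImN. Qed.
Lemma ReM z w : Re (z * w) = Re z * Re w - Im z * Im w.
Proof. by case: z; case: w. Qed.
Lemma ImM z w : Im (z * w) = Re z * Im w + Im z * Re w.
Proof. by case: z => a b; case: w => c d /=. Qed.
Lemma ReMr z r : Re (z * r%:C) = Re z * r.
Proof. by rewrite ReM /= mulr0 subr0. Qed.
Lemma Re_conj z : Re (z^*)%R = Re z. Proof. by case: z. Qed.
Lemma Im_conj z : Im (z^*)%R = - Im z. Proof. by case: z. Qed.

Lemma eqC z w : Re z = Re w -> Im z = Im w -> z = w.
Proof. by case: z; case: w => a b c d /= -> ->. Qed.

Lemma Re0 : Re (0 : R[i]) = 0. Proof. by []. Qed.
Lemma Im0 : Im (0 : R[i]) = 0. Proof. by []. Qed.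

Lemma Re_sum (I : Type) (s : seq I) (P : pred I) (F : I -> R[i]) :
  Re (\sum_(i <- s | P i) F i) = \sum_(i <- s | P i) Re (F i).
Proof. exact: (big_morph (@complex.Re R) ReD Re0). Qed.

Lemma Im_sum (I : Type) (s : seq I) (P : pred I) (F : I -> R[i]) :
  Im (\sum_(i <- s | P i) F i) = \sum_(i <- s | P i) Im (F i).
Proof. exact: (big_morph (@complex.Im R) ImD Im0). Qed.

Lemma Re_mul_conj z : Re (z * (z^*)%R) = cabs z ^+ 2.
Proof. by rewrite cabs_sqr ReM Re_conj Im_conj mulrN opprK !expr2. Qed.

Lemma cabs_conj z : cabs (z^*)%R = cabs z.
Proof. by case: z => a b /=; rewrite sqrrN. Qed.

(** The topology of [R[i]^o] comes from the [R[i]]-valued norm; this brings it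
    down to real limits. *)
Lemma cvgC_cabs (T : Type) (F : set_system T) {FF : Filter F} (f : T -> R[i]) z :
  (f x : R[i]^o) @[x --> F] --> (z : R[i]^o) <->
  (cabs (f x - z) @[x --> F] --> (0 : R)).
Proof.
split.
- move=> /cvgrPdistC_lt h; apply/cvgrPdistC_lt => e e0.
  have e0' : (0 : R[i]) < e%:C by rewrite ltcR.
  near=> x; rewrite subr0 ger0_norm ?cabs_ge0//.
  rewrite -ltcR -normC_cabs.
  by near: x; exact: h.
- move=> /cvgrPdistC_lt h; apply/cvgrPdistC_lt => -[e e'] /=.
  rewrite ltcE /= => /andP[/eqP -> e0].
  near=> x; rewrite normC_cabs ltcR -[ltLHS]ger0_norm ?cabs_ge0// -[X in `|X|]subr0.
  by near: x; exact: h.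
Unshelve. all: by end_near.
Qed.

Lemma cvg_dist_le (T : Type) (F : set_system T) {FF : Filter F} (f g : T -> R) r :
  (forall k : T, `|f k - r| <= g k) -> g k @[k --> F] --> (0 : R) ->
  f k @[k --> F] --> r.
Proof.
move=> fg /cvgrPdistC_lt h; apply/cvgrPdistC_lt => e e0.
near=> x; apply: le_lt_trans (fg x) _.
rewrite -[ltLHS]ger0_norm ?(le_trans _ (fg x))// -[X in `|X|]subr0.
by near: x; exact: h.
Unshelve. all: by end_near.
Qed.

Lemma cvgC_ReIm (T : Type) (F : set_system T) {FF : Filter F} (f : T -> R[i]) z :
  (f x : R[i]^o) @[x --> F] --> (z : R[i]^o) <->
  (Re (f x) @[x --> F] --> Re z /\ Im (f x) @[x --> F] --> Im z).
Proof.
split.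
- move=> /cvgC_cabs h; split; apply: (cvg_dist_le _ h) => x.
    by rewrite -ReB Re_le_cabs.
  by rewrite -ImB Im_le_cabs.
- move=> [hr hi]; apply/cvgC_cabs.
  have h0 : `|Re (f x) - Re z| + `|Im (f x) - Im z| @[x --> F] --> (0 : R).
    rewrite -[X in _ --> X]addr0; apply: cvgD; apply/norm_cvg0P.
      by rewrite -(subrr (Re z)); apply: cvgB => //; exact: cvg_cst.
    by rewrite -(subrr (Im z)); apply: cvgB => //; exact: cvg_cst.
  apply: (squeeze_cvgr _ _ h0); last exact: cvg_cst.
  near=> x; rewrite cabs_ge0 /= -ReB -ImB; exact: cabs_le_ReIm.
Unshelve. all: by end_near.
Qed.

(** ** Polar coordinates *)

Definition polar r t : R[i] := (r * cos t) +i* (r * sin t).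

Lemma cabs_polar r t : cabs (polar r t) = `|r|.
Proof. by rewrite /= !exprMn -mulrDr cos2Dsin2 mulr1 sqrtr_sqr. Qed.

Lemma polarM r s t u : polar r s * polar t u = polar (r * t) (s + u).
Proof. by apply: eqC; rewrite /polar ?ReM ?ImM /= ?cosD ?sinD; ring. Qed.

Lemma polarX r t n : polar r t ^+ n = polar (r ^+ n) (t *+ n).
Proof.
elim: n => [|n IH]; first by rewrite !expr0 mulr0n /polar cos0 sin0 mulr1 mulr0.
by rewrite exprS IH polarM -exprS mulrS.
Qed.

Lemma polar_mul r t : polar r t = r%:C * polar 1 t.
Proof. by apply: eqC; rewrite ?ReM ?ImM /=; ring. Qed.

Lemma polarD2pi r t : polar r (t + pi *+ 2) = polar r t.
Proof. by rewrite /polar cosD sinD cos2pi sin2pi !mulr1 !mulr0 subr0 addr0. Qed.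

Lemma polar_eq0 r t : polar r t = 0 -> r = 0.
Proof. by move=> h; apply/eqP; rewrite -normr_eq0 -(cabs_polar r t) h cabs0. Qed.

Lemma polar_exists z : exists2 t, - pi <= t <= pi & z = polar (cabs z) t.
Proof.
have [->|z0] := eqVneq z 0.
  exists 0; first by rewrite oppr_le0 !pi_ge0.
  by rewrite cabs0 /polar !mul0r.
set r := cabs z; have r0 : 0 < r by exact: cabs_gt0.
have hc : -1 <= Re z / r <= 1.
  by rewrite -ler_norml normrM normfV (gtr0_norm r0) ler_pdivrMr// mul1r Re_le_cabs.
have sE : r * Num.sqrt (1 - (Re z / r) ^+ 2) = `|Im z|.
  rewrite -[X in X * _](gtr0_norm r0) -[X in X * _]sqrtr_sqr -sqrtrM ?sqr_ge0//.
  rewrite -sqrtr_sqr; congr Num.sqrt.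
  rewrite mulrBr mulr1 exprMn exprVn mulrCA divff ?mulr1 ?expf_neq0 ?gt_eqF//.
  by rewrite cabs_sqr addrAC subrr add0r.
have [i0|i0] := leP 0 (Im z).
  exists (acos (Re z / r)).
    rewrite acos_lepi// andbT (le_trans _ (acos_ge0 hc))//.
    by rewrite oppr_le0 pi_ge0.
  rewrite /polar acosK ?in_itv//= sin_acos// sE ger0_norm// mulrCA divff ?gt_eqF//.
  by rewrite mulr1; case: (z).
exists (- acos (Re z / r)).
  rewrite lerN2 acos_lepi//= (le_trans _ (pi_ge0 _))//.
  by rewrite oppr_le0 acos_ge0.
rewrite /polar cosN sinN acosK ?in_itv//= sin_acos// mulrN sE ltr0_norm// opprK.
by rewrite mulrCA divff ?gt_eqF// mulr1; case: (z).
Qed.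

End complex_numbers.

(** * Integrals of continuous functions over segments *)

Section segment_integral.
Variable R : realType.
Implicit Types (f g : R -> R) (a b c k : R).

Definition sint a b f : R := \int[@lebesgue_measure R]_(x in `[a, b]) f x.

Lemma sint_integrable a b f : {within `[a, b], continuous f} ->
  (@lebesgue_measure R).-integrable `[a, b] (EFin \o f).
Proof. by move=> h; apply: continuous_compact_integrable h; exact: segment_compact. Qed.

Lemma within_sub a b c k f : a <= c -> k <= b ->
  {within `[a, b], continuous f} -> {within `[c, k], continuous f}.
Proof.
move=> ac kb; apply: continuous_subspaceW => x /=; rewrite !in_itv /=.
by move=> /andP[cx xk]; rewrite (le_trans ac cx) (le_trans xk kb).
Qed.

Lemma within_cst a b k : {within `[a, b], continuous (fun _ : R => k)}.
Proof. by apply: continuous_subspaceT => x; exact: cvg_cst. Qed.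

Lemma within_B a b f g : {within `[a, b], continuous f} ->
  {within `[a, b], continuous g} -> {within `[a, b], continuous (fun x => f x - g x)}.
Proof. by move=> hf hg x; apply: (@continuousB _ R^o); [exact: hf|exact: hg]. Qed.

Lemma within_Z a b k f : {within `[a, b], continuous f} ->
  {within `[a, b], continuous (fun x => k * f x)}.
Proof. by move=> hf x; apply: continuousM; [exact: cvg_cst|exact: hf]. Qed.

Lemma sint_split a b c f : a <= c -> c <= b -> {within `[a, b], continuous f} ->
  sint a b f = sint a c f + sint c b f.
Proof.
move=> ac cb hf; have hi := sint_integrable hf.
have /eqP := Rintegral_itvB hi (ac : (BLeft a <= BRight c)%O) (cb : (BRight c <= BRight b)%O).
rewrite /sint subr_eq => /eqP ->; rewrite addrC; congr (_ + _).
rewrite Rintegral_itv_obnd_cbnd//; apply: integrableS hi => //.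
move=> x /=; rewrite !in_itv /= => /andP[cx ->]; rewrite andbT.
by rewrite (le_trans ac (ltW cx)).
Qed.

Lemma sintD a b f g : {within `[a, b], continuous f} ->
  {within `[a, b], continuous g} -> sint a b (fun x => f x + g x) = sint a b f + sint a b g.
Proof. by move=> /sint_integrable hf /sint_integrable hg; exact: RintegralD. Qed.

Lemma sintB a b f g : {within `[a, b], continuous f} ->
  {within `[a, b], continuous g} -> sint a b (fun x => f x - g x) = sint a b f - sint a b g.
Proof. by move=> /sint_integrable hf /sint_integrable hg; exact: RintegralB. Qed.

Lemma sintZ a b k f : {within `[a, b], continuous f} ->
  sint a b (fun x => k * f x) = k * sint a b f.
Proof. by move=> /sint_integrable hf; exact: RintegralZl. Qed.

Lemma sint_cst a b k : a <= b -> sint a b (fun=> k) = k * (b - a).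
Proof.
move=> ab; rewrite /sint Rintegral_cst//= lebesgue_measure_itv/= lte_fin.
move: ab; rewrite le_eqVlt => /orP[/eqP ->|->]//=.
by rewrite ltxx subrr.
Qed.

Lemma sint_eq a b f g : (forall x, a <= x <= b -> f x = g x) -> sint a b f = sint a b g.
Proof. by move=> h; apply: eq_Rintegral => x; rewrite inE /= in_itv /=; exact: h. Qed.

Lemma le_sint a b f g : {within `[a, b], continuous f} ->
  {within `[a, b], continuous g} -> (forall x, a <= x <= b -> f x <= g x) ->
  sint a b f <= sint a b g.
Proof.
move=> /sint_integrable hf /sint_integrable hg h; exact: le_Rintegral.
Qed.

Lemma sint_norm_le a b k f : a <= b -> {within `[a, b], continuous f} ->
  (forall x, a <= x <= b -> `|f x| <= k) -> `|sint a b f| <= k * (b - a).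
Proof.
move=> ab hf h; rewrite ler_norml -mulNr -!sint_cst//; apply/andP; split.
  apply: le_sint => //; first exact: within_cst.
  by move=> x /h; rewrite ler_norml => /andP[].
apply: le_sint => //; first exact: within_cst.
by move=> x /h; rewrite ler_norml => /andP[].
Qed.

End segment_integral.

(** * Goursat's theorem on rectangles *)

Section goursat.
Variable R : realType.
Variables (u v : R -> R -> R) (a0 b0 c0 d0 : R).

(** The real part of the integral of [u + i v] along the boundary of the rectangle,
    counterclockwise; replacing [u + i v] by [- i (u + i v)] yields the imaginary
    part. *)
Definition rect_int (a b c d : R) : R :=
  sint a b (fun x => u x c - u x d) - sint c d (fun y => v b y - v a y).

(** Complex differentiability of [u + i v], with derivative [A + i B], in the form
    that the Cauchy-Riemann equations give to the real differentials. *)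
Definition cr_at (x0 y0 : R) : Prop :=
  exists A B, forall e, 0 < e -> exists2 r, 0 < r &
    forall x y, a0 <= x <= b0 -> c0 <= y <= d0 -> `|x - x0| < r -> `|y - y0| < r ->
      `|u x y - u x0 y0 - A * (x - x0) + B * (y - y0)| <= e * (`|x - x0| + `|y - y0|) /\
      `|v x y - v x0 y0 - B * (x - x0) - A * (y - y0)| <= e * (`|x - x0| + `|y - y0|).

Hypothesis hu : forall y, c0 <= y <= d0 -> {within `[a0, b0], continuous (u ^~ y)}.
Hypothesis hv : forall x, a0 <= x <= b0 -> {within `[c0, d0], continuous (v x)}.

Lemma rect_int_splitx a m b c d :
  a0 <= a -> a <= m -> m <= b -> b <= b0 -> c0 <= c -> c <= d -> d <= d0 ->
  rect_int a b c d = rect_int a m c d + rect_int m b c d.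
Proof.
move=> h1 h2 h3 h4 h5 h6 h7; rewrite /rect_int.
have hU : {within `[a, b], continuous (fun x => u x c - u x d)}.
  apply: within_B; apply: within_sub (hu _) => //; apply/andP; split => //.
    exact: le_trans h6 h7.
  exact: le_trans h5 h6.
have hV z : a <= z <= b -> {within `[c, d], continuous (v z)}.
  move=> /andP[z1 z2]; apply: within_sub (hv _) => //.
  by rewrite (le_trans h1 z1) (le_trans z2 h4).
rewrite (sint_split h2 h3 hU).
have ab := le_trans h2 h3.
rewrite (sintB (hV b _) (hV a _)) ?lexx ?ab// (sintB (hV m _) (hV a _)) ?lexx ?ab ?h2//.
rewrite (sintB (hV b _) (hV m _)) ?lexx ?ab ?h2//.
ring.
Qed.

Lemma rect_int_splity a b c m d :
  a0 <= a -> a <= b -> b <= b0 -> c0 <= c -> c <= m -> m <= d -> d <= d0 ->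
  rect_int a b c d = rect_int a b c m + rect_int a b m d.
Proof.
move=> h1 h2 h3 h4 h5 h6 h7; rewrite /rect_int.
have hV : {within `[c, d], continuous (fun y => v b y - v a y)}.
  apply: within_B; apply: within_sub (hv _) => //; apply/andP; split => //.
    exact: le_trans h1 h2.
  exact: le_trans h2 h3.
have hU z : c <= z <= d -> {within `[a, b], continuous (u ^~ z)}.
  move=> /andP[z1 z2]; apply: within_sub (hu _) => //.
  by rewrite (le_trans h4 z1) (le_trans z2 h7).
rewrite (sint_split h5 h6 hV).
have cd := le_trans h5 h6.
rewrite (sintB (hU c _) (hU d _)) ?lexx ?cd// (sintB (hU c _) (hU m _)) ?lexx ?cd ?h5//.
rewrite (sintB (hU m _) (hU d _)) ?lexx ?cd ?h5//.
ring.
Qed.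

(** The affine part of the integrand contributes nothing: its differences across
    the rectangle are constants, whose integrals [B * (d - c) * (b - a)] cancel. *)
Lemma rect_int_local x0 y0 : cr_at x0 y0 -> forall e, 0 < e -> exists2 r, 0 < r &
  forall a b c d, a0 <= a -> a <= x0 -> x0 <= b -> b <= b0 ->
    c0 <= c -> c <= y0 -> y0 <= d -> d <= d0 -> b - a < r -> d - c < r ->
    `|rect_int a b c d| <= 2 * e * ((b - a) + (d - c)) ^+ 2.
Proof.
move=> [A [B h]] e e0; have [r r0 {}h] := h _ e0; exists r => //.
move=> a b c d h1 h2 h3 h4 h5 h6 h7 h8 hba hdc.
have ab := le_trans h2 h3; have cd := le_trans h6 h7.
set w := (b - a) + (d - c).
have E x y : a <= x <= b -> c <= y <= d ->
  `|u x y - u x0 y0 - A * (x - x0) + B * (y - y0)| <= e * w /\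
  `|v x y - v x0 y0 - B * (x - x0) - A * (y - y0)| <= e * w.
  move=> /andP[x1 x2] /andP[y1 y2].
  have hx : `|x - x0| <= b - a by rewrite ler_norml; lra.
  have hy : `|y - y0| <= d - c by rewrite ler_norml; lra.
  have hxy : e * (`|x - x0| + `|y - y0|) <= e * w.
    by rewrite ler_wpM2l ?(ltW e0)//; exact: lerD hx hy.
  have [k1 k2] : `|u x y - u x0 y0 - A * (x - x0) + B * (y - y0)| <= e * (`|x - x0| + `|y - y0|) /\
      `|v x y - v x0 y0 - B * (x - x0) - A * (y - y0)| <= e * (`|x - x0| + `|y - y0|).
    by apply: h; rewrite ?(le_trans h1 x1) ?(le_trans x2 h4) ?(le_trans h5 y1)
      ?(le_trans y2 h8) ?(le_lt_trans hx) ?(le_lt_trans hy).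
  by split; apply: le_trans hxy.
have hU : {within `[a, b], continuous (fun x => u x c - u x d)}.
  apply: within_B; apply: within_sub (hu _) => //; apply/andP; split => //.
    exact: le_trans cd h8.
  exact: le_trans h5 cd.
have hV : {within `[c, d], continuous (fun y => v b y - v a y)}.
  apply: within_B; apply: within_sub (hv _) => //; apply/andP; split => //.
    exact: le_trans h1 ab.
  exact: le_trans ab h4.
have I1 : `|sint a b (fun x => u x c - u x d) - B * (d - c) * (b - a)| <= 2 * e * w * (b - a).
  rewrite -sint_cst// -sintB//; last exact: within_cst.
  apply: sint_norm_le => //; first by apply: within_B => //; exact: within_cst.
  move=> x hx; have [k1 _] := E x c hx (introT andP (conj (lexx _) cd)).
  have [k2 _] := E x d hx (introT andP (conj cd (lexx _))).
  by move: k1 k2; rewrite !ler_norml => /andP[? ?] /andP[? ?]; lra.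
have I2 : `|sint c d (fun y => v b y - v a y) - B * (b - a) * (d - c)| <= 2 * e * w * (d - c).
  rewrite -sint_cst// -sintB//; last exact: within_cst.
  apply: sint_norm_le => //; first by apply: within_B => //; exact: within_cst.
  move=> y hy; have [_ k1] := E a y (introT andP (conj (lexx _) ab)) hy.
  have [_ k2] := E b y (introT andP (conj ab (lexx _))) hy.
  by move: k1 k2; rewrite !ler_norml => /andP[? ?] /andP[? ?]; lra.
have -> : 2 * e * w ^+ 2 = 2 * e * w * (b - a) + 2 * e * w * (d - c).
  by rewrite /w; ring.
rewrite /rect_int; move: I1 I2.
have -> : B * (b - a) * (d - c) = B * (d - c) * (b - a) by ring.
by rewrite !ler_norml => /andP[? ?] /andP[? ?]; lra.
Qed.

Let rect := (R * R * R * R)%type.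
Let inside (q : rect) : Prop := let: (a, b, c, d) := q in
  [/\ a0 <= a, a <= b, b <= b0 & [/\ c0 <= c, c <= d & d <= d0]].
Let phi (q : rect) : R := let: (a, b, c, d) := q in rect_int a b c d.
Let half (q q' : rect) : Prop :=
  let: (a, b, c, d) := q in let: (a', b', c', d') := q' in
  [/\ a <= a', b' <= b, c <= c' & d' <= d] /\
  [/\ b' - a' = (b - a) / 2, d' - c' = (d - c) / 2 & `|phi q| <= 4 * `|phi q'|].

Let quarter q : inside q -> exists2 q', inside q' & half q q'.
Proof.
move: q => [[[a b] c] d] [h1 h2 h3 [h4 h5 h6]].
pose m := (a + b) / 2; pose n := (c + d) / 2.
have [am mb] : a <= m /\ m <= b by rewrite /m; lra.
have [cn nd] : c <= n /\ n <= d by rewrite /n; lra.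
have E : phi (a, b, c, d) = phi (a, m, c, n) + phi (a, m, n, d)
    + (phi (m, b, c, n) + phi (m, b, n, d)).
  rewrite /phi (rect_int_splitx (m := m))//.
  rewrite (rect_int_splity (c := c) (m := n) (d := d) (a := a))//; last exact: le_trans mb h3.
  by rewrite (rect_int_splity (c := c) (m := n) (d := d) (a := m))//; exact: le_trans h1 am.
have in1 : inside (a, m, c, n) by split=> //; [exact: le_trans mb h3|split => //; exact: le_trans nd h6].
have in2 : inside (a, m, n, d) by split=> //; [exact: le_trans mb h3|split => //; exact: le_trans h4 cn].
have in3 : inside (m, b, c, n) by split=> //; [exact: le_trans h1 am|split => //; exact: le_trans nd h6].
have in4 : inside (m, b, n, d) by split=> //; [exact: le_trans h1 am|split => //; exact: le_trans h4 cn].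
have w1 : m - a = (b - a) / 2 by rewrite /m; lra.
have w2 : b - m = (b - a) / 2 by rewrite /m; lra.
have w3 : n - c = (d - c) / 2 by rewrite /n; lra.
have w4 : d - n = (d - c) / 2 by rewrite /n; lra.
have [k1|k1] := leP `|phi (a, b, c, d)| (4 * `|phi (a, m, c, n)|).
  by exists (a, m, c, n).
have [k2|k2] := leP `|phi (a, b, c, d)| (4 * `|phi (a, m, n, d)|).
  by exists (a, m, n, d).
have [k3|k3] := leP `|phi (a, b, c, d)| (4 * `|phi (m, b, c, n)|).
  by exists (m, b, c, n).
have [k4|k4] := leP `|phi (a, b, c, d)| (4 * `|phi (m, b, n, d)|).
  by exists (m, b, n, d).
exfalso; move: k1 k2 k3 k4; rewrite E => k1 k2 k3 k4.
have := ler_normD (phi (a, m, c, n) + phi (a, m, n, d)) (phi (m, b, c, n) + phi (m, b, n, d)).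
have := ler_normD (phi (a, m, c, n)) (phi (a, m, n, d)).
have := ler_normD (phi (m, b, c, n)) (phi (m, b, n, d)).
lra.
Qed.

(** Goursat: quarter the rectangle repeatedly, keeping a quarter whose boundary
    integral is at least a fourth of the previous one.  At the point common to
    all these rectangles [rect_int_local] contradicts that lower bound. *)
Lemma goursat : a0 <= b0 -> c0 <= d0 ->
  (forall x y, a0 <= x <= b0 -> c0 <= y <= d0 -> cr_at x y) ->
  rect_int a0 b0 c0 d0 = 0.
Proof.
move=> ab cd hcr.
have [F HF] : {F : rect -> rect & forall q, inside q -> inside (F q) /\ half q (F q)}.
  apply: (@boolp.choice _ _ (fun q q' => inside q -> inside q' /\ half q q')) => q.
  have [hq|hq] := pselect (inside q); last by exists q.
  by have [q' ? ?] := quarter hq; exists q'.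
pose q n := iter n F (a0, b0, c0, d0).
have q_in n : inside (q n).
  elim: n => [|n IH]; first by do !split.
  by have [] := HF _ IH.
have q_half n : half (q n) (q n.+1) by have [] := HF _ (q_in n).
pose a n := (q n).1.1.1; pose b n := (q n).1.1.2; pose c n := (q n).1.2; pose d n := (q n).2.
have qE n : q n = (a n, b n, c n, d n) by rewrite /a /b /c /d; case: (q n) => [[[]]].
have IN n : [/\ a0 <= a n, a n <= b n, b n <= b0 & [/\ c0 <= c n, c n <= d n & d n <= d0]].
  by have := q_in n; rewrite qE.
have HA n : [/\ a n <= a n.+1, b n.+1 <= b n, c n <= c n.+1 & d n.+1 <= d n] /\
  [/\ b n.+1 - a n.+1 = (b n - a n) / 2, d n.+1 - c n.+1 = (d n - c n) / 2 &
     `|phi (q n)| <= 4 * `|phi (q n.+1)|].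
  by have := q_half n; rewrite {1 2}[q n]qE {1 2}[q n.+1]qE /half -!qE.
have nested (s t : nat -> R) : (forall n, s n <= s n.+1) -> (forall n, t n.+1 <= t n) ->
    (forall n, s n <= t n) -> exists x, forall n, s n <= x <= t n.
  move=> hs ht hst.
  have ns : nondecreasing_seq s by apply/nondecreasing_seqP.
  have nt : nonincreasing_seq t by apply/nonincreasing_seqP.
  have hle i j : s i <= t j.
    apply: le_trans (ns i (maxn i j) (leq_maxl _ _)) _.
    by apply: le_trans (hst _) _; exact: nt (leq_maxr _ _).
  have hub : has_sup (range s).
    by split; [exists (s 0%N), 0%N|exists (t 0%N) => _ [i _ <-]].
  exists (sup (range s)) => n; apply/andP; split.
    by apply: ub_le_sup; [case: hub|exists n].
  by apply: ge_sup; [case: hub|move=> _ [i _ <-]].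
have [x0 hx0] : exists x, forall n, a n <= x <= b n.
  apply: nested => n; first by have [[]] := HA n.
    by have [[]] := HA n.
  by have [] := IN n.
have [y0 hy0] : exists y, forall n, c n <= y <= d n.
  apply: nested => n; first by have [[]] := HA n.
    by have [[]] := HA n.
  by have [_ _ _ []] := IN n.
have wE n : b n - a n = (b0 - a0) / 2 ^+ n /\ d n - c n = (d0 - c0) / 2 ^+ n.
  elim: n => [|n [IH1 IH2]]; first by rewrite !expr0 !divr1.
  have [_ [-> -> _]] := HA n; rewrite IH1 IH2 !exprS !invfM.
  by split; ring.
have phiE n : `|phi (q 0%N)| <= 4 ^+ n * `|phi (q n)|.
  elim: n => [|n IH]; first by rewrite expr0 mul1r.
  apply: le_trans IH _; have [_ [_ _ h]] := HA n.
  by rewrite exprSr -mulrA ler_wpM2l// exprn_ge0.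
have x0in : a0 <= x0 <= b0 by have := hx0 0%N.
have y0in : c0 <= y0 <= d0 by have := hy0 0%N.
set W := (b0 - a0) + (d0 - c0).
suff small e : 0 < e -> `|phi (q 0%N)| <= 2 * e * W ^+ 2.
  apply/eqP; rewrite -normr_eq0; apply/eqP/le_anti; rewrite normr_ge0 andbT.
  apply/ler_addgt0Pr => e e0; rewrite add0r.
  have K0 : 0 < 2 * (W ^+ 2 + 1) by rewrite mulr_gt0// ltr_wpDl// sqr_ge0.
  have := small (e / (2 * (W ^+ 2 + 1))) (divr_gt0 e0 K0).
  move/le_trans; apply.
  set K := 2 * (W ^+ 2 + 1).
  have -> : 2 * (e / K) * W ^+ 2 = e * (2 * W ^+ 2 / K) by ring.
  by rewrite ger_pMr// ler_pdivrMr// mul1r /K ler_wpM2l// lerDl.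
move=> e0; have [r r0 Hr] := rect_int_local (hcr _ _ x0in y0in) e0.
have [n hn] : exists n, W / 2 ^+ n < r.
  have : (fun n => W * (2^-1) ^+ n) @ \oo --> (0 : R).
    rewrite -(mulr0 W); apply: cvgM; first exact: cvg_cst.
    by apply: cvg_expr; rewrite gtr0_norm ?invr_gt0// invf_lt1// ltr1n.
  move=> /cvgrPdistC_lt /(_ _ r0) [n _ /(_ n (leqnn _))] /= h.
  exists n; rewrite -exprVn; move: h; rewrite subr0; apply: le_lt_trans.
  exact: ler_norm.
have [w1 w2] := wE n.
have p2 : 0 < (2 : R) ^+ n by rewrite exprn_gt0.
have hb : b n - a n <= W / 2 ^+ n.
  by rewrite w1 ler_pM2r ?invr_gt0// /W lerDl subr_ge0.
have hd : d n - c n <= W / 2 ^+ n.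
  by rewrite w2 ler_pM2r ?invr_gt0// /W lerDr subr_ge0.
have [i1 i2 i3 [i4 i5 i6]] := IN n.
have /andP[j1 j2] := hx0 n; have /andP[j3 j4] := hy0 n.
have := Hr _ _ _ _ i1 j1 j2 i3 i4 j3 j4 i6 (le_lt_trans hb hn) (le_lt_trans hd hn).
rewrite w1 w2 -mulrDl -/W => h.
apply: le_trans (phiE n) _.
have -> : 2 * e * W ^+ 2 = 4 ^+ n * (2 * e * (W / 2 ^+ n) ^+ 2).
  have -> : (4 : R) = 2 * 2 by ring.
  by rewrite [(2 * 2) ^+ n]exprMn; field; rewrite expf_neq0.
by rewrite ler_wpM2l ?exprn_ge0// qE /phi.
Qed.

End goursat.

(** * Cauchy's theorem in logarithmic coordinates *)

Section complex_integral.
Variable R : realType.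
Implicit Types (F G : R -> R[i]) (a b c : R).

Definition ccontinuous F : Prop :=
  continuous (fun t => Re (F t)) /\ continuous (fun t => Im (F t)).

Definition cint a b F : R[i] :=
  sint a b (fun t => Re (F t)) +i* sint a b (fun t => Im (F t)).

Lemma ccontinuous_cst (z : R[i]) : ccontinuous (fun=> z).
Proof. by split=> t; exact: cvg_cst. Qed.

Lemma ccontinuousD F G : ccontinuous F -> ccontinuous G ->
  ccontinuous (fun t => F t + G t).
Proof.
move=> [F1 F2] [G1 G2]; split.
  under eq_fun do rewrite ReD; by move=> t; apply: cvgD; [exact: F1|exact: G1].
under eq_fun do rewrite ImD; by move=> t; apply: cvgD; [exact: F2|exact: G2].
Qed.

Lemma ccontinuousM F G : ccontinuous F -> ccontinuous G ->
  ccontinuous (fun t => F t * G t).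
Proof.
move=> [F1 F2] [G1 G2]; split.
  under eq_fun do rewrite ReM; move=> t; apply: cvgB; apply: cvgM;
    by [exact: F1|exact: F2|exact: G1|exact: G2].
under eq_fun do rewrite ImM; move=> t; apply: cvgD; apply: cvgM;
  by [exact: F1|exact: F2|exact: G1|exact: G2].
Qed.

Lemma ccontinuousZ z F : ccontinuous F -> ccontinuous (fun t => z * F t).
Proof. by move=> hF; apply: ccontinuousM => //; exact: ccontinuous_cst. Qed.

Lemma ccontinuousX n F : ccontinuous F -> ccontinuous (fun t => F t ^+ n).
Proof.
move=> hF; elim: n => [|n IH]; first exact: ccontinuous_cst.
by under eq_fun do rewrite exprS; exact: ccontinuousM.
Qed.

Lemma ccontinuous_sum (I : Type) (s : seq I) (F : I -> R -> R[i]) :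
  (forall i, ccontinuous (F i)) -> ccontinuous (fun t => \sum_(i <- s) F i t).
Proof.
move=> hF; elim: s => [|i s IH].
  by under eq_fun do rewrite big_nil; exact: ccontinuous_cst.
by under eq_fun do rewrite big_cons; exact: ccontinuousD.
Qed.

Lemma ccontinuous_within a b F : ccontinuous F ->
  {within `[a, b], continuous (fun t => Re (F t))} /\
  {within `[a, b], continuous (fun t => Im (F t))}.
Proof. by move=> [h1 h2]; split; exact: continuous_subspaceT. Qed.

Lemma cintD a b F G : ccontinuous F -> ccontinuous G ->
  cint a b (fun t => F t + G t) = cint a b F + cint a b G.
Proof.
move=> /(ccontinuous_within a b)[F1 F2] /(ccontinuous_within a b)[G1 G2].
apply: eqC; rewrite ?ReD ?ImD /=.
  by rewrite -sintD//; apply: sint_eq => x _; rewrite ReD.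
by rewrite -sintD//; apply: sint_eq => x _; rewrite ImD.
Qed.

Lemma cintZ a b z F : ccontinuous F ->
  cint a b (fun t => z * F t) = z * cint a b F.
Proof.
move=> /(ccontinuous_within a b)[F1 F2].
apply: eqC; rewrite ?ReM ?ImM /=.
  rewrite -!sintZ// -sintB; [|exact: within_Z..].
  by apply: sint_eq => x _; rewrite ReM.
rewrite -!sintZ// -sintD; [|exact: within_Z..].
by apply: sint_eq => x _; rewrite ImM.
Qed.

Lemma cint_cst a b z : a <= b -> cint a b (fun=> z) = z * (b - a)%:C.
Proof.
move=> ab; rewrite /cint !sint_cst//; case: z => x y.
by apply: eqC; rewrite ?ReM ?ImM /=; ring.
Qed.

Lemma cint_sum (I : Type) (s : seq I) a b (F : I -> R -> R[i]) : a <= b ->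
  (forall i, ccontinuous (F i)) ->
  cint a b (fun t => \sum_(i <- s) F i t) = \sum_(i <- s) cint a b (F i).
Proof.
move=> ab hF; elim: s => [|i s IH].
  by under eq_fun do rewrite big_nil; rewrite big_nil cint_cst// mul0r.
under eq_fun do rewrite big_cons; rewrite big_cons -IH cintD//.
exact: ccontinuous_sum.
Qed.

Lemma cint_eq a b F G : (forall t, a <= t <= b -> F t = G t) -> cint a b F = cint a b G.
Proof. by move=> h; congr (_ +i* _); apply: sint_eq => t /h ->. Qed.

(** The factor [2] stems from estimating real and imaginary parts separately. *)
Lemma cint_cabs_le a b c F : a <= b -> ccontinuous F ->
  (forall t, a <= t <= b -> cabs (F t) <= c) -> cabs (cint a b F) <= 2 * c * (b - a).
Proof.
move=> ab /(ccontinuous_within a b)[F1 F2] h; apply: le_trans (cabs_le_ReIm _) _.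
rewrite -mulrA mulr_natl mulr2n; apply: lerD; apply: sint_norm_le => // t /h.
  exact: le_trans (Re_le_cabs _).
exact: le_trans (Im_le_cabs _).
Qed.

End complex_integral.

Section log_coordinates.
Variable R : realType.
Implicit Types (G : R -> R -> R[i]) (z w : R[i]) (x y s t : R).

(** [G x y] stands for a function of [x + i y]. *)
Definition jcont G x0 y0 : Prop := forall e, 0 < e -> exists2 r, 0 < r &
  forall x y, `|x - x0| < r -> `|y - y0| < r -> cabs (G x y - G x0 y0) < e.

Definition cdiff G x0 y0 : Prop := exists D : R[i], forall e, 0 < e -> exists2 r, 0 < r &
  forall x y, `|x - x0| < r -> `|y - y0| < r ->
    cabs (G x y - G x0 y0 - D * ((x - x0) +i* (y - y0))) <= e * (`|x - x0| + `|y - y0|).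

Lemma cdiffZ z G x0 y0 : cdiff G x0 y0 -> cdiff (fun x y => z * G x y) x0 y0.
Proof.
move=> [D h]; exists (z * D) => e e0.
have c0 : 0 < cabs z + 1 by rewrite ltr_wpDl ?cabs_ge0.
have [r r0 {}h] := h (e / (cabs z + 1)) (divr_gt0 e0 c0).
exists r => // x y hx hy; rewrite -mulrA -!mulrBr cabsM.
apply: le_trans (ler_wpM2l (cabs_ge0 z) (h _ _ hx hy)) _.
rewrite mulrA ler_wpM2r ?addr_ge0// mulrCA ger_pMr// ler_pdivrMr// mul1r lerDl.
exact: ler01.
Qed.

Lemma cdiff_cr G a b c d x0 y0 : cdiff G x0 y0 ->
  cr_at (fun x y => Re (G x y)) (fun x y => Im (G x y)) a b c d x0 y0.
Proof.
move=> [[A B] h]; exists A, B => e e0; have [r r0 {}h] := h e e0; exists r => //.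
move=> x y _ _ hx hy; have {}h := h x y hx hy.
split; apply: le_trans h.
  apply: le_trans (Re_le_cabs _); rewrite !ReB ReM /=.
  by rewrite le_eqVlt; apply/orP; left; apply/eqP; congr `|_|; ring.
apply: le_trans (Im_le_cabs _); rewrite !ImB ImM /=.
by rewrite le_eqVlt; apply/orP; left; apply/eqP; congr `|_|; ring.
Qed.

Lemma jcontZ z G x0 y0 : jcont G x0 y0 -> jcont (fun x y => z * G x y) x0 y0.
Proof.
move=> h e e0; have c0 : 0 < cabs z + 1 by rewrite ltr_wpDl ?cabs_ge0.
have [r r0 {}h] := h (e / (cabs z + 1)) (divr_gt0 e0 c0).
exists r => // x y hx hy; rewrite -mulrBr cabsM.
apply: le_lt_trans (ler_wpM2l (cabs_ge0 z) (ltW (h _ _ hx hy))) _.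
by rewrite mulrCA gtr_pMr// ltr_pdivrMr// mul1r ltrDl.
Qed.

Lemma jcont_x G x0 y0 : jcont G x0 y0 -> {for x0, continuous (fun x => Re (G x y0))}.
Proof.
move=> h; apply/cvgrPdistC_lt => e e0; have [r r0 {}h] := h e e0.
near=> x; rewrite -ReB; apply: le_lt_trans (Re_le_cabs _) _; apply: h.
  by near: x; apply: filterS (nbhsx_ballx (x0 : R) _ r0) => z; rewrite /ball/= distrC.
by rewrite subrr normr0.
Unshelve. all: by end_near.
Qed.

Lemma jcont_y G x0 y0 : jcont G x0 y0 -> {for y0, continuous (fun y => Im (G x0 y))}.
Proof.
move=> h; apply/cvgrPdistC_lt => e e0; have [r r0 {}h] := h e e0.
near=> x; rewrite -ImB; apply: le_lt_trans (Im_le_cabs _) _; apply: h.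
  by rewrite subrr normr0.
by near: x; apply: filterS (nbhsx_ballx (y0 : R) _ r0) => z; rewrite /ball/= distrC.
Unshelve. all: by end_near.
Qed.

(** Goursat with one point where only continuity is known: cutting out a small
    square around it leaves four rectangles with zero boundary integral, and the
    integral around the square is at most a constant times its side. *)
Lemma goursat_punctured G a b c d xs ys :
  a < xs < b -> c < ys < d ->
  (forall x y, a <= x <= b -> c <= y <= d -> jcont G x y) ->
  (forall x y, a <= x <= b -> c <= y <= d -> (x != xs) || (y != ys) -> cdiff G x y) ->
  rect_int (fun x y => Re (G x y)) (fun x y => Im (G x y)) a b c d = 0.
Proof.
move=> /andP[axs xsb] /andP[cys ysd] hj hd.
set u := fun x y => Re (G x y); set v := fun x y => Im (G x y).
have ab := lt_trans axs xsb; have cd := lt_trans cys ysd.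
have hu y : c <= y <= d -> {within `[a, b], continuous (u ^~ y)}.
  move=> hy; apply: continuous_in_subspaceT => x; rewrite inE/= in_itv /= => hx.
  by apply: jcont_x; exact: hj.
have hv x : a <= x <= b -> {within `[c, d], continuous (v x)}.
  move=> hx; apply: continuous_in_subspaceT => y; rewrite inE/= in_itv /= => hy.
  by apply: jcont_y; exact: hj.
have zero a' b' c' d' : a <= a' -> a' <= b' -> b' <= b -> c <= c' -> c' <= d' -> d' <= d ->
    (forall x y, a' <= x <= b' -> c' <= y <= d' -> (x != xs) || (y != ys)) ->
    rect_int u v a' b' c' d' = 0.
  move=> h1 h2 h3 h4 h5 h6 hne; apply: goursat => //.
  - move=> y /andP[y1 y2]; apply: within_sub (hu _ _) => //.
    by rewrite (le_trans h4 y1) (le_trans y2 h6).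
  - move=> x /andP[x1 x2]; apply: within_sub (hv _ _) => //.
    by rewrite (le_trans h1 x1) (le_trans x2 h3).
  - move=> x y hx hy; apply: cdiff_cr; apply: hd; last exact: hne.
      by case/andP: hx => x1 x2; rewrite (le_trans h1 x1) (le_trans x2 h3).
    by case/andP: hy => y1 y2; rewrite (le_trans h4 y1) (le_trans y2 h6).
have [r0 r00 hr0] : exists2 r, 0 < r & forall x y, `|x - xs| < r -> `|y - ys| < r ->
    cabs (G x y) <= cabs (G xs ys) + 1.
  have [] := hj xs ys _ _ 1 ltr01; rewrite ?(ltW axs) ?(ltW xsb) ?(ltW cys) ?(ltW ysd)//.
  move=> r ? h; exists r => // x y hx hy.
  rewrite -lerBlDl; apply: le_trans (ltW (h _ _ hx hy)).
  rewrite lerBlDr; apply: le_trans (cabsD _ _); by rewrite subrK.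
set C := cabs (G xs ys) + 1 in hr0.
have C0 : 0 < C by rewrite /C ltr_wpDl ?cabs_ge0.
pose m := Num.min r0 (Num.min (Num.min (xs - a) (b - xs)) (Num.min (ys - c) (d - ys))).
have m0 : 0 < m by rewrite !lt_min r00 !subr_gt0 axs xsb cys ysd.
(* Only the square of half side [e] around the exceptional point remains. *)
have small e : 0 < e -> e < m -> `|rect_int u v a b c d| <= 8 * C * e.
  move=> e0; rewrite !lt_min => /andP[er0 /andP[/andP[e1 e2] /andP[e3 e4]]].
  have [x1 x2 x3 [x4 x5 x6]] : [/\ a <= xs - e, xs - e <= xs + e, xs + e <= b &
      [/\ a <= xs + e, xs - e <= b & a <= b]].
    by clear -e0 e1 e2; do !split; lra.
  have [y1 y2 y3 [y4 y5 y6]] : [/\ c <= ys - e, ys - e <= ys + e, ys + e <= d &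
      [/\ c <= ys + e, ys - e <= d & c <= d]].
    by clear -e0 e3 e4; do !split; lra.
  have far (s t k : R) : k + e <= s \/ t <= k - e -> forall x, s <= x <= t -> x != k.
    by clear -e0 => st x hx; apply/eqP => h; move: hx; rewrite h; lra.
  have [aa [bb [cc dd]]] := (lexx a, (lexx b, (lexx c, lexx d))).
  rewrite (rect_int_splitx (m := xs - e) hu hv)//.
  rewrite (@rect_int_splitx _ u v a b c d hu hv (xs - e) (xs + e))//.
  rewrite (zero a (xs - e))//; last first.
    by move=> x y hx _; rewrite (far _ _ _ _ x hx)//; right.
  rewrite (zero (xs + e) b)//; last first.
    by move=> x y hx _; rewrite (far _ _ _ _ x hx)//; left.
  rewrite add0r addr0.
  rewrite (@rect_int_splity _ u v a b c d hu hv _ _ _ (ys - e))//.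
  rewrite (@rect_int_splity _ u v a b c d hu hv _ _ (ys - e) (ys + e))//.
  rewrite (zero (xs - e) (xs + e) c)//; last first.
    by move=> x y _ hy; rewrite (far _ _ _ _ y hy) ?orbT//; right.
  rewrite (zero (xs - e) (xs + e) (ys + e))//; last first.
    by move=> x y _ hy; rewrite (far _ _ _ _ y hy) ?orbT//; left.
  rewrite add0r addr0 /rect_int.
  have bnd x y : xs - e <= x <= xs + e -> ys - e <= y <= ys + e ->
      `|u x y| <= C /\ `|v x y| <= C.
    move=> hx hy; have h : cabs (G x y) <= C.
      by apply: hr0; clear -hx hy er0; rewrite ltr_norml; lra.
    by split; apply: le_trans h; [exact: Re_le_cabs|exact: Im_le_cabs].
  have I1 : `|sint (xs - e) (xs + e) (fun x => u x (ys - e) - u x (ys + e))| <=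
     (2 * C) * ((xs + e) - (xs - e)).
    apply: sint_norm_le => //.
      by apply: within_B; apply: within_sub (hu _ _) => //; apply/andP.
    move=> x hx; apply: le_trans (ler_normB _ _) _; rewrite mulr_natl mulr2n lerD//.
      by have [] := bnd x (ys - e) hx (introT andP (conj (lexx _) y2)).
    by have [] := bnd x (ys + e) hx (introT andP (conj y2 (lexx _))).
  have I2 : `|sint (ys - e) (ys + e) (fun y => v (xs + e) y - v (xs - e) y)| <=
     (2 * C) * ((ys + e) - (ys - e)).
    apply: sint_norm_le => //.
      by apply: within_B; apply: within_sub (hv _ _) => //; apply/andP.
    move=> y hy; apply: le_trans (ler_normB _ _) _; rewrite mulr_natl mulr2n lerD//.
      by have [] := bnd (xs + e) y (introT andP (conj x2 (lexx _))) hy.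
    by have [] := bnd (xs - e) y (introT andP (conj (lexx _) x2)) hy.
  apply: le_trans (ler_normB _ _) _; apply: le_trans (lerD I1 I2) _.
  by rewrite [leLHS](_ : _ = 8 * C * e)//; ring.
apply/eqP; rewrite -normr_eq0; apply/eqP/le_anti; rewrite normr_ge0 andbT.
apply/ler_addgt0Pr => e e0; rewrite add0r.
have C8 : 0 < 8 * C by rewrite mulr_gt0.
pose e' := Num.min (m / 2) (e / (8 * C)).
have e'0 : 0 < e' by rewrite lt_min !divr_gt0.
apply: le_trans (small e' e'0 _) _.
  rewrite (@le_lt_trans _ _ (m / 2))//; first by rewrite ge_min lexx.
  by rewrite ltr_pdivrMr// ltr_pMr// ltr1n.
by rewrite mulrC -ler_pdivlMr// ge_min lexx orbT.
Qed.

(** For a function of a logarithm, that is periodic in the vertical direction,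
    the horizontal sides cancel: circle means do not depend on the radius. *)
Lemma periodic_goursat G a b c d xs ys :
  a < xs < b -> c < ys < d -> (forall x, G x c = G x d) ->
  (forall x y, a <= x <= b -> c <= y <= d -> jcont G x y) ->
  (forall x y, a <= x <= b -> c <= y <= d -> (x != xs) || (y != ys) -> cdiff G x y) ->
  cint c d (G a) = cint c d (G b).
Proof.
move=> hx hy per hj hd.
have ab : a <= b by case/andP: hx => h1 h2; rewrite ltW// (lt_trans h1).
have cd : c <= d by case/andP: hy => h1 h2; rewrite ltW// (lt_trans h1).
have side (H : R -> R -> R[i]) : (forall x, H x c = H x d) ->
    (forall x y, a <= x <= b -> c <= y <= d -> jcont H x y) ->
    (forall x y, a <= x <= b -> c <= y <= d -> (x != xs) || (y != ys) -> cdiff H x y) ->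
    sint c d (fun y => Im (H a y)) = sint c d (fun y => Im (H b y)).
  move=> hper hHj hHd; have := goursat_punctured hx hy hHj hHd.
  rewrite /rect_int.
  under [X in X - _]sint_eq do rewrite hper subrr.
  rewrite sint_cst// mul0r sub0r sintB.
  - by move/eqP; rewrite oppr_eq0 subr_eq0 => /eqP ->.
  - apply: continuous_in_subspaceT => y; rewrite inE/= in_itv /= => hy'.
    by apply: (@jcont_y H b); apply: hHj => //; rewrite ab lexx.
  - apply: continuous_in_subspaceT => y; rewrite inE/= in_itv /= => hy'.
    by apply: (@jcont_y H a); apply: hHj => //; rewrite ab lexx.
(* Boundary integrals of [G] and of [i G] give imaginary and real parts of the sides. *)
congr (_ +i* _); last exact: side.
have := side (fun x y => 'i * G x y).
have E H : sint c d (fun y => Im ('i * H y)) = sint c d (fun y => Re (H y)).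
  by apply: sint_eq => y _; rewrite ImM /= mul0r add0r mul1r.
rewrite !E; apply.
- by move=> x; rewrite per.
- by move=> x y ? ?; apply: jcontZ; exact: hj.
- by move=> x y ? ? ?; apply: cdiffZ; exact: hd.
Qed.

End log_coordinates.

(** * Bounded holomorphic functions on the disc are power series *)

Section differentials.

(** Derivatives without division: in this form they compose with the exponential
    and apply to real and complex functions alike. *)
Lemma derivable_first_order (K : numFieldType) (f : K^o -> K^o) (w : K) :
  derivable f w 1 -> forall e, 0 < e ->
  \forall h \near nbhs (0 : K^o), `|f (h + w) - f w - 'D_1 f w * h| <= e * `|h|.
Proof.
move=> df e e0.
have : h^-1 *: (f (h *: (1 : K^o) + w) - f w) @[h --> (0:K^o)^'] --> 'D_1 f w by exact: df.
move=> /cvgrPdistC_le /(_ _ e0); rewrite /dnbhs near_withinE => h.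
near=> k.
have [->|k0] := eqVneq k 0; first by rewrite add0r subrr mulr0 subrr normr0 mulr0.
have : `|k^-1 *: (f (k *: (1 : K^o) + w) - f w) - 'D_1 f w| <= e.
  by move: (k0); near: k; exact: h.
rewrite (_ : k *: (1 : K^o) = k); last by rewrite /GRing.scale /= mulr1.
move=> h'; have -> : f (k + w) - f w - 'D_1 f w * k = k * (k^-1 *: (f (k + w) - f w) - 'D_1 f w).
  by rewrite mulrBr /GRing.scale /= mulrA divff// mul1r; congr (_ - _); rewrite mulrC.
by rewrite normrM mulrC ler_wpM2r.
Unshelve. all: by end_near.
Qed.

Context {R : realType}.
Implicit Types (f g : R[i] -> R[i]) (z w : R[i]).

Definition hol_at f w : Prop := exists D, forall e, 0 < e -> exists2 r, 0 < r &
  forall z, cabs (z - w) < r -> cabs (f z - f w - D * (z - w)) <= e * cabs (z - w).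

Definition ccont_at f w : Prop := forall e, 0 < e -> exists2 r, 0 < r &
  forall z, cabs (z - w) < r -> cabs (f z - f w) < e.

Lemma nbhs0_real (P : R -> Prop) : (\forall h \near nbhs (0 : R^o), P h) ->
  exists2 r, 0 < r & forall h, `|h| < r -> P h.
Proof.
move=> /nbhs_ballP[r /= r0 h]; exists r => // k hk; apply: h.
by rewrite /ball /= sub0r normrN.
Qed.

Lemma nbhs0_complex (P : R[i] -> Prop) : (\forall h \near nbhs (0 : R[i]^o), P h) ->
  exists2 r, 0 < r & forall h, cabs h < r -> P h.
Proof.
move=> /nbhs_ballP[[r r'] /=]; rewrite ltcE /= => /andP[/eqP -> r0] h.
exists r => // k hk; apply: h.
by rewrite /ball /= sub0r normrN normC_cabs ltcR.
Qed.

Lemma derivable_eps (f : R -> R) (x : R) : derivable f x 1 -> forall e, 0 < e ->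
  exists2 r, 0 < r & forall h, `|h| < r -> `|f (h + x) - f x - 'D_1 f x * h| <= e * `|h|.
Proof. by move=> df e e0; apply: nbhs0_real; exact: derivable_first_order. Qed.

Lemma derivable_hol_at (f : R[i]^o -> R[i]^o) w : derivable f w 1 ->
  hol_at f w.
Proof.
move=> df; exists ('D_1 (f : R[i]^o -> R[i]^o) w) => e e0.
have e0' : (0 : R[i]) < e%:C by rewrite ltcR.
have [r r0 h] := nbhs0_complex (derivable_first_order df e0').
exists r => // z hz; have := h _ hz; rewrite subrK !normC_cabs -rmorphM lecR.
by [].
Qed.

Lemma hol_at_ccont f w : hol_at f w -> ccont_at f w.
Proof.
move=> [D h] e e0; have [r r0 {}h] := h 1 ltr01.
have C0 : 0 < 1 + cabs D by rewrite ltr_wpDr ?cabs_ge0.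
exists (Num.min r (e / (1 + cabs D))); first by rewrite lt_min r0 divr_gt0.
move=> z; rewrite lt_min => /andP[z1 z2].
rewrite (_ : f z - f w = (f z - f w - D * (z - w)) + D * (z - w)); last by ring.
apply: le_lt_trans (cabsD _ _) _; rewrite cabsM.
apply: le_lt_trans (lerD (h z z1) (lexx _)) _.
by rewrite -mulrDl mulrC -ltr_pdivlMr.
Qed.

(** ** The exponential parametrisation *)

Definition cexp (s t : R) : R[i] := polar (expR s) t.

Lemma cabs_cexp s t : cabs (cexp s t) = expR s.
Proof. by rewrite cabs_polar gtr0_norm ?expR_gt0. Qed.

Lemma cexpD s s' t t' : cexp (s + s') (t + t') = cexp s t * cexp s' t'.
Proof. by rewrite /cexp polarM expRD. Qed.

Lemma cexp_first_order e : 0 < e -> exists2 r, 0 < r & forall h l, `|h| < r -> `|l| < r ->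
  cabs (cexp h l - 1 - (h +i* l)) <= e * (`|h| + `|l|).
Proof.
move=> e0; pose d := Num.min 1 (e / 6).
have d0 : 0 < d by rewrite lt_min ltr01 divr_gt0.
have d1 : d <= 1 by rewrite ge_min lexx.
have d6 : 6 * d <= e by rewrite mulrC -ler_pdivlMr// ge_min lexx orbT.
have [r1 r10 h1] := derivable_eps (@ex_derive _ _ _ _ _ _ _ (is_derive_expR (0 : R))) d0.
have [r2 r20 h2] := derivable_eps (@ex_derive _ _ _ _ _ _ _ (is_derive_cos (0 : R))) d0.
have [r3 r30 h3] := derivable_eps (@ex_derive _ _ _ _ _ _ _ (is_derive_sin (0 : R))) d0.
exists (Num.min r1 (Num.min r2 (Num.min r3 (d / 2)))).
  by rewrite !lt_min r10 r20 r30 divr_gt0.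
move=> h l; rewrite !lt_min => /and4P[hr1 _ _ hd] /and4P[_ lr2 lr3 ld].
have := h1 h hr1; rewrite derive_val addr0 expR0 mul1r => k1.
have := h2 l lr2; rewrite derive_val addr0 cos0 sin0 oppr0 mul0r subr0 => k2.
have := h3 l lr3; rewrite derive_val addr0 cos0 sin0 subr0 mul1r => k3.
have hd2 : `|h| <= d / 2 by exact: ltW.
have b1 : `|expR h - 1| <= 2 * `|h|.
  rewrite (_ : expR h - 1 = (expR h - 1 - h) + h); last by ring.
  apply: le_trans (ler_normD _ _) _.
  have : d * `|h| <= 1 * `|h| by rewrite ler_wpM2r.
  by move: k1; clear; lra.
have b2 : `|expR h - 1| <= d by move: b1 hd2; clear; lra.
have b3 : `|expR h| <= 2.
  rewrite (_ : expR h = (expR h - 1) + 1); last by ring.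
  by apply: le_trans (ler_normD _ _) _; rewrite normr1; move: b2 d1; clear; lra.
apply: le_trans (cabs_le_ReIm _) _; rewrite !ReB !ImB /cexp /polar /= subr0.
rewrite (_ : expR h * cos l - 1 - h = (expR h - 1 - h) + expR h * (cos l - 1)); last by ring.
rewrite (_ : expR h * sin l - l = expR h * (sin l - l) + (expR h - 1) * l); last by ring.
have p1 : `|expR h * (cos l - 1)| <= 2 * (d * `|l|) by rewrite normrM ler_pM.
have p2 : `|expR h * (sin l - l)| <= 2 * (d * `|l|) by rewrite normrM ler_pM.
have p3 : `|(expR h - 1) * l| <= d * `|l| by rewrite normrM ler_wpM2r.
have t1 := ler_normD (expR h - 1 - h) (expR h * (cos l - 1)).
have t2 := ler_normD (expR h * (sin l - l)) ((expR h - 1) * l).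
have dh : 0 <= d * `|h| by rewrite mulr_ge0// ltW.
have q : 6 * d * (`|h| + `|l|) <= e * (`|h| + `|l|) by rewrite ler_wpM2r// addr_ge0.
have dl : 0 <= d * `|l| by rewrite mulr_ge0// ltW.
move: t1 t2 p1 p2 p3 k1 dh q dl; rewrite !mulrDr -!mulrA.
by clear; lra.
Qed.

(** The functional equation transports the estimate at the origin to any point. *)
Lemma cexp_lipschitz s t : exists2 r, 0 < r & forall x y, `|x - s| < r -> `|y - t| < r ->
  cabs (cexp x y - cexp s t) <= 2 * expR s * (`|x - s| + `|y - t|).
Proof.
have [r r0 h] := cexp_first_order (ltr01 : (0 : R) < 1); exists r => // x y hx hy.
have -> : cexp x y - cexp s t = cexp s t * (cexp (x - s) (y - t) - 1).
  by rewrite mulrBr mulr1 -cexpD ![_ + (_ - _)]addrC !subrK.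
rewrite cabsM cabs_cexp [2 * _]mulrC -mulrA ler_wpM2l ?expR_ge0//.
have := h _ _ hx hy; set d := _ +i* _ => h'.
rewrite (_ : cexp (x - s) (y - t) - 1 = (cexp (x - s) (y - t) - 1 - d) + d); last by ring.
apply: le_trans (cabsD _ _) _; apply: le_trans (lerD h' (cabs_le_ReIm _)) _.
by rewrite /= mul1r mulr_natl mulr2n.
Qed.

Lemma ccont_jcont f s t : ccont_at f (cexp s t) -> jcont (fun x y => f (cexp x y)) s t.
Proof.
move=> h e e0; have [r r0 {}h] := h e e0; have [d d0 hd] := cexp_lipschitz s t.
have L0 : 0 < 4 * expR s by rewrite mulr_gt0// expR_gt0.
exists (Num.min d (r / (4 * expR s))); first by rewrite lt_min d0 divr_gt0.
move=> x y; rewrite !lt_min => /andP[x1 x2] /andP[y1 y2].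
apply: h; apply: le_lt_trans (hd x y x1 y1) _.
move: x2 y2; rewrite !ltr_pdivlMr// => x2 y2.
by move: x2 y2; clear; lra.
Qed.

(** The chain rule, with derivative [D * cexp s t]. *)
Lemma hol_at_cdiff f s t : hol_at f (cexp s t) -> cdiff (fun x y => f (cexp x y)) s t.
Proof.
move=> [D h]; exists (D * cexp s t) => e e0.
set L := expR s; have L0 : 0 < L by exact: expR_gt0.
have K0 : 0 < cabs D * L + 1 by rewrite ltr_wpDl// mulr_ge0 ?cabs_ge0 ?ltW.
have L4 : 0 < 4 * L by rewrite mulr_gt0.
have [r r0 {}h] := h (e / (4 * L)) (divr_gt0 e0 L4).
have [d1 d10 hd1] := cexp_lipschitz s t.
have e2 : 0 < e / (2 * (cabs D * L + 1)) by rewrite divr_gt0// mulr_gt0.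
have [d2 d20 hd2] := cexp_first_order e2.
exists (Num.min d1 (Num.min d2 (r / (4 * L)))).
  by rewrite !lt_min d10 d20 divr_gt0// mulr_gt0.
move=> x y; rewrite !lt_min => /and3P[x1 x2 x3] /and3P[y1 y2 y3].
set w := `|x - s| + `|y - t|.
have w0 : 0 <= w by exact: addr_ge0.
have k1 : cabs (cexp x y - cexp s t) <= 2 * L * w by exact: hd1.
have k2 : cabs (cexp x y - cexp s t) < r.
  apply: le_lt_trans k1 _; move: x3 y3; rewrite !ltr_pdivlMr ?mulr_gt0// /w.
  by clear; lra.
have k3 := h _ k2.
have k4 := hd2 _ _ x2 y2; rewrite -/w in k4.
have E : cexp x y - cexp s t - cexp s t * ((x - s) +i* (y - t)) =
    cexp s t * (cexp (x - s) (y - t) - 1 - ((x - s) +i* (y - t))).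
  have -> : cexp x y = cexp s t * cexp (x - s) (y - t).
    by rewrite -cexpD ![_ + (_ - _)]addrC !subrK.
  by ring.
rewrite (_ : f (cexp x y) - f (cexp s t) - D * cexp s t * _ =
  (f (cexp x y) - f (cexp s t) - D * (cexp x y - cexp s t)) +
  D * (cexp x y - cexp s t - cexp s t * ((x - s) +i* (y - t)))); last by ring.
apply: le_trans (cabsD _ _) _; rewrite E !cabsM cabs_cexp -/L.
have j1 : e / (4 * L) * cabs (cexp x y - cexp s t) <= e / 2 * w.
  apply: le_trans (ler_wpM2l _ k1) _; first by rewrite divr_ge0// ?mulr_ge0// ltW.
  by rewrite le_eqVlt; apply/orP; left; apply/eqP; field; rewrite gt_eqF.
have j2 : cabs D * (L * cabs (cexp (x - s) (y - t) - 1 - ((x - s) +i* (y - t)))) <= e / 2 * w.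
  rewrite mulrA; apply: le_trans (ler_wpM2l _ k4) _; first by rewrite mulr_ge0 ?cabs_ge0 ?ltW.
  rewrite mulrA ler_wpM2r// mulrA ler_pdivrMr ?mulr_gt0//.
  by move: e0; clear; nra.
move: (le_trans k3 j1) j2; set a := cabs _; set b := cabs _ * _; clear; lra.
Qed.

End differentials.

(** ** Integrals over a period *)

Section periods.
Variable R : realType.

Lemma sint_shift (f : R -> R) (a b h : R) : a <= b -> continuous f ->
  sint (a + h) (b + h) f = sint a b (fun t => f (t + h)).
Proof.
move=> ab cf; rewrite /sint /Rintegral; congr fine.
pose F (x : R) := x + h.
have dF (x : R) : is_derive x 1 F 1.
  by rewrite /F; apply: is_derive_eq; rewrite addr0.
have dF1 : derive1 F = fun=> 1 by apply/funext => x; rewrite derive1E derive_val.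
have cF : continuous F by move=> x; apply: cvgD; [exact: cvg_id|exact: cvg_cst].
rewrite -[a + h]/(F a) -[b + h]/(F b) (@integration_by_substitution_increasing _ F)//.
- by apply: eq_integral => x _; rewrite dF1 /= mulr1.
- by move=> x y _ _; rewrite /F ltrD2r.
- by rewrite dF1 => x _; exact: cvg_cst.
- by rewrite dF1; exact: is_cvg_cst.
- by rewrite dF1; exact: is_cvg_cst.
- split.
  + by move=> x _; exact: ex_derive.
  + by apply: cvg_at_right_filter; exact: cF.
  + by apply: cvg_at_left_filter; exact: cF.
- exact: continuous_subspaceT.
Qed.

Lemma sint_period (f : R -> R) (p a b : R) : a <= b <= a + p -> continuous f ->
  (forall t, f (t + p) = f t) -> sint a (a + p) f = sint b (b + p) f.
Proof.
move=> /andP[ab bap] cf per.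
have cw c d : {within `[c, d], continuous f} by exact: continuous_subspaceT.
have bp : b <= b + p by rewrite (le_trans bap)// lerD2r.
have := sint_split ab bp (cw _ _).
rewrite (sint_split (le_trans ab bap) _ (cw _ _)); last by rewrite lerD2r.
rewrite (@sint_shift f a b p ab cf) => /eqP.
rewrite (_ : (fun t => f (t + p)) = f); last exact/funext.
by rewrite addrC => /eqP/addrI.
Qed.

Lemma cint_shift (F : R -> R[i]) (a b h : R) : a <= b -> ccontinuous F ->
  cint (a + h) (b + h) F = cint a b (fun t => F (t + h)).
Proof. by move=> ab [F1 F2]; rewrite /cint !sint_shift. Qed.

Lemma cint_period (F : R -> R[i]) (p a b : R) : a <= b <= a + p -> ccontinuous F ->
  (forall t, F (t + p) = F t) -> cint a (a + p) F = cint b (b + p) F.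
Proof.
move=> ab [F1 F2] per; rewrite /cint.
by rewrite !(sint_period ab)// => t; rewrite per.
Qed.

(** The segment is centered so that angles of arbitrary points lie in it, see
    [circ_center]. *)
Definition circ (F : R -> R[i]) : R[i] := cint (- pi) (- pi + pi *+ 2) F.

Lemma circ_center (F : R -> R[i]) (t : R) : - pi <= t <= pi -> ccontinuous F ->
  (forall t, F (t + pi *+ 2) = F t) -> cint (t - pi) (t - pi + pi *+ 2) F = circ F.
Proof.
move=> /andP[t1 t2] cF per; rewrite /circ; have p0 := pi_ge0 R.
have [t0|t0] := leP 0 t.
  apply/esym; apply: cint_period => //; rewrite mulr2n.
  by apply/andP; split; move: t0 t1 t2; clear; lra.
apply: cint_period => //; rewrite mulr2n.
by apply/andP; split; move: t0 t1 t2 p0; clear; lra.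
Qed.

(** The rotation by [h] preserves the integral and changes its sign. *)
Lemma circ_antiperiodic (F : R -> R[i]) (h : R) : 0 <= h <= pi *+ 2 -> ccontinuous F ->
  (forall t, F (t + pi *+ 2) = F t) -> (forall t, F (t + h) = - F t) -> circ F = 0.
Proof.
move=> /andP[h0 h2] cF per anti.
have E : circ F = - circ F.
  have h3 : - pi <= - pi + pi *+ 2 :> R.
    by rewrite mulr2n; have := pi_ge0 R; clear; lra.
  rewrite {1}/circ (@cint_period _ _ _ (- pi + h))//; last by rewrite lerDl h0 lerD2l.
  rewrite addrAC cint_shift//.
  under cint_eq do rewrite anti -mulN1r.
  by rewrite cintZ// mulN1r.
by move/eqP: E; rewrite -addr_eq0 -mulr2n mulrn_eq0 => /eqP.
Qed.

End periods.

(** ** The expansion *)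

Lemma derivable_invX (K : numFieldType) (z : K) k : z != 0 ->
  derivable (fun u : K^o => u^-1 ^+ k : K^o) z 1.
Proof.
move=> z0; elim: k => [|k IH].
  under eq_fun do rewrite expr0; exact: derivable_cst.
under eq_fun do rewrite exprS.
apply: (@derivableM K K^o (fun u : K^o => u^-1) (fun u : K^o => u^-1 ^+ k)); last exact: IH.
by apply: (@derivableV K K^o (id : K^o -> K^o)) => //; exact: derivable_id.
Qed.

Section power_series.
Variable R : realType.
Implicit Types (f g : R[i] -> R[i]) (z w : R[i]).

Lemma polar_inj_near (r s t : R) : r != 0 -> `|s - t| <= pi ->
  polar r s = polar r t -> s = t.
Proof.
move=> r0 st E.
have : polar r s * polar r^-1 (- t) = polar r t * polar r^-1 (- t) by rewrite E.
rewrite !polarM divff// subrr => -[]; rewrite !mul1r cos0 => cst _.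
have c0 : cos `|s - t| = cos 0.
  have [_|_] := ger0P (s - t); first by rewrite cst cos0.
  by rewrite cosN cst cos0.
move/cos_inj : c0; rewrite !in_itv /= normr_ge0 st lexx pi_ge0 => /(_ isT isT)/eqP.
by rewrite normr_eq0 subr_eq0 => /eqP.
Qed.

Lemma ccontinuous_polar (r : R) : ccontinuous (polar r).
Proof.
split => t; apply: cvgM; try exact: cvg_cst.
  exact: continuous_cos.
exact: continuous_sin.
Qed.

Lemma ccontinuous_polarN (r : R) : ccontinuous (fun t => polar r (- t)).
Proof.
rewrite /polar; split => t /=.
  under eq_fun do rewrite cosN; apply: cvgM; [exact: cvg_cst|exact: continuous_cos].
under eq_fun do rewrite sinN; apply: cvgM; first exact: cvg_cst.
apply: cvgN; exact: continuous_sin.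
Qed.

Lemma polarN_D2pi (r t : R) : polar r (- (t + pi *+ 2)) = polar r (- t).
Proof. by rewrite opprD -[LHS]polarD2pi subrK. Qed.

Lemma polar_half_turn (d : nat) : (0 < d)%N -> exists2 h : R, 0 <= h <= pi *+ 2 &
  polar 1 h ^+ d = -1 /\ polar 1 (- h) ^+ d = -1.
Proof.
move=> d0; have dn0 : d%:R != 0 :> R by rewrite gt_eqF// ltr0n.
have hd : (pi / d%:R) *+ d = pi :> R by rewrite -mulr_natr mulfVK.
exists (pi / d%:R).
  rewrite divr_ge0 ?pi_ge0//= ler_pdivrMr ?ltr0n// mulr2n mulrDl.
  rewrite -[leLHS]addr0 lerD ?mulr_ge0 ?pi_ge0// ler_peMr ?pi_ge0//.
  by rewrite ler1n.
rewrite !polarX mulNrn hd /polar cosN sinN cospi sinpi expr1n mul1r oppr0 mulr0.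
by split; apply: eqC; rewrite ?ReN ?ImN /= ?oppr0.
Qed.

(** Orthogonality of the characters of the circle: the rotation by
    [pi / |m - n|] changes the sign of the integrand. *)
Lemma circ_character (m n : nat) : m != n ->
  circ (fun t : R => polar 1 t ^+ m * polar 1 (- t) ^+ n) = 0.
Proof.
move=> mn.
have [h h02 key] : exists2 h : R, 0 <= h <= pi *+ 2 &
    polar 1 h ^+ m * polar 1 (- h) ^+ n = -1.
  have base h : polar 1 h * polar 1 (- h) = 1 :> R[i].
    by rewrite polarM mulr1 subrr /polar cos0 sin0 mulr1 mulr0.
  case: (ltngtP m n) mn => // lt_mn _.
    have d0 : (0 < n - m)%N by rewrite subn_gt0.
    have [h h02 [_ k2]] := polar_half_turn d0.
    exists h => //.
    by rewrite -[in LHS](subnKC (ltnW lt_mn)) exprD mulrA -exprMn base expr1n mul1r.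
  have d0 : (0 < m - n)%N by rewrite subn_gt0.
  have [h h02 [k1 _]] := polar_half_turn d0.
  exists h => //.
  by rewrite -[in LHS](subnKC (ltnW lt_mn)) exprD mulrAC -exprMn base expr1n mul1r.
apply: (circ_antiperiodic h02).
- apply: ccontinuousM; apply: ccontinuousX; first exact: ccontinuous_polar.
  exact: ccontinuous_polarN.
- by move=> t; rewrite polarD2pi polarN_D2pi.
- move=> t; rewrite opprD -[X in polar X (t + h)]mulr1 -polarM.
  rewrite -[X in polar X (- t - h)]mulr1 -polarM !exprMn mulrACA key.
  by rewrite mulrN1.
Qed.

Lemma ccontinuous_circle f (r : R) : 0 < r -> (forall z, cabs z = r -> ccont_at f z) ->
  ccontinuous (fun t => f (polar r t)).
Proof.
move=> r0 cf.
have jc t : jcont (fun x y => f (cexp x y)) (ln r) t.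
  by apply: ccont_jcont; apply: cf; rewrite cabs_cexp lnK.
have E t : f (polar r t) = f (cexp (ln r) t) by rewrite /cexp lnK.
split=> t.
  under eq_fun do rewrite E.
  have := jcont_y (jcontZ 'i (jc t)).
  have Ei z : Im ('i * z) = Re z by rewrite ImM /= mul0r add0r mul1r.
  by rewrite (_ : (fun y => _) = (fun y => Re (f (cexp (ln r) y))))//; apply/funext => y; rewrite Ei.
under eq_fun do rewrite E.
exact: jcont_y (jc t).
Qed.

(** In logarithmic coordinates the annulus, cut open at the angle opposite to the
    one of [w], is a rectangle with [w] in its interior whose vertical sides
    are the two boundary circles. *)
Lemma mean_annulus g w (th r1 r2 : R) : 0 < r1 -> r1 < r2 ->
  w = polar (cabs w) th -> cabs w != r1 -> cabs w != r2 ->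
  (forall z, r1 <= cabs z <= r2 -> ccont_at g z) ->
  (forall z, r1 <= cabs z <= r2 -> z != w -> hol_at g z) ->
  cint (th - pi) (th - pi + pi *+ 2) (fun t => g (polar r1 t)) =
  cint (th - pi) (th - pi + pi *+ 2) (fun t => g (polar r2 t)).
Proof.
move=> r10 r12 wE w1 w2 cg hg.
have r20 := lt_trans r10 r12.
have p0 := pi_gt0 R.
have thE : th - pi + pi *+ 2 = th + pi by rewrite mulr2n addrA subrK.
(* If [w] lies outside the annulus any interior point can be declared exceptional. *)
pose xs := if r1 < cabs w < r2 then ln (cabs w) else (ln r1 + ln r2) / 2.
have l12 : ln r1 < ln r2 by rewrite ltr_ln.
have E r t : 0 < r -> g (polar r t) = g (cexp (ln r) t) by move=> r0; rewrite /cexp lnK.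
rewrite (@cint_eq _ _ _ _ (fun t => g (cexp (ln r1) t))); last by move=> *; rewrite E.
rewrite (@cint_eq _ _ _ (fun t => g (polar r2 t)) (fun t => g (cexp (ln r2) t))); last by move=> *; rewrite E.
have dom s t : ln r1 <= s <= ln r2 -> r1 <= cabs (cexp s t) <= r2.
  move=> /andP[s1 s2]; by rewrite cabs_cexp -ler_ln ?posrE ?expR_gt0// expRK s1 -ler_ln ?posrE ?expR_gt0// expRK s2.
apply: (@periodic_goursat _ (fun s t => g (cexp s t)) _ _ _ _ xs th).
- rewrite /xs; case: ifP => [/andP[a b]|_].
    have c0 := lt_trans r10 a.
    by rewrite !ltr_ln ?posrE ?a ?b.
  by move: l12; clear; lra.
- by rewrite thE ltrBlDr !ltrDl p0.
- by move=> s; rewrite /cexp polarD2pi.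
- by move=> s t hs _; apply: ccont_jcont; apply: cg; exact: dom.
move=> s t hs ht ne; apply: hol_at_cdiff; apply: hg; first exact: dom.
apply/eqP => sw; move/negP : ne; apply.
have ws : cabs w = expR s by rewrite -sw cabs_cexp.
have w0 : 0 < cabs w by rewrite ws expR_gt0.
apply/negP; rewrite negb_or !negbK; apply/andP; split.
  rewrite /xs ifT ?ws ?expRK//.
  have := dom _ t hs; rewrite sw => /andP[h1 h2].
  by rewrite -ws !lt_neqAle h1 h2 w2 eq_sym w1.
apply/eqP; apply: (@polar_inj_near (cabs w)); first by rewrite gt_eqF.
  by move: ht; rewrite thE ler_norml; clear; lra.
by rewrite [RHS](esym wE) ws.
Qed.

Lemma hol_at_local f g w (d : R) : 0 < d ->
  (forall z, cabs (z - w) < d -> f z = g z) -> hol_at f w -> hol_at g w.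
Proof.
move=> d0 fg [D h]; exists D => e e0; have [r r0 {}h] := h e e0.
exists (Num.min r d); first by rewrite lt_min r0.
move=> z; rewrite lt_min => /andP[zr zd].
by rewrite -!fg// ?subrr ?cabs0//; exact: h.
Qed.

Lemma circD (F G : R -> R[i]) : ccontinuous F -> ccontinuous G ->
  circ (fun t => F t + G t) = circ F + circ G.
Proof. exact: cintD. Qed.

Lemma circZ z (F : R -> R[i]) : ccontinuous F -> circ (fun t => z * F t) = z * circ F.
Proof. exact: cintZ. Qed.

Lemma pi2_gt0 : 0 < pi *+ 2 :> R.
Proof. by rewrite mulrn_wgt0// pi_gt0. Qed.

Lemma circ_dom : - pi <= - pi + pi *+ 2 :> R.
Proof. by rewrite lerDl ltW// pi2_gt0. Qed.

Lemma circ_sum (I : Type) (s : seq I) (F : I -> R -> R[i]) :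
  (forall i, ccontinuous (F i)) ->
  circ (fun t => \sum_(i <- s) F i t) = \sum_(i <- s) circ (F i).
Proof. exact: cint_sum circ_dom. Qed.

Lemma circ_cst z : circ (fun=> z) = z * (pi *+ 2)%:C.
Proof. by rewrite /circ cint_cst ?circ_dom// opprK addrAC addNr add0r. Qed.

Lemma circ_eq (F G : R -> R[i]) : F =1 G -> circ F = circ G.
Proof. by move=> h; apply: cint_eq => t _. Qed.

Lemma circ_cabs_le (c : R) (F : R -> R[i]) : ccontinuous F ->
  (forall t, cabs (F t) <= c) -> cabs (circ F) <= 2 * c * (pi *+ 2).
Proof.
move=> cF h; apply: le_trans (cint_cabs_le circ_dom cF (fun t _ => h t)) _.
by rewrite opprK addrAC addNr add0r.
Qed.

Lemma polarV (r t : R) : r != 0 -> (polar r t)^-1 = polar r^-1 (- t).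
Proof.
move=> r0; have p0 : polar r t != 0 by apply: contra r0 => /eqP/polar_eq0 ->.
apply: (mulfI p0); rewrite divff// polarM divff// subrr /polar cos0 sin0.
by rewrite mulr1 mulr0.
Qed.

Lemma cabs_small_eq0 z (C : R) : 0 <= C -> (forall e, 0 < e -> cabs z <= C * e) -> z = 0.
Proof.
move=> C0 h; apply: cabs_eq0; apply/le_anti; rewrite cabs_ge0 andbT.
apply/ler_addgt0Pr => e e0; rewrite add0r.
have C1 : 0 < C + 1 by rewrite ltr_wpDl.
apply: le_trans (h _ (divr_gt0 e0 C1)) _.
by rewrite mulrCA ger_pMr// ler_pdivrMr// mul1r lerDl.
Qed.

Lemma derivable_subr z w : derivable (fun u : R[i]^o => u - w : R[i]^o) z 1.
Proof.
exact: (@derivableB _ _ _ (id : R[i]^o -> R[i]^o) (cst w) z 1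
  (@derivable_id _ _ _ _) (@derivable_cst _ _ _ _ _ _)).
Qed.

Section expansion.
Variables (f : R[i] -> R[i]) (M : R).
Hypothesis df : forall w, cabs w < 1 -> derivable (f : R[i]^o -> R[i]^o) w 1.
Hypothesis fM : forall w, cabs w < 1 -> cabs (f w) <= M.

Let cont_f w : cabs w < 1 -> ccont_at f w.
Proof. by move=> /df/derivable_hol_at/hol_at_ccont. Qed.

(** Cauchy's formula for the coefficient of order [k], on the circle of radius
    [r]. *)
Definition taylor (r : R) (k : nat) : R[i] :=
  (pi *+ 2)%:C^-1 * circ (fun t => f (polar r t) * (polar r t)^-1 ^+ k).

(** The integrand is holomorphic away from the origin. *)
Lemma taylor_radius (r1 r2 : R) k : 0 < r1 -> r1 < r2 -> r2 < 1 ->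
  taylor r1 k = taylor r2 k.
Proof.
move=> r10 r12 r21.
suff E : circ (fun t => f (polar r1 t) * (polar r1 t)^-1 ^+ k) =
         circ (fun t => f (polar r2 t) * (polar r2 t)^-1 ^+ k).
  exact: (congr1 (fun x => (pi *+ 2)%:C^-1 * x) E).
rewrite /circ.
have z0 : (0 : R[i]) = polar (cabs (0 : R[i])) 0 by rewrite cabs0 /polar !mul0r.
pose g z := f z * z^-1 ^+ k.
have hg z : r1 <= cabs z <= r2 -> hol_at g z.
  move=> /andP[h1 h2]; apply: derivable_hol_at.
  have zn0 : z != 0.
    by apply/eqP => z0'; move: h1; rewrite z0' cabs0 leNgt r10.
  apply: derivableM; first by apply: df; exact: le_lt_trans r21.
  exact: derivable_invX.
have := @mean_annulus g 0 0 r1 r2 r10 r12 z0; rewrite cabs0 sub0r; apply.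
- by rewrite lt_eqF.
- by rewrite lt_eqF// (lt_trans r10).
- by move=> z /hg/hol_at_ccont.
- by move=> z /hg.
Qed.

(** The difference quotient at [w], times the variable, has zero mean over the
    circles around the origin: extended by continuity to [w] it is continuous,
    and holomorphic elsewhere, so its means are independent of the radius; they
    tend to zero with it. *)
Lemma mean_difference_quotient w (r : R) : cabs w < r -> r < 1 ->
  circ (fun t => polar r t * (f (polar r t) - f w) / (polar r t - w)) = 0.
Proof.
move=> wr r1; have r0 : 0 < r := le_lt_trans (cabs_ge0 w) wr.
have w1 := lt_trans wr r1.
have [D hD] := derivable_hol_at (df w1).
pose k z := if z == w then w * D else z * (f z - f w) / (z - w).
have khol z : cabs z < 1 -> z != w -> hol_at k z.
  move=> z1 zw; pose k' := fun z => z * (f z - f w) * (z - w)^-1.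
  have zw0 : z - w != 0 by rewrite subr_eq0.
  apply: (@hol_at_local k' _ _ (cabs (z - w))); first exact: cabs_gt0.
    move=> z'; rewrite /k; case: eqP => // ->; rewrite cabsB.
    by rewrite ltxx.
  apply: derivable_hol_at; apply: derivableM.
    apply: derivableM; first exact: derivable_id.
    exact: (derivableB (df z1) (derivable_cst (f w : R[i]^o) _ _)).
  by apply: derivableV => //; exact: derivable_subr.
have kcont z : cabs z < 1 -> ccont_at k z.
  move=> z1; have [->|zw] := eqVneq z w; last exact/hol_at_ccont/khol.
  move=> e e0; set L := 2 * (cabs w + 1 + cabs D).
  have L0 : 0 < L by rewrite mulr_gt0// ltr_wpDr ?cabs_ge0// ltr_wpDl ?cabs_ge0.
  have [d d0 hd] := hD (e / L) (divr_gt0 e0 L0).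
  exists (Num.min d (Num.min 1 (e / L))); first by rewrite !lt_min d0 ltr01 divr_gt0.
  move=> z'; rewrite !lt_min => /and3P[z'd z'1 z'e].
  rewrite /k eqxx; case: eqVneq => [_|z'w]; first by rewrite subrr cabs0.
  have zw0 : z' - w != 0 by rewrite subr_eq0.
  have zw0' := cabs_gt0 zw0.
  have := hd z' z'd.
  rewrite -ler_pdivrMr// -cabsV -cabsM => h1.
  rewrite (_ : z' * (f z' - f w) / (z' - w) - w * D =
    z' * ((f z' - f w - D * (z' - w)) * (z' - w)^-1) + (z' - w) * D); last by field.
  apply: le_lt_trans (cabsD _ _) _; rewrite [cabs (z' * _)]cabsM [cabs (_ * D)]cabsM.
  have h2 : cabs z' <= cabs w + 1.
    rewrite (_ : z' = w + (z' - w)); last by ring.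
    by apply: le_trans (cabsD _ _) _; rewrite lerD2l ltW.
  have p1 : cabs z' * cabs ((f z' - f w - D * (z' - w)) * (z' - w)^-1) <= (cabs w + 1) * (e / L).
    by apply: ler_pM; rewrite ?cabs_ge0.
  have p2 : cabs (z' - w) * cabs D <= (e / L) * cabs D.
    by rewrite ler_wpM2r ?cabs_ge0// ltW.
  apply: le_lt_trans (lerD p1 p2) _.
  rewrite (_ : (cabs w + 1) * (e / L) + e / L * cabs D = e * ((cabs w + 1 + cabs D) / L)); last by ring.
  rewrite gtr_pMr// ltr_pdivrMr// mul1r /L mulr_natl mulr2n ltrDl.
  by rewrite ltr_wpDr ?cabs_ge0// ltr_wpDl ?cabs_ge0.
have [th hth wE] := polar_exists w.
have ck s : 0 < s -> s < 1 -> ccontinuous (fun t => k (polar s t)).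
  by move=> s0 s1; apply: ccontinuous_circle => // z zs; apply: kcont; rewrite zs.
rewrite (@circ_eq _ (fun t => k (polar r t))); last first.
  move=> t; rewrite /k; case: eqP => // zw; exfalso.
  by move: wr; rewrite -zw cabs_polar gtr0_norm// ltxx.
rewrite -(circ_center hth); [|exact: ck|by move=> t; rewrite polarD2pi].
have pp : 0 <= 2 * (pi *+ 2) :> R by rewrite mulr_ge0// ltW// pi2_gt0.
apply: (cabs_small_eq0 pp) => e e0.
have [d d0 hd] := kcont 0 ltac:(by rewrite cabs0) e e0.
have k0 : k 0 = 0.
  by rewrite /k; case: eqVneq => [<-|_]; rewrite ?mul0r.
(* A circle so small that it does not pass through [w]. *)
pose m := if w == 0 then r else cabs w.
have m0 : 0 < m by rewrite /m; case: eqVneq => // /cabs_gt0.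
pose s := Num.min (d / 2) (m / 2).
have s0 : 0 < s by rewrite lt_min !divr_gt0.
have sd : s < d.
  by apply: (@le_lt_trans _ _ (d / 2)); [rewrite ge_min lexx|rewrite ltr_pdivrMr// ltr_pMr// ltr1n].
have sm : s < m.
  by apply: (@le_lt_trans _ _ (m / 2)); [rewrite ge_min lexx orbT|rewrite ltr_pdivrMr// ltr_pMr// ltr1n].
have mr : m <= r by rewrite /m; case: eqVneq => // _; exact: ltW.
have sr := lt_le_trans sm mr.
have ws : cabs w != s.
  move: sm; rewrite /m; case: eqVneq => [->|_] h; first by rewrite cabs0 lt_eqF.
  by rewrite gt_eqF.
rewrite -(@mean_annulus k w th s r s0 sr wE ws).
- have tle : th - pi <= th - pi + pi *+ 2 by rewrite lerDl ltW// pi2_gt0.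
  apply: le_trans (cint_cabs_le tle (ck _ s0 (lt_trans sr r1)) (c := e) _) _.
    move=> t _; have := hd (polar s t); rewrite subr0 cabs_polar gtr0_norm// => /(_ sd).
    by rewrite k0 subr0 => /ltW.
  rewrite addrAC subrr add0r mulrAC; exact: lexx.
- by rewrite lt_eqF.
- by move=> z /andP[_ h]; apply: kcont; exact: le_lt_trans h r1.
- by move=> z /andP[_ h]; apply: khol; exact: le_lt_trans h r1.
Qed.

(** With [z] on the circle and [q = w / z], summing geometric progressions turns
    [f(z) (1 + .. + q^(N-1)) - f(w) (1 + .. + q^(N-1))] into
    [z (f(z) - f(w)) / (z - w) * (1 - q^N)]. On the left the means are the Taylor
    polynomial and [f(w)]; on the right the leading term has mean zero by
    [mean_difference_quotient] and the other one is small. *)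
Lemma taylor_remainder w (r : R) (N : nat) : cabs w < r -> r < 1 -> (0 < N)%N ->
  cabs (\sum_(0 <= k < N) taylor r k * w ^+ k - f w) <=
    2 * (r * (2 * M) / (r - cabs w)) * (cabs w / r) ^+ N.
Proof.
move=> wr r1 N0; have r0 : 0 < r := le_lt_trans (cabs_ge0 w) wr.
have rn0 : r != 0 by rewrite gt_eqF.
have w1 := lt_trans wr r1.
have P0 : (pi *+ 2)%:C != 0 :> R[i] by rewrite fmorph_eq0 gt_eqF// pi2_gt0.
pose z (t : R) := polar r t.
have zn0 t : z t != 0 by apply: contra rn0 => /eqP/polar_eq0 ->.
have zw t : z t - w != 0.
  rewrite subr_eq0; apply/eqP => h; move: wr.
  by rewrite -h cabs_polar gtr0_norm// ltxx.
have cz : ccontinuous z by exact: ccontinuous_polar.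
have czV : ccontinuous (fun t => (z t)^-1).
  by under eq_fun do rewrite /z polarV//; exact: ccontinuous_polarN.
have cfz : ccontinuous (fun t => f (z t)).
  by apply: ccontinuous_circle => // u ur; apply: cont_f; rewrite ur.
have cq : ccontinuous (fun t => (z t - w)^-1).
  apply: (@ccontinuous_circle (fun u => (u - w)^-1)) => // u ur.
  apply: hol_at_ccont; apply: derivable_hol_at; apply: derivableV.
    rewrite subr_eq0; apply/eqP => h; move: wr.
    by rewrite -h ur ltxx.
  exact: derivable_subr.
pose k t := z t * (f (z t) - f w) / (z t - w).
have ckk : ccontinuous k.
  apply: ccontinuousM => //; apply: ccontinuousM => //.
  by apply: ccontinuousD => //; exact: ccontinuous_cst.
have cfk j : ccontinuous (fun t => f (z t) * (z t)^-1 ^+ j).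
  by apply: ccontinuousM => //; exact: ccontinuousX.
have geom t : \sum_(0 <= j < N) w ^+ j * (f (z t) * (z t)^-1 ^+ j) +
    (- f w) * \sum_(0 <= j < N) w ^+ j * (z t)^-1 ^+ j =
    k t + (- 1) * (k t * (w * (z t)^-1) ^+ N).
  have -> : \sum_(0 <= j < N) w ^+ j * (f (z t) * (z t)^-1 ^+ j) =
      f (z t) * \sum_(0 <= j < N) (w * (z t)^-1) ^+ j.
    by rewrite mulr_sumr; apply: eq_bigr => j _; rewrite exprMn mulrCA.
  have -> : \sum_(0 <= j < N) w ^+ j * (z t)^-1 ^+ j = \sum_(0 <= j < N) (w * (z t)^-1) ^+ j.
    by apply: eq_bigr => j _; rewrite exprMn.
  have := subrX1 (w * (z t)^-1) N; rewrite -(big_mkord xpredT (fun j => (w / z t) ^+ j)).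
  move=> /(congr1 (fun u => - u)) h.
  have -> : k t + (-1) * (k t * (w / z t) ^+ N) = k t * - ((w / z t) ^+ N - 1) by ring.
  rewrite h; set S := \sum_(_ <= _ < _) _; rewrite /k; field.
  by rewrite zw zn0.
have I0 : circ k = 0 by exact: mean_difference_quotient.
have := circ_eq geom.
rewrite circD; last 2 first.
- by apply: ccontinuous_sum => j; exact: ccontinuousZ.
- by apply: ccontinuousZ; apply: ccontinuous_sum => j; apply: ccontinuousZ; exact: ccontinuousX.
have ckN : ccontinuous (fun t => k t * (w * (z t)^-1) ^+ N).
  by apply: ccontinuousM => //; apply: ccontinuousX; exact: ccontinuousZ.
rewrite circD//; last exact: ccontinuousZ.
rewrite I0 add0r [in RHS]circZ// circ_sum; last by move=> j; exact: ccontinuousZ.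
rewrite circZ; last by apply: ccontinuous_sum => j; apply: ccontinuousZ; exact: ccontinuousX.
rewrite circ_sum; last by move=> j; apply: ccontinuousZ; exact: ccontinuousX.
have -> : \sum_(0 <= j < N) circ (fun t => w ^+ j * (z t)^-1 ^+ j) = (pi *+ 2)%:C.
  rewrite big_ltn// big_nat big1 ?addr0.
    by under circ_eq do rewrite !expr0 mulr1; rewrite circ_cst mul1r.
  move=> j /andP[j0 _]; rewrite circZ; last exact: ccontinuousX.
  rewrite (@circ_eq _ (fun t => r^-1%:C ^+ j * (polar 1 t ^+ 0 * polar 1 (- t) ^+ j))); last first.
    by move=> t; rewrite expr0 mul1r -exprMn /z polarV// [in LHS]polar_mul.
  rewrite circZ; last first.
    by apply: ccontinuousM; apply: ccontinuousX; [exact: ccontinuous_polar|exact: ccontinuous_polarN].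
  by rewrite circ_character ?mulr0// eq_sym -lt0n.
have -> : \sum_(0 <= j < N) circ (fun t => w ^+ j * (f (z t) * (z t)^-1 ^+ j)) =
    (pi *+ 2)%:C * \sum_(0 <= j < N) taylor r j * w ^+ j.
  rewrite mulr_sumr; apply: eq_bigr => j _; rewrite circZ// /taylor.
  by rewrite -[in RHS]mulrA mulVKf// mulrC.
rewrite mulN1r mulNr [f w * _]mulrC -mulrBr => h.
have bk t : cabs (k t * (w * (z t)^-1) ^+ N) <= r * (2 * M) / (r - cabs w) * (cabs w / r) ^+ N.
  have zr : cabs (z t) = r by rewrite cabs_polar gtr0_norm.
  rewrite cabsM cabsX cabsM cabsV zr ler_wpM2r//.
    by rewrite exprn_ge0// divr_ge0 ?cabs_ge0// ltW.
  rewrite /k !cabsM cabsV zr; apply: ler_pM.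
  - by rewrite mulr_ge0 ?cabs_ge0// ltW.
  - by rewrite invr_ge0 cabs_ge0.
  - rewrite ler_wpM2l ?(ltW r0)//; apply: le_trans (cabsD _ _) _.
    by rewrite cabsN mulr_natl mulr2n lerD ?fM ?zr.
  - rewrite lef_pV2 ?posrE ?subr_gt0 ?cabs_gt0//.
    rewrite lerBlDr -zr -[X in cabs X <= _](subrK w); exact: cabsD.
have := circ_cabs_le ckN bk.
rewrite -cabsN -h cabsM cabs_real gtr0_norm ?pi2_gt0// mulrC.
move=> h2; rewrite -(ler_pM2r pi2_gt0); apply: le_trans h2 _.
by rewrite mulrA.
Qed.

(** The coefficients do not depend on the radius, so for each [w] the remainder can
    be estimated on a circle between [w] and the unit circle. *)
Theorem hol_power_series : exists c : nat -> R[i], forall w, cabs w < 1 ->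
  series (fun n => c n * w ^+ n : R[i]^o) @ \oo --> (f w : R[i]^o).
Proof.
exists (taylor (1 / 2)) => w w1.
(* [1 / 2] is the radius that defines the coefficients, [r] is beyond it and [w]. *)
pose r := (Num.max (cabs w) (1 / 2) + 1) / 2.
have [wr hr r1] : [/\ cabs w < r, 1 / 2 < r & r < 1].
  have m1 : Num.max (cabs w) (1 / 2) < 1 by rewrite gt_max w1; lra.
  have m2 : cabs w <= Num.max (cabs w) (1 / 2) by rewrite le_max lexx.
  have m3 : 1 / 2 <= Num.max (cabs w) (1 / 2) by rewrite le_max lexx orbT.
  by rewrite /r; move: m1 m2 m3; set m := Num.max _ _; clear; split; lra.
have r0 : 0 < r by rewrite (lt_trans _ hr)//; lra.
have E k : taylor (1 / 2) k = taylor r k by apply: taylor_radius => //; lra.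
apply/cvgC_cabs; set C := 2 * (r * (2 * M) / (r - cabs w)).
apply: (@squeeze_cvgr _ _ _ _ (fun=> 0) (fun n => C * (cabs w / r) ^+ n)).
- near=> n; rewrite cabs_ge0/= /series /=.
  under eq_bigr do rewrite E.
  apply: taylor_remainder => //.
  by near: n; exact: nbhs_infty_gt.
- exact: cvg_cst.
- rewrite -(mulr0 C); apply: cvgM; first exact: cvg_cst.
  apply: cvg_expr; rewrite ger0_norm; last by rewrite mulr_ge0 ?cabs_ge0 ?invr_ge0 ?(ltW r0).
  by rewrite ltr_pdivrMr// mul1r.
Unshelve. all: by end_near.
Qed.

End expansion.
End power_series.

(** * Power series on the disc: Cauchy products and Parseval's identity *)

Section psums.
Variable R : realType.
Implicit Types (a b d : nat -> R[i]) (f g : R[i] -> R[i]) (z w : R[i]).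

Definition psums d f : Prop := forall w, cabs w < 1 ->
  series (fun n => d n * w ^+ n : R[i]^o) @ \oo --> (f w : R[i]^o).

Lemma geometric_sum_le (q : R) n : 0 <= q < 1 -> \sum_(i < n) q ^+ i <= (1 - q)^-1.
Proof.
move=> /andP[q0 q1]; have k0 : 0 < 1 - q by rewrite subr_gt0.
rewrite -[leRHS]mul1r ler_pdivlMr//.
by rewrite mulrC -opprB mulNr -subrX1 opprB gerBl exprn_ge0.
Qed.

Lemma natr_expr_bounded (q : R) : 0 <= q < 1 -> exists K, forall n : nat, n%:R * q ^+ n <= K.
Proof.
move=> q01; have /andP[q0 q1] := q01; exists (1 - q)^-1 => n.
apply: le_trans (geometric_sum_le n q01).
have -> : n%:R * q ^+ n = \sum_(i < n) q ^+ n.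
  by rewrite sumr_const card_ord mulr_natl.
apply: ler_sum => i _.
by rewrite ler_wiXn2l// ?(ltW q1)// ltnW.
Qed.

Lemma cvg_natr_sqr_expr (q : R) : 0 <= q < 1 ->
  (fun n : nat => n%:R ^+ 2 * q ^+ n) @ \oo --> (0 : R).
Proof.
(* [q = t^4] with [t < 1], and [n t^n] is bounded. *)
move=> /andP[q0 q1]; pose s := Num.sqrt q; pose t := Num.sqrt s.
have s01 : 0 <= s < 1 by rewrite sqrtr_ge0 -sqrtr1 ltr_sqrt ?ltr01.
have t01 : 0 <= t < 1 by rewrite sqrtr_ge0 -sqrtr1 ltr_sqrt ?ltr01//; case/andP: s01.
have [K HK] := natr_expr_bounded t01.
have K0 : 0 <= K by apply: le_trans (HK 0%N); rewrite mul0r.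
apply: (@squeeze_cvgr _ _ _ _ (fun=> 0) (fun n => K ^+ 2 * s ^+ n)).
- near=> n; rewrite mulr_ge0 ?exprn_ge0//=.
  have -> : q = t ^+ 2 * s by rewrite sqr_sqrtr ?sqrtr_ge0// -expr2 sqr_sqrtr.
  rewrite exprMn mulrA -exprM mulnC exprM -exprMn.
  rewrite ler_wpM2r ?exprn_ge0 ?sqrtr_ge0// lerXn2r ?nnegrE//.
  by rewrite mulr_ge0// exprn_ge0// sqrtr_ge0.
- exact: cvg_cst.
- rewrite -(mulr0 (K ^+ 2)); apply: cvgM; first exact: cvg_cst.
  by apply: cvg_expr; case/andP: s01 => h ?; rewrite ger0_norm.
Unshelve. all: by end_near.
Qed.

Lemma cvgC_bounded (u : nat -> R[i]) z : (u n : R[i]^o) @[n --> \oo] --> (z : R[i]^o) ->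
  exists C, forall n, cabs (u n) <= C.
Proof.
move=> /cvgC_cabs h.
have /cvg_seq_bounded [C [_ hC]] : cvgn (fun n => cabs (u n - z)) by apply/cvg_ex; exists 0.
exists (C + 1 + cabs z) => n.
have /hC /(_ n I) : C < C + 1 by rewrite ltrDl.
rewrite /= ger0_norm ?cabs_ge0// => h1.
rewrite -[u n](subrK z); apply: le_trans (cabsD _ _) _.
by rewrite lerD2r.
Qed.

(** The terms are bounded at the radius [s] halfway between [r] and [1]; going
    back to [r] gains the factor [(r / s)^n]. *)
Lemma psums_geometric d f r : psums d f -> 0 <= r < 1 -> exists C q, [/\ 0 <= C, 0 <= q < 1 &
  forall n, cabs (d n) * r ^+ n <= C * q ^+ n].
Proof.
move=> hd /andP[r0 r1]; pose s := (1 + r) / 2.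
have [rs s1 s0] : [/\ r < s, s < 1 & 0 < s] by rewrite /s; split; lra.
have s1' : cabs (s%:C : R[i]) < 1 by rewrite cabs_real gtr0_norm.
have [C hC] := cvgC_bounded (hd _ s1').
have C0 : 0 <= C by apply: le_trans (hC 0%N); exact: cabs_ge0.
exists (2 * C), (r / s); split.
- by rewrite mulr_ge0.
- by rewrite mulr_ge0 ?invr_ge0 ?(ltW s0)//= ltr_pdivrMr// mul1r.
move=> n; have -> : cabs (d n) * r ^+ n = (cabs (d n) * s ^+ n) * (r / s) ^+ n.
  by rewrite -mulrA -exprMn mulrCA divff ?mulr1// gt_eqF.
have rs0 : 0 <= r / s by rewrite mulr_ge0// invr_ge0 ltW.
rewrite ler_wpM2r ?exprn_ge0//.
have -> : cabs (d n) * s ^+ n = cabs (d n * s%:C ^+ n).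
  by rewrite cabsM cabsX cabs_real gtr0_norm.
have -> : d n * s%:C ^+ n = series (fun n => d n * s%:C ^+ n : R[i]^o) n.+1 -
    series (fun n => d n * s%:C ^+ n : R[i]^o) n.
  by rewrite /series /= big_nat_recr//= addrAC subrr add0r.
apply: le_trans (cabsD _ _) _; rewrite cabsN mulr_natl mulr2n lerD//; exact: hC.
Qed.

Definition cauchy_prod a b (n : nat) : R[i] := \sum_(j < n.+1) a j * b (n - j)%N.

(** Cauchy products: the partial sum of the product series differs from the
    product of the partial sums by the upper half of the coefficients of a
    product of two polynomials. *)
Lemma psums_mul a b f g : psums a f -> psums b g ->
  psums (cauchy_prod a b) (fun w => f w * g w).
Proof.
move=> ha hb w w1; have r01 : 0 <= cabs w < 1 by rewrite cabs_ge0.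
have [C1 [q1 [C10 q101 h1]]] := psums_geometric ha r01.
have [C2 [q2 [C20 q201 h2]]] := psums_geometric hb r01.
pose q := Num.max q1 q2; pose C := Num.max C1 C2.
have q01 : 0 <= q < 1.
  case/andP: q101 => ? ?; case/andP: q201 => ? ?.
  by rewrite le_max gt_max; apply/andP; split; apply/orP || apply/andP; [left|].
have C0 : 0 <= C by rewrite le_max C10.
have [q0 _] := andP q01.
have qle1 n : q1 ^+ n <= q ^+ n.
  by rewrite lerXn2r ?nnegrE// ?le_max ?lexx//; case/andP: q101.
have qle2 n : q2 ^+ n <= q ^+ n.
  by rewrite lerXn2r ?nnegrE// ?le_max ?lexx ?orbT//; case/andP: q201.
have {}h1 n : cabs (a n * w ^+ n) <= C * q ^+ n.
  rewrite cabsM cabsX; apply: le_trans (h1 n) _.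
  by rewrite ler_pM ?exprn_ge0 ?le_max ?lexx//; case/andP: q101.
have {}h2 n : cabs (b n * w ^+ n) <= C * q ^+ n.
  rewrite cabsM cabsX; apply: le_trans (h2 n) _.
  by rewrite ler_pM ?exprn_ge0 ?le_max ?lexx ?orbT//; case/andP: q201.
have /cvgC_cabs hp : (series (fun n => a n * w ^+ n : R[i]^o) n *
    series (fun n => b n * w ^+ n : R[i]^o) n : R[i]^o) @[n --> \oo] --> (f w * g w : R[i]^o).
  by apply: cvgM; [exact: ha|exact: hb].
apply/cvgC_cabs.
apply: (@squeeze_cvgr _ _ _ _ (fun=> 0)
  (fun n => cabs (series (fun n => a n * w ^+ n : R[i]^o) n *
                  series (fun n => b n * w ^+ n : R[i]^o) n - f w * g w) +
            2 * C ^+ 2 * (n%:R ^+ 2 * q ^+ n))); last 2 first.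
- exact: cvg_cst.
- rewrite -[X in _ --> X]addr0; apply: cvgD; first exact: hp.
  rewrite -(mulr0 (2 * C ^+ 2)); apply: cvgM; first exact: cvg_cst.
  exact: cvg_natr_sqr_expr.
near=> N; rewrite cabs_ge0; apply/andP; split=> //.
set SA := series _ N; set SB := series _ N; set SC := \sum_(0 <= k < N) cauchy_prod _ _ _ * _.
rewrite [X in cabs X <= _](_ : _ = (SA * SB - f w * g w) + (SC - SA * SB)); last by ring.
apply: le_trans (cabsD _ _) _; rewrite lerD2l.
pose P := \poly_(i < N) (a i * w ^+ i); pose Q := \poly_(i < N) (b i * w ^+ i).
have PQ1 : (P * Q).[1] = SA * SB.
  rewrite hornerM !horner_poly /SA /SB /series /= !big_mkord.
  by congr (_ * _); apply: eq_bigr => i _; rewrite expr1n mulr1.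
have sPQ : (size (P * Q)%R <= N + N)%N.
  apply: leq_trans (size_polyMleq _ _) _.
  by apply: leq_trans (leq_pred _) _; rewrite leq_add// size_poly.
have SCE : SC = \sum_(0 <= i < N) (P * Q)`_i.
  rewrite /SC /series /=; apply: eq_big_nat => i /andP[_ iN].
  rewrite coefM /cauchy_prod mulr_suml; apply: eq_bigr => j _.
  rewrite !coef_poly (leq_ltn_trans _ iN) ?(leq_ltn_trans (leq_subr _ _) iN)//; last by rewrite -ltnS.
  by rewrite mulrACA -exprD subnKC// -ltnS.
rewrite -PQ1 (horner_coef_wide _ sPQ).
under [X in _ - X]eq_bigr do rewrite expr1n mulr1.
rewrite -(big_mkord xpredT (fun i => (P * Q)`_i)) (big_cat_nat (n := N))//= ?leq_addr//.
rewrite -SCE opprD addrA subrr sub0r cabsN.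
apply: le_trans (cabs_sum _ _ _) _.
have bc i : (N <= i < N + N)%N -> cabs (P * Q)`_i <= (N + N)%:R * (C ^+ 2 * q ^+ N).
  move=> /andP[Ni iNN]; rewrite coefM; apply: le_trans (cabs_sum _ _ _) _.
  apply: (@le_trans _ _ (\sum_(j < i.+1) C ^+ 2 * q ^+ N)); last first.
    rewrite sumr_const card_ord -[leLHS]mulr_natl ler_wpM2r ?ler_nat//.
    by rewrite mulr_ge0// exprn_ge0.
  apply: ler_sum => j _; rewrite !coef_poly; case: ifP => _; last first.
    by rewrite mul0r cabs0 mulr_ge0// exprn_ge0.
  case: ifP => _; last by rewrite mulr0 cabs0 mulr_ge0// exprn_ge0.
  rewrite cabsM; apply: le_trans (ler_pM _ _ (h1 _) (h2 _)) _; rewrite ?cabs_ge0//.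
  have ji : (j <= i)%N by rewrite -ltnS.
  rewrite mulrACA -expr2 -exprD subnKC//; apply: ler_wpM2l; first exact: exprn_ge0.
  by apply: ler_wiXn2l => //; apply: ltW; case/andP: q01.
rewrite big_nat; apply: (@le_trans _ _ (\sum_(N <= i < N + N) (N + N)%:R * (C ^+ 2 * q ^+ N))).
  by rewrite [leRHS]big_nat; apply: ler_sum => i; exact: bc.
rewrite sumr_const_nat addKn -[leLHS]mulr_natl natrD.
by rewrite le_eqVlt; apply/orP; left; apply/eqP; ring.
Unshelve. all: by end_near.
Qed.

Lemma psumsD a b f g : psums a f -> psums b g ->
  psums (fun n => a n + b n) (fun w => f w + g w).
Proof.
move=> ha hb w w1.
rewrite (_ : series _ = series (fun n => a n * w ^+ n : R[i]^o) + series (fun n => b n * w ^+ n : R[i]^o)).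
  by apply: cvgD; [exact: ha|exact: hb].
apply/funext => n; rewrite /series /= [in RHS]/GRing.add /= -big_split.
by apply: eq_bigr => i _; rewrite mulrDl.
Qed.

Lemma psums_ext a b f g : psums a f -> a =1 b -> f =1 g -> psums b g.
Proof. by move=> h /funext <- /funext <-. Qed.

Lemma psums0 : psums (fun=> 0) (fun=> 0).
Proof.
move=> w _; rewrite (_ : series _ = fun=> 0); first exact: cvg_cst.
by apply/funext => n; rewrite /series /= big1// => i _; rewrite mul0r.
Qed.

Lemma psums_mulr d f (c : R[i]) : psums d f -> psums (fun n => d n * c) (fun w => f w * c).
Proof.
move=> hd w w1.
rewrite (_ : series _ = fun N => series (fun n => d n * w ^+ n : R[i]^o) N * c : R[i]^o).
  by apply: cvgM; [exact: hd|exact: cvg_cst].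
apply/funext => N; rewrite /series /= mulr_suml; apply: eq_bigr => n _.
by rewrite mulrAC.
Qed.

Lemma psums_sum (I : Type) (s : seq I) (d : I -> nat -> R[i]) (f : I -> R[i] -> R[i]) :
  (forall i, psums (d i) (f i)) ->
  psums (fun n => \sum_(i <- s) d i n) (fun w => \sum_(i <- s) f i w).
Proof.
move=> h; elim: s => [|i s IH].
  by apply: (psums_ext psums0) => ?; rewrite big_nil.
by apply: (psums_ext (psumsD (h i) IH)) => ?; rewrite big_cons.
Qed.

Lemma psums_poly N b : (forall n, (N <= n)%N -> b n = 0) ->
  psums b (fun w => \sum_(0 <= n < N) b n * w ^+ n).
Proof.
move=> hb w _; apply: cvg_near_cst.
near=> n; rewrite /series /= (big_cat_nat (n := N))//=; last by near: n; exact: nbhs_infty_ge.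
rewrite [X in _ + X]big_nat [X in _ + X]big1 ?addr0// => i /andP[Ni _].
by rewrite hb// mul0r.
Unshelve. all: by end_near.
Qed.

(** ** Parseval *)

Definition mean (h : R -> R) : R := (pi *+ 2)^-1 * sint 0 (pi *+ 2) h.

Lemma mean_circ (F : R -> R[i]) : ccontinuous F -> (forall t, F (t + pi *+ 2) = F t) ->
  mean (fun t => Re (F t)) = (pi *+ 2)^-1 * Re (circ F).
Proof.
move=> [F1 F2] per; rewrite /mean /circ /cint /=; congr (_ * _).
have := @sint_period _ (fun t => Re (F t)) (pi *+ 2) (- pi) 0.
rewrite add0r => -> //; last by move=> t; rewrite per.
rewrite oppr_le0 pi_ge0/= mulr2n addrA addNr add0r; exact: pi_ge0.
Qed.

Lemma polar_conj (r t : R) : ((polar r t)^*)%R = polar r (- t).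
Proof. by apply: eqC; rewrite ?Re_conj ?Im_conj /= ?cosN ?sinN ?mulrN. Qed.

(** Expand the square of the modulus and use [circ_character]. *)
Lemma parseval_poly d (r : R) N :
  mean (fun t => cabs (\sum_(0 <= n < N) d n * polar r t ^+ n) ^+ 2) =
  \sum_(0 <= n < N) cabs (d n) ^+ 2 * r ^+ (n * 2).
Proof.
pose z t := polar r t; pose S t := \sum_(0 <= n < N) d n * z t ^+ n.
pose S' t := \sum_(0 <= n < N) (d n)^* * polar r (- t) ^+ n.
have SS' t : ((S t)^*)%R = S' t.
  rewrite /S /S' rmorph_sum; apply: eq_bigr => i _.
  by rewrite rmorphM rmorphXn /= /z polar_conj.
have cz : ccontinuous z by exact: ccontinuous_polar.
have cz' : ccontinuous (fun t => polar r (- t)) by exact: ccontinuous_polarN.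
have cS : ccontinuous S by apply: ccontinuous_sum => n; apply: ccontinuousZ; exact: ccontinuousX.
have cS' : ccontinuous S' by apply: ccontinuous_sum => n; apply: ccontinuousZ; exact: ccontinuousX.
have -> : (fun t => cabs (\sum_(0 <= n < N) d n * polar r t ^+ n) ^+ 2) = (fun t => Re (S t * S' t)).
  by apply/funext => t; rewrite -SS' Re_mul_conj.
rewrite mean_circ; last 2 first.
- exact: ccontinuousM.
- by move=> t; rewrite /S /S' /z polarD2pi polarN_D2pi.
have cmn m n : ccontinuous (fun t => z t ^+ m * polar r (- t) ^+ n).
  by apply: ccontinuousM; exact: ccontinuousX.
have E : circ (fun t => S t * S' t) =
    \sum_(0 <= m < N) \sum_(0 <= n < N) (d m * (d n)^*) * circ (fun t => z t ^+ m * polar r (- t) ^+ n).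
  transitivity (circ (fun t => \sum_(0 <= m < N) \sum_(0 <= n < N)
      (d m * (d n)^*) * (z t ^+ m * polar r (- t) ^+ n))).
    apply: circ_eq => t; rewrite /S /S' mulr_suml; apply: eq_bigr => m _.
    by rewrite mulr_sumr; apply: eq_bigr => n _; rewrite mulrACA.
  rewrite circ_sum; last by move=> m; apply: ccontinuous_sum => n; exact: ccontinuousZ.
  apply: eq_bigr => m _; rewrite circ_sum; last by move=> n; exact: ccontinuousZ.
  by apply: eq_bigr => n _; rewrite circZ.
have char m n : circ (fun t => z t ^+ m * polar r (- t) ^+ n) =
    if m == n then (r ^+ (n * 2) * pi *+ 2)%:C else 0.
  have -> : circ (fun t => z t ^+ m * polar r (- t) ^+ n) =
      circ (fun t => (r%:C ^+ (m + n)) * (polar 1 t ^+ m * polar 1 (- t) ^+ n)).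
    apply: circ_eq => t; rewrite /z [polar r t]polar_mul [polar r (- t)]polar_mul.
    by rewrite !exprMn exprD mulrACA.
  rewrite circZ; last first.
    by apply: ccontinuousM; apply: ccontinuousX; [exact: ccontinuous_polar|exact: ccontinuous_polarN].
  case: eqVneq => [->|mn]; last by rewrite circ_character// mulr0.
  rewrite (@circ_eq _ _ (fun=> 1)); last first.
    move=> t; rewrite -exprMn polarM mulr1 subrr /polar cos0 sin0 mulr1 mulr0.
    exact: expr1n.
  by rewrite circ_cst mul1r -rmorphXn -rmorphM mulrnAr addnn -muln2.
rewrite E Re_sum mulr_sumr; apply: eq_big_nat => m mN.
rewrite (bigD1_seq m)/= ?mem_index_iota ?iota_uniq//.
rewrite char eqxx big1 ?addr0; last by move=> n nm; rewrite char eq_sym (negbTE nm) mulr0.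
rewrite ReMr Re_mul_conj -mulrnAr mulrA mulrC.
by rewrite -!mulrA mulfV ?mulr1// gt_eqF// pi2_gt0.
Qed.

End psums.

(** * From boundary values to Taylor coefficients *)

Section boundary.
Variable R : realType.

Lemma cvg_sumr (T : Type) (F : set_system T) {FF : Filter F} (I : Type) (s : seq I)
    (f : I -> T -> R) (l : I -> R) : (forall i, f i x @[x --> F] --> l i) ->
  \sum_(i <- s) f i x @[x --> F] --> \sum_(i <- s) l i.
Proof. by move=> h; apply: cvg_big => [|i _]; [exact: add_continuous|exact: h]. Qed.

Lemma continuous_sumr (I : Type) (s : seq I) (f : I -> R -> R) :
  (forall i, continuous (f i)) -> continuous (fun t => \sum_(i <- s) f i t).
Proof. by move=> h t; apply: cvg_sumr => i; exact: h. Qed.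

Lemma mean_sum (I : Type) (s : seq I) (f : I -> R -> R) : (forall i, continuous (f i)) ->
  mean (fun t => \sum_(i <- s) f i t) = \sum_(i <- s) mean (f i).
Proof.
move=> h; rewrite /mean -mulr_sumr; congr (_ * _).
have p2 := ltW (pi2_gt0 R); elim: s => [|i s IH].
  by under sint_eq do rewrite big_nil; rewrite big_nil sint_cst// mul0r.
under sint_eq do rewrite big_cons; rewrite big_cons -IH sintD//.
  exact: continuous_subspaceT.
by apply: continuous_subspaceT; exact: continuous_sumr.
Qed.

Lemma sint_dominated (f_ : nat -> R -> R) (f : R -> R) (a b B : R) :
  (forall n, continuous (f_ n)) -> continuous f ->
  (forall n t, `|f_ n t| <= B) ->
  {ae @lebesgue_measure R, forall t, a <= t <= b -> f_ n t @[n --> \oo] --> f t} ->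
  sint a b (f_ n) @[n --> \oo] --> sint a b f.
Proof.
move=> cf_ cf bf hae.
have mI : measurable (`[a, b]%classic : set R) by exact: measurable_itv.
have intf (g : R -> R) : continuous g ->
    (@lebesgue_measure R).-integrable `[a, b] (EFin \o g).
  by move=> cg; apply: sint_integrable; exact: continuous_subspaceT.
have [] := @dominated_convergence _ _ _ (@lebesgue_measure R) `[a, b]%classic mI
  (fun n => EFin \o f_ n) (EFin \o f) (EFin \o cst B).
- by move=> n; exact: measurable_int (intf _ (cf_ n)).
- exact: measurable_int (intf _ cf).
- apply: (@filterS _ _ (ae_filter_ringOfSetsType (@lebesgue_measure R)) _ _ _ hae) => t ht; rewrite /= in_itv /= => /ht h.
  by apply: cvg_EFin => //; near=> n.
- exact/sint_integrable/within_cst.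
- by apply: aeW => t n _ /=; rewrite lee_fin.
move=> fi _ hc; rewrite /sint /Rintegral.
apply: fine_cvg; rewrite fineK; last exact: integrable_fin_num.
exact: hc.
Unshelve. all: by end_near.
Qed.

Lemma continuous_cabs_sqr (F : R -> R[i]) : ccontinuous F ->
  continuous (fun t => cabs (F t) ^+ 2).
Proof.
move=> [F1 F2]; under eq_fun do rewrite cabs_sqr !expr2.
by move=> t; apply: cvgD; apply: cvgM; [exact: F1|exact: F1|exact: F2|exact: F2].
Qed.

Lemma cvg_cabs_sqr (T : Type) (F : set_system T) {FF : Filter F} (f : T -> R[i]) (z : R[i]) :
  (f x : R[i]^o) @[x --> F] --> (z : R[i]^o) ->
  cabs (f x) ^+ 2 @[x --> F] --> cabs z ^+ 2.
Proof.
move=> /cvgC_ReIm[h1 h2]; under eq_fun do rewrite cabs_sqr !expr2.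
by rewrite cabs_sqr !expr2; apply: cvgD; apply: cvgM.
Qed.

Lemma mean_cvg (f_ : nat -> R -> R) (f : R -> R) (B : R) :
  (forall n, continuous (f_ n)) -> continuous f ->
  (forall n t, `|f_ n t| <= B) ->
  {ae @lebesgue_measure R, forall t, 0 <= t <= pi *+ 2 -> f_ n t @[n --> \oo] --> f t} ->
  mean (f_ n) @[n --> \oo] --> mean f.
Proof.
move=> h1 h2 h3 h4; apply: cvgM; first exact: cvg_cst.
exact: sint_dominated h4.
Qed.

(** The partial sums converge boundedly on the circle, so [parseval_poly] passes to
    the limit. *)
Lemma parseval (d : nat -> R[i]) (f : R[i] -> R[i]) (r : R) : psums d f -> 0 <= r < 1 ->
  ccontinuous (fun t => f (polar r t)) ->
  series (fun n => cabs (d n) ^+ 2 * r ^+ (n * 2)) @ \oo -->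
    mean (fun t => cabs (f (polar r t)) ^+ 2).
Proof.
move=> hd r01 cf; have /andP[r0 r1] := r01.
have [C [q [C0 q01 hq]]] := psums_geometric hd r01.
rewrite (_ : series _ = fun N =>
    mean (fun t => cabs (\sum_(0 <= n < N) d n * polar r t ^+ n) ^+ 2)); last first.
  by apply/funext => N; rewrite parseval_poly.
have q1 : 0 <= (1 - q)^-1 by rewrite invr_ge0 subr_ge0 ltW//; case/andP: q01.
apply: (@mean_cvg _ _ ((C * (1 - q)^-1) ^+ 2)).
- move=> N; apply: continuous_cabs_sqr; apply: ccontinuous_sum => n.
  by apply: ccontinuousZ; apply: ccontinuousX; exact: ccontinuous_polar.
- exact: continuous_cabs_sqr.
- move=> N t; rewrite ger0_norm ?sqr_ge0// lerXn2r ?nnegrE ?cabs_ge0// ?mulr_ge0//.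
  apply: le_trans (cabs_sum _ _ _) _.
  apply: le_trans (ler_wpM2l C0 (geometric_sum_le N q01)).
  rewrite mulr_sumr -(big_mkord xpredT (fun n => C * q ^+ n)).
  by apply: ler_sum => n _; rewrite cabsM cabsX cabs_polar ger0_norm.
- apply: aeW => t _; apply: cvg_cabs_sqr; apply: hd.
  by rewrite cabs_polar ger0_norm.
Qed.

(** For nonnegative terms the limits in [n] and in [r -> 1] are suprema, which
    commute. *)
Lemma abel_series (x : nat -> R) (r : nat -> R) (I_ : nat -> R) (I : R) :
  (forall n, 0 <= x n) -> (forall k, 0 <= r k < 1) -> r @ \oo --> (1 : R) ->
  (forall k, series (fun n => x n * r k ^+ (n * 2)) @ \oo --> I_ k) ->
  I_ @ \oo --> I -> series x @ \oo --> I.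
Proof.
move=> x0 r01 r1 hI hI_.
have nds (y : nat -> R) : (forall n, 0 <= y n) -> nondecreasing_seq (series y).
  by move=> y0; apply/nondecreasing_seqP => n; rewrite /series /= big_nat_recr//= lerDl.
have y0 k n : 0 <= x n * r k ^+ (n * 2).
  by rewrite mulr_ge0// exprn_ge0//; case/andP: (r01 k).
have up N : series x N <= I.
  have h1 : (fun k => \sum_(0 <= n < N) x n * r k ^+ (n * 2)) @ \oo --> series x N.
    rewrite /series /=; apply: cvg_sumr => n.
    rewrite -[X in _ --> X]mulr1; apply: cvgM; first exact: cvg_cst.
    have h := @exprn_continuous R (n * 2) 1; rewrite /continuous_at /= expr1n in h.
    exact: cvg_comp r1 h.
  have := @ler_cvg_to _ _ _ _ _ _ _ _ h1 hI_; apply; near=> k.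
  rewrite -(cvg_lim _ (hI k))//.
  apply: (nondecreasing_cvgn_le (nds _ (y0 k))); by apply/cvg_ex; exists (I_ k).
have cx : cvgn (series x).
  by apply: nondecreasing_is_cvgn; [exact: nds|exists I => _ [N _ <-]].
have xl := nondecreasing_cvgn_le (nds _ x0) cx.
suff -> : I = limn (series x) by [].
apply/le_anti/andP; split; last first.
  by apply: limr_le => //; near=> N.
rewrite -(cvg_lim _ hI_)//; apply: limr_le; first by apply/cvg_ex; exists I.
near=> k; rewrite -(cvg_lim _ (hI k))//; apply: limr_le.
  by apply/cvg_ex; exists (I_ k).
near=> N; apply: le_trans (xl N); apply: ler_sum => n _.
by rewrite ler_piMr// exprn_ile1//; case/andP: (r01 k) => // ? /ltW.
Unshelve. all: by end_near.
Qed.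

Lemma cvnorm_sqr m (x : 'cV[R[i]]_m) : cvnorm x ^+ 2 = \sum_(i < m) cabs (x i 0) ^+ 2.
Proof.
rewrite /cvnorm sqr_sqrtr /cvdot Re_sum.
  by apply: eq_bigr => i _; rewrite Re_mul_conj.
by apply: sumr_ge0 => i _; rewrite Re_mul_conj sqr_ge0.
Qed.

Lemma cvnorm_ge0 m (x : 'cV[R[i]]_m) : 0 <= cvnorm x.
Proof. exact: sqrtr_ge0. Qed.

Lemma cabs_le_cvnorm m (x : 'cV[R[i]]_m) i : cabs (x i 0) <= cvnorm x.
Proof.
rewrite -(@ler_pXn2r _ 2) ?nnegrE ?cabs_ge0 ?cvnorm_ge0//.
by rewrite cvnorm_sqr (bigD1 i)//= lerDl sumr_ge0// => j _; exact: sqr_ge0.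
Qed.

(** If the norm of a bounded vector power series has a continuous function as
    radial limit almost everywhere, the squares of its coefficients sum up to
    the mean of the square of that limit: Parseval on the circles of radius
    [r < 1], then dominated convergence. *)
Lemma boundary_parseval m (G : R[i] -> 'cV[R[i]]_m) (d : nat -> 'cV[R[i]]_m)
    (H : R -> R) (B : R) :
  (forall i, psums (fun n => d n i 0) (fun w => G w i 0)) ->
  (forall i w, cabs w < 1 -> ccont_at (fun w => G w i 0) w) ->
  (forall i w, cabs w < 1 -> cabs (G w i 0) <= B) ->
  continuous H ->
  {ae @lebesgue_measure R, forall t, 0 <= t <= pi *+ 2 ->
    exists2 V : 'cV[R[i]]_m, cvnorm V ^+ 2 = H t &
      forall i, (G (polar r t) i 0 : R[i]^o) @[r --> (1 : R)^'-] --> (V i 0 : R[i]^o)} ->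
  series (fun n => cvnorm (d n) ^+ 2) @ \oo --> mean H.
Proof.
move=> hd hc hB cH hae.
(* Dominated convergence needs a sequence of radii. *)
pose r k : R := 1 - k.+1%:R^-1.
have r01 k : 0 <= r k < 1.
  by rewrite subr_ge0 ltrBlDr ltrDl invr_gt0 ltr0Sn invf_le1 ?ler1n ?ltr0n.
have r1 : r @ \oo --> (1 : R).
  rewrite -[X in _ --> X]subr0; apply: cvgB; first exact: cvg_cst.
  exact: cvg_harmonic.
have cG i k : ccontinuous (fun t => G (polar (r k) t) i 0).
  have /andP[k0 k1] := r01 k.
  move: k0; rewrite le_eqVlt => /orP[/eqP k0|k0].
    by under eq_fun do rewrite -k0 /polar !mul0r; exact: ccontinuous_cst.
  by apply: (@ccontinuous_circle _ (fun w => G w i 0)) => // z zr; apply: hc; rewrite zr.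
apply: (@abel_series _ r (fun k => mean (fun t => cvnorm (G (polar (r k) t)) ^+ 2))) => //.
- by move=> n; exact: sqr_ge0.
- move=> k.
  rewrite (_ : series _ = fun N => \sum_(i < m) series (fun n => cabs (d n i 0) ^+ 2 * r k ^+ (n * 2)) N); last first.
    apply/funext => N; rewrite /series /= exchange_big /=; apply: eq_bigr => n _.
    by rewrite cvnorm_sqr mulr_suml.
  under [X in mean X]eq_fun do rewrite cvnorm_sqr.
  rewrite mean_sum; last by move=> i; exact: continuous_cabs_sqr.
  by apply: cvg_sumr => i; exact: (parseval (hd i)).
- apply: (@mean_cvg _ _ (\sum_(i < m) B ^+ 2)) => //.
  + move=> k; under eq_fun do rewrite cvnorm_sqr.
    move=> t; apply: cvg_sumr => i; exact: (continuous_cabs_sqr (cG i k)).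
  + move=> k t; rewrite ger0_norm ?sqr_ge0// cvnorm_sqr; apply: ler_sum => i _.
    have /andP[k0 k1] := r01 k.
    have hp : cabs (polar (r k) t) < 1 by rewrite cabs_polar ger0_norm.
    rewrite lerXn2r ?nnegrE ?cabs_ge0 ?hB// (le_trans (cabs_ge0 _) (hB i _ hp))//.
  + apply: (@filterS _ _ (ae_filter_ringOfSetsType (@lebesgue_measure R)) _ _ _ hae) => t ht /ht[V <- hV].
    rewrite cvnorm_sqr; under eq_fun do rewrite cvnorm_sqr.
    apply: cvg_sumr => i; apply: cvg_cabs_sqr.
    have /cvgC_ReIm[h1 h2] := hV i.
    have rl : (forall n, r n < 1) /\ r @ \oo --> (1 : R).
      by split=> // n; case/andP: (r01 n).
    apply/cvgC_ReIm; split.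
      exact: ((cvg_at_leftP (fun r => Re (G (polar r t) i 0)) 1 _).1 h1 _ rl).
    exact: ((cvg_at_leftP (fun r => Im (G (polar r t) i 0)) 1 _).1 h2 _ rl).
Qed.

End boundary.

(** * Taylor coefficients of an inner function *)

Section unitary.
Variables (R : realType) (p : nat).
Implicit Types (U : 'M[R[i]]_p) (x y : 'cV[R[i]]_p).

Definition adjmx m n (U : 'M[R[i]]_(m, n)) : 'M[R[i]]_(n, m) := (map_mx Num.conj U)^T.

Lemma cvdotE m (x y : 'cV[R[i]]_m) : cvdot x y = (adjmx y *m x) 0 0.
Proof. by rewrite /cvdot mxE; apply: eq_bigr => i _; rewrite !mxE mulrC. Qed.

Lemma adjmxM m n k (A : 'M[R[i]]_(m, n)) (B : 'M[R[i]]_(n, k)) :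
  adjmx (A *m B) = adjmx B *m adjmx A.
Proof. by rewrite /adjmx map_mxM trmx_mul. Qed.

Lemma adjmxK m n (A : 'M[R[i]]_(m, n)) : adjmx (adjmx A) = A.
Proof. by apply/matrixP => i j; rewrite !mxE conjCK. Qed.

Lemma cvdot_adj m n (A : 'M[R[i]]_(m, n)) (x : 'cV_n) (y : 'cV_m) :
  cvdot (A *m x) y = cvdot x (adjmx A *m y).
Proof. by rewrite !cvdotE adjmxM adjmxK mulmxA. Qed.

Lemma cvdotDl m (x y z : 'cV[R[i]]_m) : cvdot (x + y) z = cvdot x z + cvdot y z.
Proof. by rewrite /cvdot -big_split; apply: eq_bigr => i _; rewrite mxE mulrDl. Qed.

Lemma cvdotDr m (x y z : 'cV[R[i]]_m) : cvdot x (y + z) = cvdot x y + cvdot x z.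
Proof. by rewrite /cvdot -big_split; apply: eq_bigr => i _; rewrite mxE rmorphD mulrDr. Qed.

Lemma cvdotZl m (a : R[i]) (x y : 'cV[R[i]]_m) : cvdot (a *: x) y = a * cvdot x y.
Proof. by rewrite /cvdot mulr_sumr; apply: eq_bigr => i _; rewrite mxE mulrA. Qed.

Lemma cvdotZr m (a : R[i]) (x y : 'cV[R[i]]_m) : cvdot x (a *: y) = (a^*)%R * cvdot x y.
Proof. by rewrite /cvdot mulr_sumr; apply: eq_bigr => i _; rewrite mxE rmorphM mulrCA. Qed.

Lemma cvdot_conj m (x y : 'cV[R[i]]_m) : ((cvdot x y)^*)%R = cvdot y x.
Proof. by rewrite /cvdot rmorph_sum; apply: eq_bigr => i _; rewrite rmorphM /= conjCK mulrC. Qed.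

Lemma Re_cvdotC m (x y : 'cV[R[i]]_m) : Re (cvdot x y) = Re (cvdot y x).
Proof. by rewrite -cvdot_conj Re_conj. Qed.

Lemma Re_cvdot_sqr m (x : 'cV[R[i]]_m) : Re (cvdot x x) = cvnorm x ^+ 2.
Proof.
rewrite cvnorm_sqr /cvdot Re_sum; apply: eq_bigr => i _; exact: Re_mul_conj.
Qed.

Lemma Im_cvdot m (x y : 'cV[R[i]]_m) : Im (cvdot x y) = Re (cvdot x ('i *: y)).
Proof. by rewrite cvdotZr ReM; case: (cvdot x y) => a b /=; rewrite mul0r sub0r mulN1r opprK. Qed.

(** Polarization recovers the Hermitian product from the norm. *)
Lemma isometric_unitary U : isometric U -> adjmx U *m U = 1%:M.
Proof.
move=> iso.
have re x y : Re (cvdot (U *m x) (U *m y)) = Re (cvdot x y).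
  have := congr1 (fun r => r ^+ 2) (iso (x + y)).
  rewrite -!Re_cvdot_sqr mulmxDr !cvdotDl !cvdotDr !ReD !Re_cvdot_sqr !iso.
  rewrite (Re_cvdotC (U *m y)) (Re_cvdotC y); lra.
have im x y : cvdot (U *m x) (U *m y) = cvdot x y.
  by apply: eqC; [exact: re|rewrite !Im_cvdot scalemxAr re].
apply/matrixP => i j.
have := im (delta_mx j 0) (delta_mx i 0).
rewrite !cvdotE adjmxM -mulmxA (mulmxA (adjmx U)) => h.
have E (M : 'M[R[i]]_p) : (adjmx (delta_mx i (0 : 'I_1)) *m (M *m delta_mx j (0 : 'I_1))) 0 0 = M i j.
  have -> : adjmx (delta_mx i (0 : 'I_1)) = delta_mx 0 i :> 'M[R[i]]_(1, p).
    by apply/matrixP => k l; rewrite !mxE rmorph_nat andbC.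
  by rewrite mulmxA -rowE -colE !mxE.
by rewrite -(E (adjmx U *m U)) -(E 1%:M) mul1mx.
Qed.

(** Finite dimension enters here: a left inverse of a square matrix is also a
    right inverse. *)
Lemma isometric_tr U : isometric U -> isometric U^T.
Proof.
move=> /isometric_unitary/mulmx1C h x.
apply: (@pexpIrn _ 2) => //; rewrite ?nnegrE ?cvnorm_ge0//.
rewrite -!Re_cvdot_sqr cvdot_adj mulmxA.
have -> : adjmx U^T *m U^T = 1%:M.
  rewrite /adjmx map_trmx trmxK; apply: trmx_inj; rewrite trmx_mul trmxK trmx1.
  by rewrite -h /adjmx.
by rewrite mul1mx.
Qed.

End unitary.

Section inner_coefficients.
Variables (R : realType) (p : nat).
Implicit Types (b : nat -> 'cV[R[i]]_p).

Definition conv (A : nat -> 'M[R[i]]_p) b (n : nat) : 'cV[R[i]]_p :=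
  \sum_(j < n.+1) A j *m b (n - j)%N.

Definition mx_psums (A : nat -> 'M[R[i]]_p) (Theta : R[i] -> 'M[R[i]]_p) :=
  forall i j, psums (fun n => A n i j) (fun w => Theta w i j).

Lemma conv_psums A Theta b (g : R[i] -> 'cV[R[i]]_p) : mx_psums A Theta ->
  (forall i, psums (fun n => b n i 0) (fun w => g w i 0)) ->
  forall i, psums (fun n => conv A b n i 0) (fun w => (Theta w *m g w) i 0).
Proof.
move=> hA hb i; have h j := psums_mul (hA i j) (hb j).
refine (psums_ext (@psums_sum _ _ (index_enum 'I_p) _ _ h) _ _) => [n|w]; last by rewrite mxE.
rewrite /conv summxE /cauchy_prod exchange_big /=; apply: eq_bigr => l _.
by rewrite mxE.
Qed.

Lemma cvgC_sum (T : Type) (F : set_system T) {FF : Filter F} (I : Type) (s : seq I)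
    (f : I -> T -> R[i]) (l : I -> R[i]) :
  (forall i, (f i x : R[i]^o) @[x --> F] --> (l i : R[i]^o)) ->
  (\sum_(i <- s) f i x : R[i]^o) @[x --> F] --> (\sum_(i <- s) l i : R[i]^o).
Proof.
move=> h; apply/cvgC_ReIm; split.
  under eq_fun do rewrite Re_sum; rewrite Re_sum; apply: cvg_sumr => i.
  by have /cvgC_ReIm[] := h i.
under eq_fun do rewrite Im_sum; rewrite Im_sum; apply: cvg_sumr => i.
by have /cvgC_ReIm[] := h i.
Qed.

Lemma cvg_ccont_at (f : R[i] -> R[i]) w :
  (f z : R[i]^o) @[z --> (w : R[i]^o)] --> (f w : R[i]^o) -> ccont_at f w.
Proof.
move=> h e e0; have e0' : (0 : R[i]) < e%:C by rewrite ltcR.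
move/cvgrPdistC_lt : h => /(_ _ e0') /nbhs_ballP[[r r'] /=].
rewrite ltcE /= => /andP[/eqP -> r0] h; exists r => // z hz.
rewrite -ltcR -normC_cabs; apply: h.
by rewrite /ball /= distrC normC_cabs ltcR.
Qed.

Lemma cvg_polar (t : R) : (polar r t : R[i]^o) @[r --> (1 : R)^'-] --> (polar 1 t : R[i]^o).
Proof.
apply/cvgC_ReIm; split; apply: cvgM; try exact: cvg_cst;
  apply: cvg_at_left_filter; exact: cvg_id.
Qed.

Lemma cvgC_exp (T : Type) (F : set_system T) {FF : Filter F} (f : T -> R[i]) z n :
  (f x : R[i]^o) @[x --> F] --> (z : R[i]^o) ->
  (f x ^+ n : R[i]^o) @[x --> F] --> (z ^+ n : R[i]^o).
Proof.
move=> h; elim: n => [|n IH]; first by under eq_fun do rewrite expr0; exact: cvg_cst.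
by under eq_fun do rewrite exprS; rewrite exprS; apply: cvgM; [exact: h|exact: IH].
Qed.

Section inner.
Variables (Theta : R[i] -> 'M[R[i]]_p) (Theta_inner : inner_multiplier Theta).

Lemma inner_entry_bound : exists2 M, 0 <= M &
  forall i j w, cabs w < 1 -> cabs (Theta w i j) <= M.
Proof.
have [[_ [M hM]] _] := Theta_inner.
exists `|M| => // i j w w1.
have w1' : `|w| < 1 by rewrite normC_cabs ltcR.
have := hM w (delta_mx j 0) w1'.
have -> : cvnorm (delta_mx j 0 : 'cV[R[i]]_p) = 1.
  apply: (@pexpIrn _ 2) => //; rewrite ?nnegrE ?cvnorm_ge0//.
  rewrite cvnorm_sqr expr1n (bigD1 j)//= mxE !eqxx cabs1 expr1n big1 ?addr0// => k kj.
  by rewrite mxE (negbTE kj) cabs0 expr0n.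
rewrite mulr1 => h; apply: le_trans (ler_norm M); apply: le_trans h.
apply: le_trans (cabs_le_cvnorm _ i).
by rewrite -colE mxE.
Qed.

Lemma inner_psums : exists A, mx_psums A Theta.
Proof.
have [M _ hM] := inner_entry_bound; have [[hd _] _] := Theta_inner.
have h (ij : 'I_p * 'I_p) : exists c : nat -> R[i], psums c (fun w => Theta w ij.1 ij.2).
  apply: (@hol_power_series _ (fun w => Theta w ij.1 ij.2) M).
    by move=> w w1; apply: hd; rewrite normC_cabs ltcR.
  by move=> w w1; exact: hM.
have [c hc] := boolp.choice h.
exists (fun n => \matrix_(i, j) c (i, j) n) => i j.
by refine (psums_ext (hc (i, j)) _ _) => // n; rewrite mxE.
Qed.

Lemma inner_cvg i j w : cabs w < 1 ->
  (Theta z i j : R[i]^o) @[z --> (w : R[i]^o)] --> (Theta w i j : R[i]^o).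
Proof.
move=> w1; have [[hd _] _] := Theta_inner.
have w1' : `|w| < 1 by rewrite normC_cabs ltcR.
exact: (differentiable_continuous ((derivable1_diffP _ _).1 (hd i j w w1'))).
Qed.

Variable (A : nat -> 'M[R[i]]_p).
Hypothesis A_psums : mx_psums A Theta.

(** Apply [boundary_parseval] to [Theta q]: on the boundary its norm is the one of
    the polynomial [q], whose mean [parseval_poly] computes. *)
Lemma inner_poly_isometry b N : (forall n, (N <= n)%N -> b n = 0) ->
  series (fun n => cvnorm (conv A b n) ^+ 2) @ \oo --> \sum_(0 <= n < N) cvnorm (b n) ^+ 2.
Proof.
move=> hb; pose q w : 'cV[R[i]]_p := \sum_(0 <= n < N) w ^+ n *: b n.
have qE w j : q w j 0 = \sum_(0 <= n < N) b n j 0 * w ^+ n.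
  by rewrite /q summxE; apply: eq_bigr => n _; rewrite mxE mulrC.
have hq j : psums (fun n => b n j 0) (fun w => q w j 0).
  have hbj n : (N <= n)%N -> b n j 0 = 0 by move=> Nn; rewrite hb// mxE.
  by refine (psums_ext (psums_poly hbj) _ _) => // w; rewrite qE.
have qcvg (T : Type) (F : set_system T) (FF : Filter F) (f : T -> R[i]) z j :
    (f x : R[i]^o) @[x --> F] --> (z : R[i]^o) ->
    (q (f x) j 0 : R[i]^o) @[x --> F] --> (q z j 0 : R[i]^o).
  move=> h; under eq_fun do rewrite qE; rewrite qE; apply: cvgC_sum => n.
  by apply: cvgM; [exact: cvg_cst|exact: cvgC_exp].
have [M M0 hM] := inner_entry_bound.
have -> : \sum_(0 <= n < N) cvnorm (b n) ^+ 2 = mean (fun t => cvnorm (q (polar 1 t)) ^+ 2).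
  under [X in mean X]eq_fun do rewrite cvnorm_sqr.
  under eq_bigr do rewrite cvnorm_sqr; rewrite exchange_big /= mean_sum; last first.
    move=> j; apply: continuous_cabs_sqr; under eq_fun do rewrite qE.
    apply: ccontinuous_sum => n; apply: ccontinuousZ; apply: ccontinuousX.
    exact: ccontinuous_polar.
  apply: eq_bigr => j _; under [X in mean X]eq_fun do rewrite qE.
  by rewrite parseval_poly; apply: eq_bigr => n _; rewrite expr1n mulr1.
apply: (@boundary_parseval _ _ (fun w => Theta w *m q w) _ _
  (\sum_(j < p) M * \sum_(0 <= n < N) cabs (b n j 0))).
- exact: conv_psums.
- move=> i w w1; apply: cvg_ccont_at.
  under eq_fun do rewrite mxE; rewrite mxE.
  apply: (@cvgC_sum _ _ (nbhs_filter (w : R[i]^o))) => j.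
  apply: cvgM; first exact: inner_cvg.
  by apply: qcvg; exact: cvg_id.
- move=> i w w1; rewrite mxE; apply: le_trans (cabs_sum _ _ _) _.
  apply: ler_sum => j _; rewrite cabsM; apply: ler_pM; rewrite ?cabs_ge0 ?hM//.
  rewrite qE; apply: le_trans (cabs_sum _ _ _) _; apply: ler_sum => n _.
  rewrite cabsM cabsX ler_piMr ?cabs_ge0// exprn_ile1 ?cabs_ge0//; exact: ltW.
- under eq_fun do rewrite cvnorm_sqr; apply: continuous_sumr => j.
  apply: continuous_cabs_sqr; under eq_fun do rewrite qE.
  apply: ccontinuous_sum => n; apply: ccontinuousZ; apply: ccontinuousX.
  exact: ccontinuous_polar.
- have [_ hae] := Theta_inner.
  apply: (@filterS _ _ (ae_filter_ringOfSetsType (@lebesgue_measure R)) _ _ _ hae) => t ht /ht[U hU isoU].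
  exists (U *m q (polar 1 t)); first by rewrite isoU.
  move=> i; under eq_fun do rewrite mxE; rewrite mxE; apply: cvgC_sum => j.
  apply: cvgM; first exact: hU.
  by apply: qcvg; exact: cvg_polar.
Qed.

(** The transposes of the boundary values are isometries too, and the constant
    vector [y] replaces the polynomial. *)
Lemma inner_tr_isometry (y : 'cV[R[i]]_p) :
  series (fun n => cvnorm ((A n)^T *m y) ^+ 2) @ \oo --> cvnorm y ^+ 2.
Proof.
have [M M0 hM] := inner_entry_bound.
have -> : cvnorm y ^+ 2 = mean (fun=> cvnorm y ^+ 2).
  rewrite /mean sint_cst ?(ltW (pi2_gt0 R))// subr0 mulrCA mulVf ?mulr1//.
  by rewrite gt_eqF// pi2_gt0.
apply: (@boundary_parseval _ _ (fun w => (Theta w)^T *m y) _ _ (\sum_(j < p) M * cabs (y j 0))).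
- move=> i; have h j : psums (fun n => A n j i * y j 0) (fun w => Theta w j i * y j 0).
    exact: psums_mulr.
  refine (psums_ext (@psums_sum _ _ (index_enum 'I_p) _ _ h) _ _) => [n|w]; rewrite mxE; apply: eq_bigr => j _; by rewrite mxE.
- move=> i w w1; apply: cvg_ccont_at.
  under eq_fun do rewrite mxE; rewrite mxE.
  apply: (@cvgC_sum _ _ (nbhs_filter (w : R[i]^o))) => j.
  apply: cvgM; last exact: cvg_cst.
  by under eq_fun do rewrite mxE; rewrite mxE; exact: inner_cvg.
- move=> i w w1; rewrite mxE; apply: le_trans (cabs_sum _ _ _) _.
  by apply: ler_sum => j _; rewrite cabsM mxE ler_wpM2r ?cabs_ge0 ?hM.
- by move=> t; exact: cvg_cst.
- have [_ hae] := Theta_inner.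
  apply: (@filterS _ _ (ae_filter_ringOfSetsType (@lebesgue_measure R)) _ _ _ hae) => t ht /ht[U hU isoU].
  exists (U^T *m y); first by rewrite (isometric_tr isoU).
  move=> i; under eq_fun do rewrite mxE; rewrite mxE; apply: cvgC_sum => j.
  apply: cvgM; last exact: cvg_cst.
  by under eq_fun do rewrite mxE; rewrite mxE; exact: hU.
Qed.

End inner.
End inner_coefficients.

(** * The Hilbert space of square summable sequences *)

Section l2_type.
Variables (R : realType) (p : nat).
Local Notation vec := 'cV[R[i]]_p.
Implicit Types (a b : nat -> vec).

Lemma square_summable_bounded a (B : R) :
  (forall N, \sum_(0 <= n < N) cvnorm (a n) ^+ 2 <= B) -> square_summable a.
Proof.
move=> h; apply: nondecreasing_is_cvgn.
  by apply/nondecreasing_seqP => n; rewrite /series /= big_nat_recr//= lerDl sqr_ge0.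
by exists B => _ [N _ <-]; exact: h.
Qed.

Lemma cvnorm_sqrD (x y : vec) : cvnorm (x + y) ^+ 2 <= 2 * (cvnorm x ^+ 2 + cvnorm y ^+ 2).
Proof.
rewrite !cvnorm_sqr -big_split /= mulr_sumr; apply: ler_sum => i _; rewrite mxE.
have h := cabsD (x i 0) (y i 0).
have : cabs (x i 0 + y i 0) ^+ 2 <= (cabs (x i 0) + cabs (y i 0)) ^+ 2.
  by rewrite ler_pXn2r ?nnegrE ?cabs_ge0 ?addr_ge0 ?cabs_ge0.
have := sqr_ge0 (cabs (x i 0) - cabs (y i 0)).
set s := cabs _; set t := cabs (y i 0); set u := cabs (_ + _) ^+ 2; rewrite !expr2.
by move=> h1 h2; lra.
Qed.

Lemma cvnorm_sqrZ (c : R[i]) (x : vec) : cvnorm (c *: x) ^+ 2 = cabs c ^+ 2 * cvnorm x ^+ 2.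
Proof.
by rewrite !cvnorm_sqr mulr_sumr; apply: eq_bigr => i _; rewrite mxE cabsM exprMn.
Qed.

Definition l2pred : {pred nat -> vec} := [pred a | `[< square_summable a >]].

Lemma l2_submod_closed : submod_closed l2pred.
Proof.
split=> [|c a b /asboolP ha /asboolP hb]; apply/asboolP.
  apply: (@square_summable_bounded _ 0) => N; rewrite big1// => n _.
  by rewrite cvnorm_sqr big1// => i _; rewrite mxE cabs0 expr0n.
have hab : cvgn (series (fun n => 2 * (cabs c ^+ 2 * cvnorm (a n) ^+ 2 + cvnorm (b n) ^+ 2))).
  rewrite (_ : series _ = fun N => 2 * (cabs c ^+ 2 * series (fun n => cvnorm (a n) ^+ 2) N +
      series (fun n => cvnorm (b n) ^+ 2) N)).
    by apply: is_cvgMr; apply: is_cvgD => //; exact: is_cvgMr.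
  apply/funext => N; rewrite /series /= [in RHS]mulr_sumr -big_split /= mulr_sumr.
  by apply: eq_bigr.
apply: (series_le_cvg _ _ _ hab) => n; rewrite ?sqr_ge0//.
  apply: mulr_ge0 => //. apply: addr_ge0. apply: mulr_ge0. exact: sqr_ge0. exact: sqr_ge0. exact: sqr_ge0.
rewrite -cvnorm_sqrZ; exact: cvnorm_sqrD.
Qed.

HB.instance Definition _ := GRing.isSubmodClosed.Build R[i] (nat -> vec) l2pred l2_submod_closed.

Record l2 : Type := L2 { l2val :> nat -> vec; l2valP : l2val \in l2pred }.

HB.instance Definition _ := [isSub for l2val].
HB.instance Definition _ := [Choice of l2 by <:].
HB.instance Definition _ := [SubChoice_isSubLmodule of l2 by <:].

Arguments l2val : simpl never.

Implicit Types (x y z : l2) (c : R[i]) (r : R).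

Lemma l2P x : square_summable x.
Proof. by have := l2valP x => /asboolP. Qed.

Definition mkl2 a (h : square_summable a) : l2 := L2 (asboolT h : a \in l2pred).

Lemma l2_ext x y : (forall n, x n = y n) -> x = y.
Proof. by move=> h; apply: val_inj; apply/funext. Qed.

Lemma l2D x y n : l2val (x + y) n = x n + y n. Proof. by []. Qed.
Lemma l2B x y n : l2val (x - y) n = x n - y n. Proof. by []. Qed.
Lemma l2Z c x n : l2val (c *: x) n = c *: x n. Proof. by []. Qed.
Lemma l2_sum (I : Type) (s : seq I) (F : I -> l2) n :
  l2val (\sum_(i <- s) F i) n = \sum_(i <- s) F i n.
Proof. by elim: s => [|i s IH]; rewrite ?big_nil// !big_cons l2D IH. Qed.

(** ** The real inner product *)

(** The real part of the Hermitian product. The imaginary part is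
    [dot x ('i *: y)], so on complex subspaces orthogonality and adjoints for
    [dot] are those for the Hermitian product. *)
Definition dot x y : R := limn (series (fun n => Re (cvdot (x n) (y n)))).

Lemma Re_cvdot_le (v w : vec) : `|Re (cvdot v w)| <= cvnorm v ^+ 2 + cvnorm w ^+ 2.
Proof.
rewrite /cvdot Re_sum !cvnorm_sqr -big_split /=.
apply: le_trans (ler_norm_sum _ _ _) _; apply: ler_sum => i _.
apply: le_trans (Re_le_cabs _) _; rewrite cabsM.
rewrite (_ : cabs ((w i 0)^*)%R = cabs (w i 0)); last exact: cabs_conj.
have := sqr_ge0 (cabs (v i 0) - cabs (w i 0)).
have := sqr_ge0 (cabs (v i 0)); have := sqr_ge0 (cabs (w i 0)).
by rewrite /= !expr2; set s := cabs _; set t := cabs _; move=> h1 h2 h3; lra.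
Qed.

Lemma dot_cvg x y : series (fun n => Re (cvdot (x n) (y n))) @ \oo --> dot x y.
Proof.
suff : cvgn (series (fun n => Re (cvdot (x n) (y n)))) by [].
apply: normed_cvg.
have hab : cvgn (series (fun n => cvnorm (x n) ^+ 2 + cvnorm (y n) ^+ 2)).
  rewrite (_ : series _ = series (fun n => cvnorm (x n) ^+ 2) + series (fun n => cvnorm (y n) ^+ 2)).
    by apply: is_cvgD; exact: l2P.
  by apply/funext => N; rewrite /series /= [in RHS]/GRing.add /= -big_split /=.
apply: (series_le_cvg _ _ _ hab) => n //=; first by rewrite addr_ge0 ?sqr_ge0.
exact: Re_cvdot_le.
Qed.

Arguments dot_cvg : clear implicits.

Lemma dot_lim x y (l : R) : series (fun n => Re (cvdot (x n) (y n))) @ \oo --> l -> dot x y = l.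
Proof. by move=> h; apply: cvg_lim. Qed.

Lemma dotC x y : dot x y = dot y x.
Proof.
by rewrite /dot; congr (limn (series _)); apply/funext => n; rewrite Re_cvdotC.
Qed.

Lemma dotDl x y z : dot (x + y) z = dot x z + dot y z.
Proof.
apply: dot_lim; rewrite (_ : series _ = series (fun n => Re (cvdot (x n) (z n))) +
    series (fun n => Re (cvdot (y n) (z n)))).
  by apply: cvgD; exact: dot_cvg.
apply/funext => N; rewrite /series /= [in RHS]/GRing.add /= -big_split /=.
by apply: eq_bigr => n _; rewrite l2D cvdotDl ReD.
Qed.

Lemma dotZl r x z : dot (r%:C *: x) z = r * dot x z.
Proof.
apply: dot_lim; rewrite (_ : series _ = fun N => r * series (fun n => Re (cvdot (x n) (z n))) N).
  by apply: cvgM; [exact: cvg_cst|exact: dot_cvg].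
apply/funext => N; rewrite /series /= mulr_sumr.
by apply: eq_bigr => n _; rewrite l2Z cvdotZl mulrC ReMr mulrC.
Qed.

Lemma dotDr x y z : dot z (x + y) = dot z x + dot z y.
Proof. by rewrite !(dotC z) dotDl. Qed.

Lemma dotZr r x z : dot z (r%:C *: x) = r * dot z x.
Proof. by rewrite !(dotC z) dotZl. Qed.

Lemma dot_sqrD x y : dot (x + y) (x + y) = dot x x + 2 * dot x y + dot y y.
Proof. by rewrite dotDl !dotDr (dotC y x); ring. Qed.

Lemma dotNl x z : dot (- x) z = - dot x z.
Proof.
by rewrite -scaleN1r (_ : -1 = (-1)%:C) ?dotZl ?mulN1r// rmorphN rmorph1.
Qed.

Lemma dotNr x z : dot z (- x) = - dot z x.
Proof. by rewrite !(dotC z) dotNl. Qed.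

Lemma dotBl x y z : dot (x - y) z = dot x z - dot y z.
Proof. by rewrite dotDl dotNl. Qed.

Lemma dotBr x y z : dot z (x - y) = dot z x - dot z y.
Proof. by rewrite dotDr dotNr. Qed.

Lemma dot0l z : dot 0 z = 0.
Proof. by rewrite -(subrr z) dotBl subrr. Qed.

Lemma dotii x y : dot ('i *: x) ('i *: y) = dot x y.
Proof.
rewrite /dot; congr (limn (series _)); apply/funext => n.
rewrite !l2Z cvdotZl cvdotZr mulrA (_ : 'i * ('i^*)%R = 1) ?mul1r//.
by apply: eqC; rewrite ?ReM ?ImM /=; ring.
Qed.

Lemma dot_sqr_cvg x : series (fun n => cvnorm (x n) ^+ 2) @ \oo --> dot x x.
Proof. by have := dot_cvg x x; under eq_fun do rewrite Re_cvdot_sqr. Qed.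

Arguments dot_sqr_cvg : clear implicits.

Lemma dot_sqr_partial x N : \sum_(0 <= n < N) cvnorm (x n) ^+ 2 <= dot x x.
Proof.
rewrite -(cvg_lim _ (dot_sqr_cvg x))//; apply: (@nondecreasing_cvgn_le _ (series _)); last exact: l2P.
by apply/nondecreasing_seqP => n; rewrite /series /= big_nat_recr//= lerDl sqr_ge0.
Qed.

Lemma dot_sqr_le x (B : R) : (forall N, \sum_(0 <= n < N) cvnorm (x n) ^+ 2 <= B) -> dot x x <= B.
Proof.
move=> h; rewrite -(cvg_lim _ (dot_sqr_cvg x))//; apply: limr_le; first exact: l2P.
by near=> N; exact: h.
Unshelve. all: by end_near.
Qed.

Lemma dot_ge0 x : 0 <= dot x x.
Proof. by have := dot_sqr_partial x 0; rewrite big_nil. Qed.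

Lemma cvnorm_eq0 (v : vec) : cvnorm v = 0 -> v = 0.
Proof.
move=> h; apply/matrixP => i j; rewrite ord1 mxE; apply: cabs_eq0.
by apply/le_anti; rewrite cabs_ge0 andbT -h cabs_le_cvnorm.
Qed.

Definition nrm x : R := Num.sqrt (dot x x).

Lemma nrm_ge0 x : 0 <= nrm x. Proof. exact: sqrtr_ge0. Qed.

Lemma nrm_sqr x : nrm x ^+ 2 = dot x x.
Proof. by rewrite sqr_sqrtr// dot_ge0. Qed.

Lemma nrm_le x y : dot x x <= dot y y -> nrm x <= nrm y.
Proof. by move=> h; rewrite ler_wsqrtr. Qed.

Lemma cvnorm_le_nrm x n : cvnorm (x n) <= nrm x.
Proof.
rewrite -(@ler_pXn2r _ 2) ?nnegrE ?cvnorm_ge0 ?nrm_ge0// nrm_sqr.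
apply: le_trans (dot_sqr_partial x n.+1); rewrite big_nat_recr//= lerDr.
by apply: sumr_ge0 => i _; exact: sqr_ge0.
Qed.

Lemma nrm_eq0 x : nrm x = 0 -> x = 0.
Proof.
move=> h; apply: l2_ext => n; apply: cvnorm_eq0; apply/le_anti.
by rewrite cvnorm_ge0 andbT -h cvnorm_le_nrm.
Qed.

Lemma dot_sqr_eq0 x : dot x x = 0 -> x = 0.
Proof. by move=> h; apply: nrm_eq0; rewrite /nrm h sqrtr0. Qed.

Lemma nrm0 : nrm 0 = 0.
Proof. by rewrite /nrm dot0l sqrtr0. Qed.

Lemma cauchy_schwarz x y : `|dot x y| <= nrm x * nrm y.
Proof.
rewrite -(@ler_pXn2r _ 2) ?nnegrE ?mulr_ge0 ?nrm_ge0// exprMn !nrm_sqr -normrX ger0_norm ?sqr_ge0//.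
have [y0|y0] := eqVneq (dot y y) 0.
  by rewrite (dot_sqr_eq0 y0) dotC !dot0l expr0n mulr0.
have yy : 0 < dot y y by rewrite lt_neqAle eq_sym y0 dot_ge0.
have := dot_ge0 ((dot y y)%:C *: x - (dot x y)%:C *: y).
rewrite !dotBl !dotBr !dotZl !dotZr (dotC y x).
set a := dot x x; set b := dot y y in yy y0 *; set c := dot x y => h.
have : 0 <= b * (a * b - c ^+ 2) by move: h; congr (0 <= _); ring.
by rewrite pmulr_rge0// subr_ge0.
Qed.

Lemma nrmD x y : nrm (x + y) <= nrm x + nrm y.
Proof.
rewrite -(@ler_pXn2r _ 2) ?nnegrE ?addr_ge0 ?nrm_ge0// nrm_sqr.
rewrite dot_sqrD sqrrD !nrm_sqr mulr2n.
have := cauchy_schwarz x y; rewrite ler_norml => /andP[_ h].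
by move: h; set u := nrm x * nrm y; lra.
Qed.

Lemma nrmZ c x : nrm (c *: x) = cabs c * nrm x.
Proof.
apply: (@pexpIrn _ 2) => //; rewrite ?nnegrE ?mulr_ge0 ?nrm_ge0 ?cabs_ge0//.
rewrite exprMn !nrm_sqr; apply/esym; apply: cvg_unique (dot_sqr_cvg (c *: x)).
  exact: norm_hausdorff.
rewrite (_ : series _ = fun N => cabs c ^+ 2 * series (fun n => cvnorm (x n) ^+ 2) N).
  by apply: cvgM; [exact: cvg_cst|exact: dot_sqr_cvg].
apply/funext => N; rewrite /series /= mulr_sumr; apply: eq_bigr => n _.
by rewrite l2Z cvnorm_sqrZ.
Qed.

Lemma nrmN x : nrm (- x) = nrm x.
Proof. by rewrite -scaleN1r nrmZ cabsN cabs1 mul1r. Qed.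

Lemma nrmB x y : nrm (x - y) <= nrm x + nrm y.
Proof. by rewrite -[nrm y]nrmN nrmD. Qed.

Lemma nrm_distC x y : nrm (x - y) = nrm (y - x).
Proof. by rewrite -nrmN opprB. Qed.

Lemma nrm_sum (I : Type) (s : seq I) (F : I -> l2) :
  nrm (\sum_(i <- s) F i) <= \sum_(i <- s) nrm (F i).
Proof.
elim: s => [|i s IH]; first by rewrite !big_nil nrm0.
by rewrite !big_cons (le_trans (nrmD _ _))// lerD2l.
Qed.

(** ** Completeness *)

Lemma realcauchy_cvg (f : nat -> R) : (forall e, 0 < e -> exists N, forall m n, (N <= m)%N -> (N <= n)%N ->
  `|f m - f n| <= e) -> cvgn f.
Proof.
move=> h; apply/cauchy_cvgP/cauchy_exP => e e0.
have e2 : 0 < e / 2 by rewrite divr_gt0.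
have [N hN] := h _ e2; exists (f N); exists N => // n /= Nn.
rewrite /ball /=; apply: le_lt_trans (hN _ _ (leqnn N) Nn) _.
by rewrite ltr_pdivrMr// ltr_pMr// ltr1n.
Qed.

Lemma cvnorm_cvg0 (T : Type) (F : set_system T) {FF : Filter F} (v : T -> vec) :
  (forall i, cabs (v t i 0) @[t --> F] --> (0 : R)) -> cvnorm (v t) @[t --> F] --> (0 : R).
Proof.
move=> h; have h2 : cvnorm (v t) ^+ 2 @[t --> F] --> (0 : R).
  have : \sum_(i < p) cabs (v t i 0) ^+ 2 @[t --> F] --> \sum_(i < p) (0 : R) ^+ 2.
    by apply: cvg_sumr => i; rewrite !expr2; under eq_fun do rewrite expr2; apply: cvgM.
  rewrite big1 => [|i _]; last by rewrite expr0n.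
  by under eq_fun do rewrite -cvnorm_sqr.
have h3 : Num.sqrt (cvnorm (v t) ^+ 2) @[t --> F] --> Num.sqrt (0 : R).
  by apply: (cvg_comp _ _ h2); exact: sqrt_continuous.
move: h3; rewrite sqrtr0; under eq_fun do rewrite sqrtr_sqr ger0_norm ?cvnorm_ge0//.
by [].
Qed.

(** A Cauchy sequence converges to its coordinatewise limit: the bound on finite
    partial sums passes to the limit. *)
Lemma l2_complete (u : nat -> l2) :
  (forall e, 0 < e -> exists N, forall m n, (N <= m)%N -> (N <= n)%N -> nrm (u m - u n) <= e) ->
  exists x, forall e, 0 < e -> exists N, forall n, (N <= n)%N -> nrm (u n - x) <= e.
Proof.
move=> hu.
have cz n i : exists z : R[i], (cabs (u m n i 0 - z) @[m --> \oo] --> (0 : R)).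
  have hd m k : cabs (u m n i 0 - u k n i 0) <= nrm (u m - u k).
    apply: le_trans (cvnorm_le_nrm (u m - u k) n); apply: le_trans (cabs_le_cvnorm _ i).
    by rewrite l2B !mxE.
  have cr : cvgn (fun m => Re (u m n i 0)).
    apply: realcauchy_cvg => e e0; have [N hN] := hu e e0; exists N => m k Nm Nk.
    apply: le_trans (hN _ _ Nm Nk); apply: le_trans (hd _ _).
    by rewrite -ReB Re_le_cabs.
  have ci : cvgn (fun m => Im (u m n i 0)).
    apply: realcauchy_cvg => e e0; have [N hN] := hu e e0; exists N => m k Nm Nk.
    apply: le_trans (hN _ _ Nm Nk); apply: le_trans (hd _ _).
    by rewrite -ImB Im_le_cabs.
  exists (limn (fun m => Re (u m n i 0)) +i* limn (fun m => Im (u m n i 0))).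
  by apply/cvgC_cabs/cvgC_ReIm; split.
have [g hg] := boolp.choice (fun ni : nat * 'I_p => cz ni.1 ni.2).
pose a n : vec := \col_i g (n, i).
have fatou N m e : 0 <= e -> (forall k, (N <= k)%N -> nrm (u m - u k) <= e) ->
    forall K, \sum_(0 <= n < K) cvnorm (u m n - a n) ^+ 2 <= e ^+ 2.
  move=> e0 h K.
  have c1 : \sum_(0 <= n < K) cvnorm (u m n - u k n) ^+ 2 @[k --> \oo] -->
      \sum_(0 <= n < K) cvnorm (u m n - a n) ^+ 2.
    apply: cvg_sumr => n; under eq_fun do rewrite cvnorm_sqr; rewrite cvnorm_sqr.
    apply: cvg_sumr => i; apply: cvg_cabs_sqr; rewrite !mxE.
    under eq_fun do rewrite !mxE.
    by apply: cvgB; [exact: cvg_cst|apply/cvgC_cabs; exact: (hg (n, i))].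
  rewrite -(cvg_lim _ c1)//; apply: limr_le; first by apply/cvg_ex; eexists; exact: c1.
  near=> k; apply: le_trans (dot_sqr_partial (u m - u k) K) _.
  rewrite -nrm_sqr ler_pXn2r ?nnegrE ?nrm_ge0//; apply: h.
  by near: k; exact: nbhs_infty_ge.
have [N1 hN1] := hu 1 ltr01.
have sq : square_summable (fun n => u N1 n - a n).
  by apply: (@square_summable_bounded _ (1 ^+ 2)) => K; apply: (fatou N1) => // k Nk; exact: hN1.
exists (u N1 - mkl2 sq) => e e0; have [N hN] := hu e e0; exists N => n Nn.
rewrite -(@ler_pXn2r _ 2) ?nnegrE ?nrm_ge0 ?(ltW e0)// nrm_sqr; apply: dot_sqr_le => K.
have -> : \sum_(0 <= k < K) cvnorm ((u n - (u N1 - mkl2 sq)) k) ^+ 2 =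
    \sum_(0 <= k < K) cvnorm (u n k - a k) ^+ 2.
  apply: eq_bigr => k _; rewrite !l2B; congr (cvnorm _ ^+ 2).
  rewrite (_ : l2val (mkl2 sq) k = u N1 k - a k)//; congr (_ - _).
  by rewrite opprB addrCA subrr addr0.
by apply: (fatou N) => [|k Nk]; [exact: ltW|exact: hN].
Unshelve. all: by end_near.
Qed.

(** ** Orthogonal projections *)

(** The minimal distance is attained: by the parallelogram identity minimizing
    sequences are Cauchy. *)
Lemma projection_exists (K : set l2) x : K 0 ->
  (forall y z r, K y -> K z -> K (y + r%:C *: z)) ->
  (forall (u : nat -> l2) y, (forall n, K (u n)) ->
     (forall e, 0 < e -> exists N, forall n, (N <= n)%N -> nrm (u n - y) <= e) -> K y) ->
  exists2 y, K y & forall h, K h -> dot (x - y) h = 0.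
Proof.
move=> K0 Klin Kcl; pose E : set R := [set dot (x - y) (x - y) | y in K].
have hE : has_inf E.
  split; first by exists (dot (x - 0) (x - 0)), 0.
  by exists 0 => _ [y _ <-]; exact: dot_ge0.
pose d := inf E.
have dE y : K y -> d <= dot (x - y) (x - y).
  by move=> Ky; apply: ge_inf; [case: hE|exists y].
have seqex (n : nat) : exists y, K y /\ dot (x - y) (x - y) <= d + n.+1%:R^-1.
  have n0 : 0 < n.+1%:R^-1 :> R by rewrite invr_gt0 ltr0Sn.
  have [_ [y Ky <-] hy] := inf_adherent n0 hE.
  by exists y; split=> //; exact: ltW.
have [u hu] := boolp.choice seqex.
(* The midpoint stays in [K], which the parallelogram identity below exploits. *)
have half y z : K y -> K z -> K ((1 / 2)%:C *: (y + z)).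
  move=> Ky Kz; have Kyz : K (y + z).
    by rewrite -[z]scale1r (_ : 1 = 1%:C)//; exact: Klin.
  by rewrite -[X in K X]add0r; exact: Klin.
have para m n : dot (u m - u n) (u m - u n) <= 2 * (m.+1%:R^-1 + n.+1%:R^-1).
  have [Km hm] := hu m; have [Kn hn] := hu n.
  have := dE _ (half _ _ Km Kn).
  set s := dot (x - u m) _ in hm; set t := dot (x - u n) _ in hn.
  set w := dot (x - _ *: _) _.
  have -> : dot (u m - u n) (u m - u n) = 2 * s + 2 * t - 4 * w.
    rewrite /s /t /w !dotBl !dotBr !dotZl !dotZr !dotDl !dotDr.
    rewrite !(dotC (u m) x) !(dotC (u n) x) !(dotC (u n) (u m)).
    by field.
  by move: (m.+1%:R^-1) (n.+1%:R^-1) hm hn => i j hm hn; clear -hm hn; lra.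
have [y hy] : exists y, forall e, 0 < e -> exists N, forall n, (N <= n)%N -> nrm (u n - y) <= e.
  apply: l2_complete => e e0.
  have [N hN] : exists N : nat, 4 / e ^+ 2 < N%:R.
    by exists (Num.bound (4 / e ^+ 2)); apply: archi_boundP; rewrite divr_ge0 ?exprn_ge0// ltW.
  exists N => m n Nm Nn; rewrite -(@ler_pXn2r _ 2) ?nnegrE ?nrm_ge0 ?(ltW e0)// nrm_sqr.
  apply: le_trans (para m n) _.
  have N0 : 0 < N%:R :> R by apply: le_lt_trans hN; rewrite divr_ge0 ?exprn_ge0// ltW.
  have inv k : (N <= k)%N -> k.+1%:R^-1 <= N%:R^-1 :> R.
    by move=> Nk; rewrite lef_pV2 ?posrE ?ltr0Sn// ler_nat leqW.
  have h4 : 4 * N%:R^-1 <= e ^+ 2.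
    by rewrite ler_pdivrMr// mulrC -ler_pdivrMr ?exprn_gt0// ltW.
  move: (m.+1%:R^-1) (n.+1%:R^-1) (N%:R^-1) (inv m Nm) (inv n Nn) h4 => i j k.
  by clear; lra.
have Ky : K y by apply: Kcl hy => n; case: (hu n).
exists y => // h Kh.
have dy : dot (x - y) (x - y) <= d.
  apply/ler_addgt0Pr => e e0.
  pose c := nrm (x - y) + 1; have c0 : 0 < c by rewrite ltr_wpDl ?nrm_ge0.
  pose C := 2 * c + 1; have C0 : 0 < C by rewrite addr_gt0// mulr_gt0.
  pose t := Num.min 1 (e / (2 * C)).
  have t0 : 0 < t by rewrite lt_min ltr01 divr_gt0// mulr_gt0.
  have t1 : t <= 1 by rewrite ge_min lexx.
  have tC : C * t <= e / 2.
    rewrite mulrC -ler_pdivlMr//.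
    by apply: le_trans (_ : t <= e / (2 * C)) _; rewrite ?ge_min ?lexx ?orbT// invfM mulrA.
  have {}tC : 2 * (c * t) + t <= e / 2.
    by rewrite (_ : 2 * (c * t) + t = C * t)// /C; ring.
  have [N hN] := hy t t0.
  have [M hM] : exists M : nat, 2 / e < M%:R.
    by exists (Num.bound (2 / e)); apply: archi_boundP; rewrite divr_ge0// ltW.
  pose n := maxn N M; have hn := hN n (leq_maxl _ _).
  have hi : n.+1%:R^-1 <= e / 2.
    rewrite -[e / 2]invrK invf_div lef_pV2 ?posrE ?ltr0Sn ?divr_gt0//.
    by apply: le_trans (ltW hM) _; rewrite ler_nat leqW// leq_maxr.
  have [_ hd] := hu n.
  have -> : x - y = (x - u n) + (u n - y) by rewrite addrA subrK.
  rewrite dot_sqrD.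
  have h1 := cauchy_schwarz (x - u n) (u n - y).
  have h2 : nrm (x - u n) <= c.
    rewrite (_ : x - u n = (x - y) + (y - u n)); last by rewrite addrA subrK.
    by apply: le_trans (nrmD _ _) _; rewrite lerD2l nrm_distC (le_trans hn).
  have h3 : nrm (x - u n) * nrm (u n - y) <= c * t by rewrite ler_pM ?nrm_ge0.
  have h4 : dot (u n - y) (u n - y) <= t.
    rewrite -nrm_sqr expr2 -[leRHS]mulr1; apply: ler_pM; rewrite ?nrm_ge0//.
    exact: le_trans hn t1.
  move: h1 h3 h4 tC hd hi; rewrite ler_norml => /andP[_ h1].
  move: h1; set a1 := dot _ (u n - y).
  set a2 := _ * nrm _; set a3 := c * t; set a4 := dot (x - u n) _; set a5 := dot _ _.
  by move: (n.+1%:R^-1) => a6; clear; lra.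
(* Minimality along the line through [y] in the direction [h]: a nonnegative quadratic
   polynomial in [r] that vanishes at [0] has no linear term. *)
have var r : 0 <= r ^+ 2 * dot h h - 2 * r * dot (x - y) h.
  have := le_trans dy (dE _ (Klin _ _ r Ky Kh)).
  have -> : x - (y + r%:C *: h) = (x - y) + (- r)%:C *: h.
    by rewrite opprD addrA rmorphN scaleNr.
  rewrite [X in _ <= X]dot_sqrD !dotZr dotZl -addrA lerDl.
  by congr (0 <= _); ring.
have [h0|h0] := eqVneq (dot h h) 0; first by rewrite (dot_sqr_eq0 h0) dotC dot0l.
have hh : 0 < dot h h by rewrite lt_neqAle eq_sym h0 dot_ge0.
have := var (dot (x - y) h / dot h h).
set s := dot (x - y) h; set q := dot h h in h0 hh * => v.
have : s ^+ 2 <= 0.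
  have e : (s / q) ^+ 2 * q - 2 * (s / q) * s = - (s ^+ 2 / q) by field.
  by move: v; rewrite e oppr_ge0 ler_pdivrMr// mul0r.
by move=> s0; apply/eqP; rewrite -sqrf_eq0; apply/eqP/le_anti; rewrite s0 sqr_ge0.
Qed.

End l2_type.

Arguments l2val : simpl never.
Arguments dot_cvg {R p} x y.
Arguments dot_sqr_cvg {R p} x.

(* Keeps unification from unfolding [dot] to a limit. *)
#[global] Opaque dot.

(** * Shifts and multiplication by an inner function *)

Section shifts.
Variables (R : realType) (p : nat).
Local Notation vec := 'cV[R[i]]_p.
Local Notation l2 := (l2 R p).
Implicit Types (x y z : l2) (c : R[i]) (r : R) (v w : vec).

Definition shift_seq (a : nat -> vec) (n : nat) : vec := if n is m.+1 then a m else 0.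

Lemma cvnorm0 : cvnorm (0 : vec) = 0.
Proof.
apply: (@pexpIrn _ 2) => //; rewrite ?nnegrE ?cvnorm_ge0// expr0n cvnorm_sqr.
by rewrite big1// => i _; rewrite mxE cabs0 expr0n.
Qed.

Lemma shift_summable x : square_summable (shift_seq x).
Proof.
apply: (@square_summable_bounded _ _ _ (dot x x)) => -[|N]; first by rewrite big_nil dot_ge0.
by rewrite big_nat_recl//= cvnorm0 expr0n add0r dot_sqr_partial.
Qed.

Lemma bshift_summable x : square_summable (fun n => x n.+1).
Proof.
apply: (@square_summable_bounded _ _ _ (dot x x)) => N.
apply: le_trans (dot_sqr_partial x N.+1); rewrite big_nat_recl//= lerDr.
exact: sqr_ge0.
Qed.

(** Multiplication by the variable on coefficients, and its adjoint. *)
Definition Sh x : l2 := mkl2 (@shift_summable x).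
Definition Bk x : l2 := mkl2 (@bshift_summable x).

Lemma ShS x n : Sh x n.+1 = x n. Proof. by []. Qed.
Lemma Sh0 x : Sh x 0%N = 0. Proof. by []. Qed.
Lemma BkE x n : Bk x n = x n.+1. Proof. by []. Qed.

Lemma iter_BkE m x n : iter m Bk x n = x (n + m)%N.
Proof. by elim: m n => [|m IH] n; rewrite ?addn0// iterS BkE IH addSnnS. Qed.

Lemma iter_ShE m x n : iter m Sh x n = if (n < m)%N then 0 else x (n - m)%N.
Proof.
elim: m n => [|m IH] [|n]; rewrite ?subn0//.
by rewrite iterS ShS IH ltnS subSS.
Qed.

Lemma Bk_Sh x : Bk (Sh x) = x. Proof. exact: l2_ext. Qed.

Lemma ShD x y : Sh (x + y) = Sh x + Sh y.
Proof. by apply: l2_ext => -[|n]; rewrite l2D ?addr0. Qed.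

Lemma ShZ c x : Sh (c *: x) = c *: Sh x.
Proof. by apply: l2_ext => -[|n]; rewrite l2Z ?scaler0. Qed.

Lemma BkD x y : Bk (x + y) = Bk x + Bk y. Proof. exact: l2_ext. Qed.
Lemma BkZ c x : Bk (c *: x) = c *: Bk x. Proof. exact: l2_ext. Qed.

Lemma ShB x y : Sh (x - y) = Sh x - Sh y.
Proof. by rewrite -scaleN1r ShD ShZ scaleN1r. Qed.

Lemma dot_recl x y : dot x y = Re (cvdot (x 0%N) (y 0%N)) + dot (Bk x) (Bk y).
Proof.
apply: dot_lim; rewrite -(cvg_shiftS (series _)).
rewrite (_ : (fun n => _) = fun n => Re (cvdot (x 0%N) (y 0%N)) +
   series (fun n => Re (cvdot (Bk x n) (Bk y n))) n).
  by apply: cvgD; [exact: cvg_cst|exact: dot_cvg].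
by apply/funext => n; rewrite /series /= big_nat_recl.
Qed.

Lemma dot_ShBk x y : dot (Sh x) y = dot x (Bk y).
Proof.
rewrite dot_recl Bk_Sh Sh0 /cvdot big1 ?add0r// => i _.
by rewrite mxE mul0r.
Qed.

Lemma dot_ShSh x y : dot (Sh x) (Sh y) = dot x y.
Proof. by rewrite dot_ShBk Bk_Sh. Qed.

Lemma nrm_Sh x : nrm (Sh x) = nrm x. Proof. by rewrite /nrm dot_ShSh. Qed.

Lemma nrm_Bk x : nrm (Bk x) <= nrm x.
Proof. by apply: nrm_le; rewrite (dot_recl x) Re_cvdot_sqr lerDr sqr_ge0. Qed.

Lemma nrm_iter_Sh m x : nrm (iter m Sh x) = nrm x.
Proof. by elim: m => //= m IH; rewrite nrm_Sh. Qed.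

Lemma nrm_iter_Bk m x : nrm (iter m Bk x) <= nrm x.
Proof. by elim: m => //= m IH; exact: le_trans (nrm_Bk _) IH. Qed.

Lemma dot_iter_Bk m x : dot (iter m Bk x) (iter m Bk x) =
  dot x x - \sum_(0 <= n < m) cvnorm (x n) ^+ 2.
Proof.
elim: m => [|m IH]; first by rewrite big_nil subr0.
rewrite big_nat_recr//= opprD addrA -IH (dot_recl (iter m Bk x)) Re_cvdot_sqr.
by rewrite iter_BkE add0n; ring.
Qed.

(** The powers of the backward shift tend to zero strongly: tails of a
    convergent series. *)
Lemma iter_Bk_cvg0 x e : 0 < e -> exists N, forall m, (N <= m)%N -> nrm (iter m Bk x) <= e.
Proof.
move=> e0; have e2 : 0 < e ^+ 2 by rewrite exprn_gt0.
have /cvgrPdist_le /(_ _ e2) [N _ hN] := dot_sqr_cvg x.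
exists N => m Nm; rewrite -(@ler_pXn2r _ 2) ?nnegrE ?nrm_ge0 ?(ltW e0)// nrm_sqr dot_iter_Bk.
exact: le_trans (ler_norm _) (hN m Nm).
Qed.

(** ** Finitely supported sequences *)

Definition single_seq (n : nat) v (k : nat) : vec := if k == n then v else 0.

Lemma finite_summable (a : nat -> vec) N : (forall n, (N <= n)%N -> a n = 0) -> square_summable a.
Proof.
move=> ha; apply: (@square_summable_bounded _ _ _ (\sum_(0 <= n < N) cvnorm (a n) ^+ 2)) => M.
have [MN|NM] := leqP M N.
  by rewrite [leRHS](big_cat_nat (n := M))//= lerDl sumr_ge0// => i _; exact: sqr_ge0.
rewrite (big_cat_nat (n := N))//=; last exact: ltnW.
rewrite [X in _ + X]big_nat [X in _ + X]big1 ?addr0// => n /andP[Nn _].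
by rewrite ha// cvnorm0 expr0n.
Qed.

Lemma single_summable n v : square_summable (single_seq n v).
Proof.
apply: (@finite_summable _ n.+1) => k nk; rewrite /single_seq gtn_eqF//.
Qed.

Definition single n v : l2 := mkl2 (@single_summable n v).

Lemma singleE n v k : single n v k = if k == n then v else 0. Proof. by []. Qed.

Lemma Sh_single n v : Sh (single n v) = single n.+1 v.
Proof. by apply: l2_ext => -[|k]. Qed.

Lemma iter_Sh_single m n v : iter m Sh (single n v) = single (n + m) v.
Proof. by elim: m => [|m IH]; rewrite ?addn0// iterS IH Sh_single addnS. Qed.

Lemma dot_single x n v : dot x (single n v) = Re (cvdot (x n) v).
Proof.
elim: n x => [|n IH] x.
  have b0 : Bk (single 0 v) = 0 by apply: l2_ext.
  by rewrite dot_recl b0 (dotC _ 0) dot0l addr0.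
have bS : Bk (single n.+1 v) = single n v by apply: l2_ext.
rewrite dot_recl singleE /= bS IH BkE /cvdot big1 ?add0r// => i _.
by rewrite mxE conjC0 mulr0.
Qed.

Lemma nrm_single n v : nrm (single n v) = cvnorm v.
Proof.
apply: (@pexpIrn _ 2) => //; rewrite ?nnegrE ?nrm_ge0 ?cvnorm_ge0//.
by rewrite nrm_sqr dot_single singleE eqxx Re_cvdot_sqr.
Qed.

Definition trunc N x : l2 := \sum_(0 <= n < N) single n (x n).

Lemma truncE N x : trunc N x = x - iter N Sh (iter N Bk x).
Proof.
apply: l2_ext => k; rewrite l2B iter_ShE /trunc l2_sum.
under eq_bigr do rewrite singleE.
case: ltnP => kN.
  rewrite (bigD1_seq k) ?mem_index_iota ?iota_uniq//= eqxx big1 ?addr0 ?subr0// => n nk.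
  by rewrite eq_sym (negbTE nk).
rewrite iter_BkE subnK// subrr big_nat big1// => n /andP[_ nN].
by rewrite gtn_eqF// (leq_trans nN).
Qed.

Lemma nrm_trunc N x : nrm (trunc N x) <= \sum_(0 <= n < N) cvnorm (x n).
Proof.
apply: le_trans (nrm_sum _ _) _; apply: ler_sum => n _; by rewrite nrm_single.
Qed.

(** ** Multiplication by an inner function, on coefficients *)

Variables (Theta : R[i] -> 'M[R[i]]_p) (Theta_inner : inner_multiplier Theta).
Variables (A : nat -> 'M[R[i]]_p) (A_psums : mx_psums A Theta).

(** The first [N] coefficients of the product only see those of [x], so the
    isometry on polynomials applies to the truncation of [x]. *)
Lemma conv_partial x N :
  \sum_(0 <= n < N) cvnorm (conv A x n) ^+ 2 <= dot x x.
Proof.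
pose b n := if (n < N)%N then x n else 0.
have hb n : (N <= n)%N -> b n = 0 by rewrite /b ltnNge => ->.
have h := inner_poly_isometry Theta_inner A_psums hb.
have -> : \sum_(0 <= n < N) cvnorm (conv A x n) ^+ 2 = \sum_(0 <= n < N) cvnorm (conv A b n) ^+ 2.
  apply: eq_big_nat => n /andP[_ nN]; congr (cvnorm _ ^+ 2).
  by apply: eq_bigr => j _; rewrite /b (leq_ltn_trans (leq_subr _ _) nN).
apply: le_trans (dot_sqr_partial x N).
have -> : \sum_(0 <= n < N) cvnorm (x n) ^+ 2 = \sum_(0 <= n < N) cvnorm (b n) ^+ 2.
  by apply: eq_big_nat => n /andP[_ nN]; rewrite /b nN.
rewrite -(cvg_lim _ h)//; apply: (@nondecreasing_cvgn_le _ (series _)).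
  by apply/nondecreasing_seqP => n; rewrite /series /= [leRHS]big_nat_recr//= lerDl sqr_ge0.
by apply/cvg_ex; eexists; exact: h.
Qed.

Lemma conv_summable x : square_summable (conv A x).
Proof. exact: (square_summable_bounded (@conv_partial x)). Qed.

Definition Mul x : l2 := mkl2 (@conv_summable x).

Lemma dot_Mul_le x : dot (Mul x) (Mul x) <= dot x x.
Proof. by apply: dot_sqr_le => N; exact: conv_partial. Qed.

Lemma nrm_Mul x : nrm (Mul x) <= nrm x.
Proof. exact: nrm_le (dot_Mul_le x). Qed.

Lemma MulZ c x : Mul (c *: x) = c *: Mul x.
Proof.
apply: l2_ext => n; rewrite l2Z /= /conv scaler_sumr; apply: eq_bigr => j _.
by rewrite -scalemxAr.
Qed.

Lemma Mul_Sh x : Mul (Sh x) = Sh (Mul x).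
Proof.
apply: l2_ext => -[|n].
  rewrite Sh0 -[LHS]/(conv A (Sh x) 0) /conv big_ord_recl big_ord0 addr0 subn0.
  by rewrite Sh0 mulmx0.
rewrite ShS -[LHS]/(conv A (Sh x) n.+1) -[RHS]/(conv A x n) /conv big_ord_recr /=.
rewrite subnn [X in _ + X]mulmx0 addr0; apply: eq_bigr => j _.
by rewrite subSn// -ltnS.
Qed.

(** ** The model space *)

(** The orthogonal complement of the range of [Mul]; it is a complex subspace since
    that range is one. *)
Definition Q2 : set l2 := [set x | forall y, dot x (Mul y) = 0].

Lemma Q2_lin c x y : Q2 x -> Q2 y -> Q2 (c *: x + y).
Proof.
move=> hx hy z; rewrite dotDl hy addr0.
have -> : c *: x = (complex.Re c)%:C *: x + (complex.Im c)%:C *: ('i *: x).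
  by rewrite [in LHS](complexE c) scalerDl scalerA mulrC.
rewrite dotDl !dotZl hx mulr0 add0r -dotii scalerA.
rewrite (_ : 'i * 'i = -1); last by rewrite -expr2 sqr_i.
by rewrite scaleN1r dotNl -MulZ hx oppr0 mulr0.
Qed.

Lemma Q2_0 : Q2 0. Proof. by move=> y; rewrite dot0l. Qed.

Lemma Q2_D x y : Q2 x -> Q2 y -> Q2 (x + y).
Proof. by move=> hx hy; rewrite -[x]scale1r; exact: Q2_lin. Qed.

Lemma Q2_Z c x : Q2 x -> Q2 (c *: x).
Proof. by move=> hx; rewrite -[_ *: _]addr0; apply: Q2_lin => //; exact: Q2_0. Qed.

Lemma Q2_B x y : Q2 x -> Q2 y -> Q2 (x - y).
Proof. by move=> hx hy; rewrite -scaleN1r; apply: Q2_D => //; exact: Q2_Z. Qed.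

Lemma Q2_Bk x : Q2 x -> Q2 (Bk x).
Proof. by move=> hx y; rewrite dotC -dot_ShBk -Mul_Sh dotC. Qed.

Lemma Q2_iter_Bk m x : Q2 x -> Q2 (iter m Bk x).
Proof. by move=> hx; elim: m => //= m IH; exact: Q2_Bk. Qed.

Lemma Q2_closed (u : nat -> l2) x : (forall n, Q2 (u n)) ->
  (forall e, 0 < e -> exists N, forall n, (N <= n)%N -> nrm (u n - x) <= e) -> Q2 x.
Proof.
move=> hu hx y; apply/eqP; rewrite -normr_eq0; apply/eqP/le_anti; rewrite normr_ge0 andbT.
apply/ler_addgt0Pr => e e0; rewrite add0r.
have c0 : 0 < nrm y + 1 by rewrite ltr_wpDl ?nrm_ge0.
have [N hN] := hx _ (divr_gt0 e0 c0).
have -> : dot x (Mul y) = - dot (u N - x) (Mul y) by rewrite dotBl hu sub0r opprK.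
rewrite normrN; apply: le_trans (cauchy_schwarz _ _) _.
apply: (@le_trans _ _ (e / (nrm y + 1) * nrm y)).
  by apply: ler_pM (nrm_ge0 _) (nrm_ge0 _) (hN N (leqnn N)) (nrm_Mul y).
by rewrite mulrAC ler_pdivrMr// ler_wpM2l ?(ltW e0)// lerDl.
Qed.

Lemma proj_ex x : exists y, Q2 y /\ forall h, Q2 h -> dot (x - y) h = 0.
Proof.
have [y z r hy hz|u y hu hy|y hy h] := @projection_exists _ _ Q2 x Q2_0.
- by apply: Q2_D => //; exact: Q2_Z.
- exact: Q2_closed hu hy.
- by exists y.
Qed.

(** An opaque choice of the projection: [P2] is only used through [P2_in] and
    [P2_orth]. *)
Lemma P2_sig : {P | forall x, Q2 (P x) /\ forall h, Q2 h -> dot (x - P x) h = 0}.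
Proof. by apply: cid; have [P hP] := boolp.choice proj_ex; exists P. Qed.

Definition P2 : l2 -> l2 := projT1 P2_sig.

Lemma P2_in x : Q2 (P2 x). Proof. by case: (projT2 P2_sig x). Qed.

Lemma P2_orth x h : Q2 h -> dot (x - P2 x) h = 0.
Proof. by case: (projT2 P2_sig x) => _ /(_ h). Qed.

Lemma P2_uniq x y : Q2 y -> (forall h, Q2 h -> dot (x - y) h = 0) -> P2 x = y.
Proof.
move=> hy ho; apply/eqP; rewrite -subr_eq0; apply/eqP/dot_sqr_eq0.
have hd : Q2 (P2 x - y) by apply: Q2_B => //; exact: P2_in.
have -> : dot (P2 x - y) (P2 x - y) = dot (x - y) (P2 x - y) - dot (x - P2 x) (P2 x - y).
  by rewrite !dotBl; ring.
by rewrite ho// P2_orth// subrr.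
Qed.

Lemma P2_id x : Q2 x -> P2 x = x.
Proof. by move=> hx; apply: P2_uniq => // h _; rewrite subrr dot0l. Qed.

Lemma P2D x y : P2 (x + y) = P2 x + P2 y.
Proof.
apply: P2_uniq; first by apply: Q2_D; exact: P2_in.
by move=> h hh; rewrite opprD addrACA dotDl (P2_orth x hh) (P2_orth y hh) addr0.
Qed.

Lemma P2_perp x : (forall h, Q2 h -> dot x h = 0) -> P2 x = 0.
Proof. by move=> h; apply: P2_uniq; [exact: Q2_0|move=> k hk; rewrite subr0 h]. Qed.

Lemma P2B x y : P2 (x - y) = P2 x - P2 y.
Proof.
by apply/eqP; rewrite eq_sym subr_eq -P2D subrK.
Qed.

Lemma nrm_P2 x : nrm (P2 x) <= nrm x.
Proof.
apply: nrm_le; have := dot_sqrD (x - P2 x) (P2 x).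
rewrite subrK (P2_orth x (P2_in x)) mulr0 addr0 => ->.
by rewrite lerDr dot_ge0.
Qed.

Lemma P2_Mul y : P2 (Mul y) = 0.
Proof. by apply: P2_perp => h hh; rewrite dotC hh. Qed.

(** The model operator; its powers are compressions of powers of the shift
    since the shift preserves the orthogonal complement of the model space. *)
Definition Sop x : l2 := P2 (Sh x).

Lemma P2_Sh x : P2 (Sh (P2 x)) = P2 (Sh x).
Proof.
apply/esym/eqP; rewrite -subr_eq0 -P2B -ShB; apply/eqP/P2_perp => h hh.
by rewrite dot_ShBk P2_orth//; exact: Q2_Bk.
Qed.

Lemma iter_Sop m x : Q2 x -> iter m Sop x = P2 (iter m Sh x).
Proof.
by move=> hx; elim: m => [|m IH]; [by rewrite P2_id|rewrite !iterS IH /Sop P2_Sh].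
Qed.

(** [Theta q], with [q] the polynomial whose coefficients are the [A_j^* v], is
    as close to [v z^N] as the first [N] terms of the series of the
    [|A_j^* v|^2] are to its sum [|v|^2]. *)
Lemma P2_single_cvg0 v e : 0 < e -> exists N, forall n, (N <= n)%N -> nrm (P2 (single n v)) <= e.
Proof.
move=> e0; pose t n := cvnorm (adjmx (A n) *m v) ^+ 2.
have ht : series t @ \oo --> cvnorm v ^+ 2.
  pose y := map_mx Num.conj v.
  have cy (m : nat) (u : 'cV[R[i]]_m) : cvnorm (map_mx Num.conj u) ^+ 2 = cvnorm u ^+ 2.
    by rewrite !cvnorm_sqr; apply: eq_bigr => i _; rewrite mxE; congr (_ ^+ 2); exact: cabs_conj.
  have := @inner_tr_isometry _ _ _ Theta_inner _ A_psums y; rewrite cy.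
  rewrite (_ : t = fun n => cvnorm ((A n)^T *m y) ^+ 2)//.
  apply/funext => n; rewrite /t -cy map_mxM; congr (cvnorm (_ *m _) ^+ 2).
  by apply/matrixP => i j; rewrite /adjmx !mxE; exact: (@conjCK R[i]).
have e2 : 0 < e ^+ 2 by rewrite exprn_gt0.
have /cvgrPdist_le /(_ _ e2) [N _ hN] := ht.
exists N => n Nn; pose q k := if (k <= n)%N then adjmx (A (n - k)) *m v else 0.
have hq : square_summable q.
  by apply: (@finite_summable _ n.+1) => k nk; rewrite /q leqNgt nk.
pose x := mkl2 hq.
have sx : dot x x = \sum_(0 <= k < n.+1) t k.
  rewrite (_ : dot x x = \sum_(0 <= k < n.+1) cvnorm (x k) ^+ 2); last first.
    have := dot_iter_Bk n.+1 x.
    rewrite (_ : iter n.+1 Bk x = 0); last first.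
      by apply: l2_ext => k; rewrite iter_BkE -[LHS]/(q (k + n.+1)%N) /q leqNgt addnS ltnS leq_addl.
    by rewrite dot0l => /esym/eqP; rewrite subr_eq0 => /eqP.
  rewrite big_nat_rev /=; apply: eq_big_nat => k /andP[_ kn]; rewrite add0n subSS.
  by rewrite -[l2val x _]/(q (n - k)%N) /q leq_subr subKn.
have dx : dot (Mul x) (single n v) = dot x x.
  rewrite dot_single sx -[l2val (Mul x) n]/(conv A q n) /conv.
  rewrite big_mkord; have -> : cvdot (\sum_(j < n.+1) A j *m q (n - j)%N) v =
      \sum_(j < n.+1) cvdot (A j *m q (n - j)%N) v.
    elim/big_rec2: _ => [|j y1 y2 _ <-]; last by rewrite cvdotDl.
    by rewrite /cvdot big1// => i _; rewrite mxE mul0r.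
  rewrite Re_sum; apply: eq_bigr => j _.
  have jn : (j <= n)%N by rewrite -ltnS.
  by rewrite cvdot_adj /q leq_subr (subKn jn) Re_cvdot_sqr.
have -> : P2 (single n v) = P2 (single n v - Mul x).
  by rewrite (P2B (single n v) (Mul x)) P2_Mul subr0.
apply: le_trans (nrm_P2 _) _.
rewrite -(@ler_pXn2r _ 2) ?nnegrE ?nrm_ge0 ?(ltW e0)// nrm_sqr dotBl !dotBr.
rewrite (dotC (single n v) (Mul x)) dx.
have hM := dot_Mul_le x.
rewrite -nrm_sqr nrm_single.
have := hN n.+1 (leqW Nn); rewrite /series /= -sx => /(le_trans (ler_norm _)).
by move: hM; lra.
Qed.

(** The tail of [x] is small in norm, and the head is a finite combination of
    single coefficients. *)
Lemma P2_Sh_cvg0 x e : 0 < e -> exists N, forall m, (N <= m)%N -> nrm (P2 (iter m Sh x)) <= e.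
Proof.
move=> e0; have e2 : 0 < e / 2 by rewrite divr_gt0.
have [K hK] := iter_Bk_cvg0 x e2.
have iD m y z : iter m Sh (y + z) = iter m Sh y + iter m Sh z.
  by elim: m => //= m ->; rewrite ShD.
have step M : forall d, 0 < d ->
    exists N, forall m, (N <= m)%N -> nrm (P2 (iter m Sh (trunc M x))) <= d.
  elim: M => [|M IH] d d0.
    exists 0%N => m _; rewrite /trunc big_nil (_ : iter m Sh 0 = 0).
      by rewrite (P2_id Q2_0) nrm0 ltW.
    by elim: m => //= m ->; apply: l2_ext => -[].
  have d2 : 0 < d / 2 by rewrite divr_gt0.
  have [N hN] := IH _ d2; have [N' hN'] := P2_single_cvg0 (x M) d2.
  exists (maxn N N') => m; rewrite geq_max => /andP[Nm N'm].
  have -> : trunc M.+1 x = trunc M x + single M (x M) by rewrite /trunc big_nat_recr.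
  rewrite iD P2D iter_Sh_single; apply: le_trans (nrmD _ _) _.
  rewrite [leRHS](_ : d = d / 2 + d / 2); last by field.
  by apply: lerD; [exact: hN|apply: hN'; rewrite (leq_trans N'm)// leq_addl].
have [N hN] := step K _ e2; exists N => m Nm.
have -> : x = trunc K x + iter K Sh (iter K Bk x) by rewrite truncE subrK.
rewrite iD P2D; apply: le_trans (nrmD _ _) _.
rewrite [leRHS](_ : e = e / 2 + e / 2); last by field.
apply: lerD; first exact: hN.
by apply: le_trans (nrm_P2 _) _; rewrite !nrm_iter_Sh hK.
Qed.

End shifts.

Arguments Sh {R p} x.
Arguments Bk {R p} x.

(** * Compactness on the model space *)

Section ultrafilter_limits.
Variables (R : realType) (F : set_system nat).
Hypothesis (F_ultra : UltraFilter F).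

Let F_proper : ProperFilter F := ultra_proper.
#[local] Existing Instance F_proper.

(** A cluster point in the segment is a limit, because an ultrafilter contains each
    neighborhood's preimage or its complement. *)
Lemma ultra_bounded_cvg (f : nat -> R) (B : R) : (forall n, `|f n| <= B) ->
  exists l : R, f n @[n --> F] --> l.
Proof.
move=> hf.
have [|l [_ hl]] := @segment_compact R (- B) B (f @ F) _.
  by apply: (@filterE _ F) => n /=; rewrite in_itv /= -ler_norml.
exists l; apply/cvgrPdist_lt => e e0; pose A := [set n | `|l - f n| < e].
have [//|FA] := in_ultra_setVsetC A F_ultra.
have fA : (f @ F) [set y | ~ `|l - y| < e] by exact: FA.
have le : nbhs l (ball l e) by exact: nbhsx_ballx.
by have [y [hy1 hy2]] := hl _ _ fA le; case: hy1.
Qed.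

Lemma ultra_vec_cvg p (v : nat -> 'cV[R[i]]_p) (B : R) : (forall n, cvnorm (v n) <= B) ->
  exists c, cvnorm (v n - c) @[n --> F] --> (0 : R).
Proof.
move=> hv.
have hi i : exists z : R[i], cabs (v n i 0 - z) @[n --> F] --> (0 : R).
  have hb n : cabs (v n i 0) <= B by exact: le_trans (cabs_le_cvnorm _ _) (hv n).
  have [a ha] := @ultra_bounded_cvg (fun n => Re (v n i 0)) B
    (fun n => le_trans (Re_le_cabs _) (hb n)).
  have [b hb'] := @ultra_bounded_cvg (fun n => Im (v n i 0)) B
    (fun n => le_trans (Im_le_cabs _) (hb n)).
  by exists (a +i* b); apply/cvgC_cabs/cvgC_ReIm; split.
have [g hg] := boolp.choice hi.
exists (\col_i g i); apply: cvnorm_cvg0 => i; under eq_fun do rewrite !mxE.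
exact: hg.
Qed.

End ultrafilter_limits.

(** Intersections [I N] of index sets on which [y] oscillates by at most
    [1 / (j + 1)] belong to [F], hence are nonempty; a choice of points in them
    is Cauchy and has a limit [g], and [y] is within [2 / (j + 1)] of [g] on the
    [j]-th set. That set contains arbitrarily large indices. *)
Lemma filter_cauchy_subseq (R : realType) p (F : set_system nat) {FF : ProperFilter F}
    (y : nat -> l2 R p) : \oo `<=` F ->
  (forall e, 0 < e -> exists S, F S /\ forall n k, S n -> S k -> nrm (y n - y k) <= e) ->
  exists2 k : nat -> nat, {homo k : m n / (m < n)%N} &
  exists g, nrm (y (k n) - g) @[n --> \oo] --> (0 : R).
Proof.
move=> F_oo cauchy.
have i0 (n : nat) : 0 < n.+1%:R^-1 :> R by rewrite invr_gt0 ltr0Sn.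
have small (e : R) : 0 < e -> exists N : nat, forall n, (N <= n)%N -> n.+1%:R^-1 <= e.
  move=> e0; exists (Num.bound e^-1) => n Nn; rewrite -[e]invrK lef_pV2 ?posrE ?ltr0Sn ?invr_gt0//.
  apply: le_trans (ltW (archi_boundP _)) _; first by rewrite invr_ge0 ltW.
  by rewrite ler_nat leqW.
have [S hS] := boolp.choice (fun j : nat => cauchy _ (i0 j)).
pose I N := [set n | forall j, (j <= N)%N -> S j n].
have FI N : F (I N).
  elim: N => [|N IH].
    by apply: filterS (hS 0%N).1 => n Sn j; rewrite leqn0 => /eqP ->.
  apply: filterS (filterI IH (hS N.+1).1) => n [In Sn] j.
  by rewrite leq_eqVlt => /orP[/eqP -> //|]; exact: In.
have [a ha] := boolp.choice (fun N => filter_ex (FI N)).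
have [g hg] : exists g, forall e, 0 < e -> exists N, forall n, (N <= n)%N -> nrm (y (a n) - g) <= e.
  apply: l2_complete => e e0; have [N hN] := small e e0; exists N => m n Nm Nn.
  apply: le_trans (hN N (leqnn N)); apply: (hS N).2; exact: ha.
have far j n : S j n -> nrm (y n - g) <= 2 * j.+1%:R^-1.
  move=> Sn; have [N hN] := hg _ (i0 j).
  have hm := hN _ (leq_maxl N j); have am := ha (maxn N j) j (leq_maxr N j).
  have -> : y n - g = (y n - y (a (maxn N j))) + (y (a (maxn N j)) - g) by rewrite addrA subrK.
  apply: le_trans (nrmD _ _) _; rewrite mulrDl mul1r.
  exact: lerD ((hS j).2 _ _ Sn am) hm.
have pick (jN : nat * nat) : exists n, (jN.2 <= n)%N /\ S jN.1 n.
  have FN : F [set n | (jN.2 <= n)%N] by apply: F_oo; exact: nbhs_infty_ge.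
  by have [n [h1 h2]] := filter_ex (filterI FN (hS jN.1).1); exists n.
have [h hh] := boolp.choice pick.
pose k := fix k j := if j is i.+1 then h (i.+1, (k i).+1) else h (0, 0)%N.
have Sk j : S j (k j) by case: j => [|j]; exact: (hh (_, _)).2.
exists k.
  by apply: homo_ltn => [? ? ?|j]; [exact: ltn_trans|exact: (hh (j.+1, (k j).+1)).1].
exists g; apply/cvgrPdist_le => e e0.
have [N hN] := small _ (divr_gt0 e0 (ltr0Sn R 1)); exists N => // j /= Nj.
rewrite sub0r normrN ger0_norm ?nrm_ge0//; apply: le_trans (far _ _ (Sk j)) _.
by rewrite mulrC -ler_pdivlMr// hN.
Qed.

Lemma cvnormB (R : realType) p (v w : 'cV[R[i]]_p) : cvnorm (v - w) <= cvnorm v + cvnorm w.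
Proof.
rewrite -!(nrm_single 0) (_ : single 0 (v - w) = single 0 v - single 0 w) ?nrmB//.
by apply: l2_ext => n; rewrite l2B !singleE; case: eqP; rewrite ?subr0.
Qed.

Section compactness.
Variables (R : realType) (p : nat).
Local Notation l2 := (l2 R p).
Variables (Theta : R[i] -> 'M[R[i]]_p) (Theta_inner : inner_multiplier Theta).
Variables (A : nat -> 'M[R[i]]_p) (A_psums : mx_psums A Theta).
Local Notation Q2 := (Q2 Theta_inner A_psums).
Local Notation P2 := (P2 Theta_inner A_psums).
Local Notation Sop := (Sop Theta_inner A_psums).
Variable (T : l2 -> l2).
Hypothesis T_in : forall x, Q2 x -> Q2 (T x).
Implicit Types (x y v w g : l2).

Definition compact2 : Prop := forall u : nat -> l2, (forall n, Q2 (u n)) ->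
  (exists M, forall n, nrm (u n) <= M) ->
  exists2 k : nat -> nat, {homo k : m n / (m < n)%N} &
  exists2 g, Q2 g & nrm (T (u (k n)) - g) @[n --> \oo] --> (0 : R).

Definition compression m x : l2 := iter m Bk (T (iter m Sop x)).

Lemma Q2_iter_Sop m x : Q2 x -> Q2 (iter m Sop x).
Proof. by move=> hx; case: m => // m; rewrite iterS; exact: P2_in. Qed.

Lemma nrm_iter_Sop m x : Q2 x -> nrm (iter m Sop x) <= nrm x.
Proof.
by move=> hx; rewrite iter_Sop// (le_trans (nrm_P2 _ _ _))// nrm_iter_Sh.
Qed.

Lemma iter_BkD m x y : iter m Bk (x + y) = iter m Bk x + iter m Bk y.
Proof. by elim: m => //= m ->; rewrite BkD. Qed.

Lemma homo_ltn_ge (k : nat -> nat) n : {homo k : m n / (m < n)%N} -> (n <= k n)%N.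
Proof.
by move=> hk; elim: n => // n IH; apply: leq_ltn_trans IH (hk n n.+1 (ltnSn n)).
Qed.

(** If some [f_m] in the unit ball keep [S*^m T S^m f_m] away from [0], then
    [T S^m f_m -> g] along a subsequence, and [S*^m g -> 0] is a contradiction. *)
Lemma compact2_compression e : compact2 -> 0 < e ->
  exists N, forall m x, (N <= m)%N -> Q2 x -> nrm x <= 1 -> nrm (compression m x) <= e.
Proof.
move=> cT e0; apply: contrapT => hN.
have hex N : exists mx : nat * l2, [/\ (N <= mx.1)%N, Q2 mx.2, nrm mx.2 <= 1 &
    e < nrm (compression mx.1 mx.2)].
  apply: contrapT => h; apply: hN; exists N => m x Nm Qx x1; rewrite leNgt; apply/negP => ex.
  by apply: h; exists (m, x); split.
have [f hf] := boolp.choice hex; pose u n := iter (f n).1 Sop (f n).2.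
have [|| k hk [g Qg hg]] := cT u.
- by move=> n; have [_ Qf _ _] := hf n; exact: Q2_iter_Sop.
- exists 1 => n; have [_ Qf f1 _] := hf n.
  exact: le_trans (nrm_iter_Sop _ Qf) f1.
have e2 : 0 < e / 2 by rewrite divr_gt0.
have [N1 hN1] := iter_Bk_cvg0 g e2.
have /cvgrPdist_le /(_ _ e2) [N2 _ hN2] := hg.
pose n := maxn N1 N2; have [nm Qf _ ] := hf (k n).
have N1n : (N1 <= (f (k n)).1)%N.
  by apply: leq_trans nm; apply: leq_trans (leq_maxl N1 N2) (homo_ltn_ge n hk).
rewrite ltNge => /negP; apply.
rewrite /compression -/(u (k n)) -[T _](subrK g) iter_BkD.
apply: le_trans (nrmD _ _) _; rewrite [leRHS](_ : e = e / 2 + e / 2); last by field.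
apply: lerD; last exact: hN1.
apply: le_trans (nrm_iter_Bk _ _) _.
have := hN2 n (leq_maxr N1 N2); rewrite /= sub0r normrN; exact: le_trans (ler_norm _).
Qed.

Hypothesis T_lin : forall c x y, Q2 x -> Q2 y -> T (c *: x + y) = c *: T x + T y.

Lemma T_D x y : Q2 x -> Q2 y -> T (x + y) = T x + T y.
Proof. by move=> hx hy; have := T_lin 1 hx hy; rewrite !scale1r. Qed.

Lemma T_0 : T 0 = 0.
Proof.
have h := T_lin (- 1) (Q2_0 Theta_inner A_psums) (Q2_0 Theta_inner A_psums).
by rewrite !scaleN1r !addNr in h.
Qed.

Lemma T_Z c x : Q2 x -> T (c *: x) = c *: T x.
Proof.
by move=> hx; have := T_lin c hx (Q2_0 Theta_inner A_psums); rewrite T_0 !addr0.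
Qed.

Lemma T_B x y : Q2 x -> Q2 y -> T (x - y) = T x - T y.
Proof.
move=> hx hy; rewrite T_D//; last by rewrite -scaleN1r; exact: Q2_Z.
by congr (_ + _); rewrite -scaleN1r T_Z// scaleN1r.
Qed.

Variable M : R.
Hypotheses (M_ge0 : 0 <= M) (T_bnd : forall x, Q2 x -> nrm (T x) <= M * nrm x).

Lemma compressionZ m r x : Q2 x -> compression m (r%:C *: x) = r%:C *: compression m x.
Proof.
move=> hx; rewrite /compression.
have -> : iter m Sop (r%:C *: x) = r%:C *: iter m Sop x.
  elim: m => //= m ->; rewrite /Sop ShZ; apply: P2_uniq; first by apply: Q2_Z; exact: P2_in.
  by move=> h hh; rewrite -scalerBr dotZl P2_orth// mulr0.
rewrite T_Z; last exact: Q2_iter_Sop.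
by elim: m (T _) => //= m IH y; rewrite IH BkZ.
Qed.

(** The powers [S^m] tend to zero strongly, so the compressions [S*^m T S^m] can only
    converge to [0]. *)
Lemma compression_cvg0 x e : Q2 x -> 0 < e ->
  exists N, forall m, (N <= m)%N -> nrm (compression m x) <= e.
Proof.
move=> hx e0; have c0 : 0 < M + 1 by rewrite ltr_wpDl.
have [N hN] := P2_Sh_cvg0 Theta_inner A_psums x (divr_gt0 e0 c0).
exists N => m Nm; apply: le_trans (nrm_iter_Bk _ _) _.
apply: le_trans (T_bnd (Q2_iter_Sop m hx)) _; rewrite iter_Sop//.
apply: (@le_trans _ _ (M * (e / (M + 1)))); first by rewrite ler_wpM2l// hN.
by rewrite mulrCA ler_piMr ?(ltW e0)// ler_pdivrMr// mul1r lerDl.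
Qed.

(** With [s = S^m S*^m v] and [t = E v] one has [T v = T s + T t]. The norm of [T t]
    is at most [M] times that of [trunc m v]. Splitting [T s] once more, its
    first part is [S^m (S*^m T S^m) S*^m v] and its second part [E (T s)] is
    controlled by [trunc m (T v - T t)]. *)
Lemma compression_estimate m d v : Q2 v -> 0 <= d ->
  (forall x, Q2 x -> nrm (compression m x) <= d * nrm x) ->
  nrm (T v) <= d * nrm v + nrm (trunc m (T v)) + 3 * M * nrm (trunc m v).
Proof.
move=> hv d0 hd; pose w := iter m Bk v; have hw : Q2 w by exact: Q2_iter_Bk.
have dec x : Q2 x -> x = P2 (iter m Sh (iter m Bk x)) + P2 (trunc m x).
  by move=> hx; rewrite -P2D truncE addrC subrK P2_id.
pose s := P2 (iter m Sh w); pose t := P2 (trunc m v).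
have hs : Q2 s by exact: P2_in. have ht : Q2 t by exact: P2_in.
have nt : nrm (T t) <= M * nrm (trunc m v).
  by apply: le_trans (T_bnd ht) _; rewrite ler_wpM2l// nrm_P2.
have Tv : T v = T s + T t by rewrite -T_D// -dec.
have Ts : iter m Bk (T s) = compression m w by rewrite /compression iter_Sop.
rewrite Tv; apply: le_trans (nrmD _ _) _.
have n1 : nrm (T s) <= d * nrm v + nrm (trunc m (T s)).
  rewrite {1}(dec _ (T_in hs)); apply: le_trans (nrmD _ _) _; apply: lerD; last exact: nrm_P2.
  apply: le_trans (nrm_P2 _ _ _) _; rewrite nrm_iter_Sh Ts.
  by apply: le_trans (hd _ hw) _; rewrite ler_wpM2l// nrm_iter_Bk.
have n2 : nrm (trunc m (T s)) <= nrm (trunc m (T v)) + 2 * nrm (T t).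
  have -> : trunc m (T s) = trunc m (T v) - trunc m (T t).
    rewrite Tv /trunc -sumrB; apply: eq_bigr => n _; apply: l2_ext => k.
    by rewrite l2B !singleE l2D; case: eqP => _; rewrite ?subr0 ?addrK.
  apply: le_trans (nrmB _ _) _; rewrite lerD2l truncE.
  apply: le_trans (nrmB _ _) _; rewrite nrm_iter_Sh mulrDl !mul1r lerD2l.
  exact: nrm_iter_Bk.
by rewrite -Tv; move: n1 n2 nt; move: (nrm (trunc m v)) (d * nrm v) => a b; clear; lra.
Qed.

(** The limit [L] vanishes on the unit ball, so some compression has norm at most
    [d]; then [compression_estimate] bounds the oscillation of [T u] by that of
    finitely many coefficients, which converge along an ultrafilter. *)
Lemma compression_compact2 (L : l2 -> l2) :
  (forall e, 0 < e -> exists N, forall m x, (N <= m)%N -> Q2 x -> nrm x <= 1 ->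
     nrm (compression m x - L x) <= e) ->
  compact2.
Proof.
move=> hL.
have L0 x : Q2 x -> nrm x <= 1 -> L x = 0.
  move=> hx x1; apply: nrm_eq0; apply/le_anti; rewrite nrm_ge0 andbT.
  apply/ler_addgt0Pr => e e0; rewrite add0r; have e2 : 0 < e / 2 by rewrite divr_gt0.
  have [N1 h1] := hL _ e2; have [N2 h2] := compression_cvg0 hx e2.
  have {}h1 := h1 _ _ (leq_maxl N1 N2) hx x1; have {}h2 := h2 _ (leq_maxr N1 N2).
  move: h1 h2; set y := compression _ _ => h1 h2.
  have -> : L x = y - (y - L x) by rewrite opprB addrC subrK.
  apply: le_trans (nrmB _ _) _; rewrite [leRHS](_ : e = e / 2 + e / 2); last by field.
  exact: lerD.
have small e : 0 < e -> exists m, forall x, Q2 x -> nrm (compression m x) <= e * nrm x.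
  move=> e0; have [m hm] := hL _ e0; exists m => x hx.
  have [x0|x0] := eqVneq (nrm x) 0.
    have -> : x = (0 : R)%:C *: x by rewrite (nrm_eq0 x0) scaler0.
    by rewrite compressionZ// !nrmZ cabs0 !mul0r mulr0.
  have xp : 0 < nrm x by rewrite lt_neqAle eq_sym x0 nrm_ge0.
  have Qx : Q2 ((nrm x)^-1%:C *: x) by exact: Q2_Z.
  have x1 : nrm ((nrm x)^-1%:C *: x) <= 1.
    by rewrite nrmZ cabs_real ger0_norm ?invr_ge0 ?nrm_ge0// mulVf.
  have := hm m _ (leqnn m) Qx x1; rewrite L0// subr0 compressionZ// nrmZ cabs_real.
  by rewrite ger0_norm ?invr_ge0 ?nrm_ge0// mulrC ler_pdivrMr.
move=> u hu [B hB].
have B0 : 0 <= B by exact: le_trans (nrm_ge0 _) (hB 0%N).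
(* Coefficients converge along any ultrafilter finer than the neighborhoods of infinity. *)
have [F [F_ultra F_oo]] := @ultraFilterLemma nat \oo _.
pose F_proper : ProperFilter F := ultra_proper.
have trunc_small (v : nat -> l2) b m e : (forall n, nrm (v n) <= b) -> 0 < e ->
    exists2 S, F S & forall n k, S n -> S k -> nrm (trunc m (v n - v k)) <= e.
  move=> hb e0; have e2 : 0 < e / 2 by rewrite divr_gt0.
  have hc j : exists c, cvnorm (v n j - c) @[n --> F] --> (0 : R).
    by apply: (@ultra_vec_cvg _ _ F_ultra _ _ b) => n; exact: le_trans (cvnorm_le_nrm _ _) (hb n).
  have [c hc'] := boolp.choice hc.
  have : \sum_(0 <= j < m) cvnorm (v n j - c j) @[n --> F] --> \sum_(0 <= j < m) (0 : R).
    by apply: cvg_sumr => j; exact: hc'.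
  rewrite big1// => /cvgrPdist_le /(_ _ e2) hS.
  exists [set n | `|0 - \sum_(0 <= j < m) cvnorm (v n j - c j)| <= e / 2] => // n k /=.
  rewrite !sub0r !normrN => hn hk; apply: le_trans (nrm_trunc _ _) _.
  rewrite [leRHS](_ : e = e / 2 + e / 2); last by field.
  apply: le_trans (lerD (le_trans (ler_norm _) hn) (le_trans (ler_norm _) hk)).
  rewrite -big_split; apply: ler_sum => j _ /=.
  have := cvnormB (v n j - c j) (v k j - c j).
  rewrite (_ : v n j - c j - (v k j - c j) = v n j - v k j); first by [].
  by rewrite opprB addrA subrK.
have TB n : nrm (T (u n)) <= M * B.
  by apply: le_trans (T_bnd (hu n)) _; rewrite ler_wpM2l.
have cauchy e : 0 < e -> exists S, F S /\ forall n k, S n -> S k -> nrm (T (u n) - T (u k)) <= e.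
  move=> e0; pose d := e / (6 * (B + 1)).
  have B1 : 0 < B + 1 by rewrite ltr_wpDl.
  have M1 : 0 < M + 1 by rewrite ltr_wpDl.
  have d0 : 0 < d by rewrite divr_gt0// mulr_gt0.
  have [m hm] := small d d0.
  have e3 : 0 < e / 3 by rewrite divr_gt0.
  have e9 : 0 < e / (9 * (M + 1)) by rewrite divr_gt0// mulr_gt0.
  have [S1 F1 h1] := trunc_small (T \o u) (M * B) m _ TB e3.
  have [S2 F2 h2] := trunc_small u B m _ hB e9.
  exists (S1 `&` S2); split; first exact: filterI.
  move=> n k [n1 n2] [k1 k2]; rewrite -T_B//.
  have Qv : Q2 (u n - u k) by exact: Q2_B.
  apply: le_trans (compression_estimate Qv (ltW d0) hm) _.
  have a1 : d * nrm (u n - u k) <= e / 3.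
    apply: (@le_trans _ _ (d * (2 * (B + 1)))).
      rewrite ler_wpM2l ?(ltW d0)//; apply: le_trans (nrmB _ _) _.
      by have := hB n; have := hB k; lra.
    by rewrite /d le_eqVlt; apply/orP; left; apply/eqP; field; rewrite gt_eqF.
  have a2 : nrm (trunc m (T (u n - u k))) <= e / 3 by rewrite T_B//; exact: h1.
  have a3 : 3 * M * nrm (trunc m (u n - u k)) <= e / 3.
    apply: (@le_trans _ _ (3 * (M + 1) * (e / (9 * (M + 1))))).
      apply: ler_pM; rewrite ?nrm_ge0 ?mulr_ge0//; last exact: h2.
      by rewrite ler_wpM2l// lerDl.
    by rewrite le_eqVlt; apply/orP; left; apply/eqP; field; rewrite gt_eqF.
  rewrite [leRHS](_ : e = e / 3 + e / 3 + e / 3); last by field.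
  by apply: lerD => //; apply: lerD.
have [k hk [g hg]] := filter_cauchy_subseq F_oo cauchy.
exists k => //; exists g => //.
apply: (@Q2_closed _ _ _ Theta_inner _ A_psums (T \o u \o k)) => [n|e e0]; first exact: T_in.
have /cvgrPdist_le /(_ _ e0) [N _ hN] := hg; exists N => n Nn.
by have := hN n Nn; rewrite /= sub0r normrN; exact: le_trans (ler_norm _).
Qed.

End compactness.

(** * Power series and the Hardy space *)

Section embedding.
Variables (R : realType) (p : nat).
Local Notation vec := 'cV[R[i]]_p.
Local Notation l2 := (l2 R p).
Implicit Types (x y : l2) (f g : discfun R p) (a b : nat -> vec).

Lemma bounded_psums_cvg (d : nat -> R[i]) (B : R) (w : R[i]) :
  (forall n, cabs (d n) <= B) -> cabs w < 1 ->
  exists z : R[i], series (fun n => d n * w ^+ n : R[i]^o) @ \oo --> (z : R[i]^o).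
Proof.
move=> hd w1.
have geo : cvgn (series (fun n => B * cabs w ^+ n)).
  have := @is_cvg_geometric_series R B (cabs w); rewrite ger0_norm ?cabs_ge0//; exact.
have term n : cabs (d n * w ^+ n) <= B * cabs w ^+ n.
  by rewrite cabsM cabsX ler_wpM2r// exprn_ge0// cabs_ge0.
have B0 : 0 <= B by exact: le_trans (cabs_ge0 _) (hd 0%N).
have cv (h : R[i] -> R) : (forall z, `|h z| <= cabs z) ->
    cvgn (series (fun n => h (d n * w ^+ n))).
  move=> hh; apply: normed_cvg; apply: (series_le_cvg _ _ _ geo) => n //=.
    by rewrite mulr_ge0// exprn_ge0// cabs_ge0.
  exact: le_trans (hh _) (term n).
have c1 := cv _ (@Re_le_cabs R); have c2 := cv _ (@Im_le_cabs R).
exists (limn (series (fun n => Re (d n * w ^+ n))) +i* limn (series (fun n => Im (d n * w ^+ n)))).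
apply/cvgC_ReIm; split => /=.
  by rewrite /series /=; under eq_fun do rewrite Re_sum; exact: c1.
by rewrite /series /=; under eq_fun do rewrite Im_sum; exact: c2.
Qed.

(** Defined for every complex argument, so that the results on [psums] apply. *)
Definition psum_of x (w : R[i]) : vec := \col_i
  xget 0 [set z : R[i] | series (fun n => x n i 0 * w ^+ n : R[i]^o) @ \oo --> (z : R[i]^o)].

Lemma psum_ofP x i : psums (fun n => x n i 0) (fun w => psum_of x w i 0).
Proof.
move=> w w1; rewrite mxE.
have hb n : cabs (x n i 0) <= nrm x.
  exact: le_trans (cabs_le_cvnorm _ _) (cvnorm_le_nrm _ _).
by have [z hz] := bounded_psums_cvg hb w1; exact: (@xgetPex _ 0 [set z : R[i] | _] (ex_intro _ z hz)).
Qed.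

Definition emb x : discfun R p := fun w => psum_of x (sval w).

Lemma cabs_disc (w : disc R) : cabs (sval w) < 1.
Proof. by case: w => w /=; rewrite normC_cabs ltcR. Qed.

Lemma emb_series x : power_series_of x (emb x).
Proof. by move=> w i; apply: psum_ofP; exact: cabs_disc. Qed.

Lemma power_series_inj a f g : power_series_of a f -> power_series_of a g -> f = g.
Proof.
move=> hf hg; apply/funext => w; apply/matrixP => i j; rewrite ord1.
by apply: (cvg_unique _ (hf w i) (hg w i)); exact: norm_hausdorff.
Qed.

(** The coefficients of a power series are determined by its sum, by
    Parseval's formula for the difference on a circle. *)
Lemma power_series_coef_inj a b f : power_series_of a f -> power_series_of b f -> a = b.
Proof.
move=> ha hb; apply/funext => n; apply/matrixP => i j; rewrite ord1.
pose d n := a n i 0 - b n i 0.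
have hd : psums d (fun=> 0).
  move=> w w1; have w1' : `|w| < 1 by rewrite normC_cabs ltcR.
  have h1 := ha (exist _ w w1') i; have h2 := hb (exist _ w w1') i.
  rewrite -(subrr (f (exist _ w w1') i 0)).
  rewrite (_ : series _ = fun N => series (fun n => a n i 0 * w ^+ n : R[i]^o) N -
      series (fun n => b n i 0 * w ^+ n : R[i]^o) N); first exact: cvgB h1 h2.
  apply/funext => N; rewrite /series /= -sumrB.
  by apply: eq_bigr => k _; rewrite /d mulrBl.
have r1 : 0 <= (2^-1 : R) < 1 by rewrite invr_ge0 ler0n invf_lt1// ltr1n.
have c0 : ccontinuous (fun _ : R => 0 : R[i]) by split => t; exact: cst_continuous.
have h := parseval hd r1 c0.
have {}h : series (fun n => cabs (d n) ^+ 2 * (2^-1 : R) ^+ (n * 2)) @ \oo --> (0 : R).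
  move: h; rewrite /mean; under [X in sint _ _ X]eq_fun do rewrite cabs0 expr0n /=.
  by rewrite sint_cst ?(ltW (pi2_gt0 R))// subr0 ?mulr0 ?mul0r ?mulr0.
have t0 k : 0 <= cabs (d k) ^+ 2 * (2^-1 : R) ^+ (k * 2).
  by rewrite mulr_ge0 ?sqr_ge0// exprn_ge0// invr_ge0.
have : series (fun n => cabs (d n) ^+ 2 * (2^-1 : R) ^+ (n * 2)) n.+1 <= 0.
  rewrite -(cvg_lim _ h)//; apply: (@nondecreasing_cvgn_le _ (series _)).
    by apply/nondecreasing_seqP => k; rewrite /series /= [leRHS]big_nat_recr//= lerDl.
  by apply/cvg_ex; eexists; exact: h.
rewrite /series /= big_nat_recr//= => le0.
have : cabs (d n) ^+ 2 * (2^-1 : R) ^+ (n * 2) <= 0.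
  by apply: le_trans le0; rewrite lerDr sumr_ge0.
rewrite pmulr_lle0 ?exprn_gt0 ?invr_gt0// => dn.
apply/eqP; rewrite -subr_eq0; apply/eqP/cabs_eq0/eqP; rewrite -sqrf_eq0.
by apply/eqP/le_anti; rewrite dn sqr_ge0.
Qed.

Lemma coefs_eq a f : power_series_of a f -> coefs f = a.
Proof.
by move=> h; apply: xget_unique => // b hb; exact: power_series_coef_inj hb h.
Qed.

Lemma coefs_emb x : coefs (emb x) = x.
Proof. exact: coefs_eq (@emb_series x). Qed.

Lemma emb_inj x y : emb x = emb y -> x = y.
Proof. by move=> h; apply: l2_ext => n; rewrite -(coefs_emb x) h coefs_emb. Qed.

Lemma hardy2_emb x : hardy2 (emb x).
Proof. by exists x; [exact: l2P|exact: emb_series]. Qed.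

Lemma hardy2P f : hardy2 f -> exists x, f = emb x.
Proof.
move=> [a ha hf]; exists (mkl2 ha); apply: power_series_inj hf _.
exact: (@emb_series (mkl2 ha)).
Qed.

Lemma emb_lin (c : R[i]) x y : emb (c *: x + y) = c *: emb x + emb y.
Proof.
apply: (power_series_inj (@emb_series _) _) => w i.
have h1 := @emb_series x w i; have h2 := @emb_series y w i.
rewrite (_ : (c *: emb x + emb y) w i 0 = c * emb x w i 0 + emb y w i 0); last first.
  by rewrite /GRing.add /= /GRing.scale /= !mxE.
rewrite (_ : series _ = fun N => c * series (fun n => x n i 0 * sval w ^+ n : R[i]^o) N +
    series (fun n => y n i 0 * sval w ^+ n : R[i]^o) N).
  by apply: cvgD h2; apply: cvgM h1; exact: cvg_cst.
apply/funext => N; rewrite /series /= mulr_sumr -big_split /=.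
by apply: eq_bigr => k _; rewrite l2D l2Z !mxE mulrDl mulrA.
Qed.

Lemma emb0 : emb 0 = 0.
Proof. by rewrite -(addNr (0 : l2)) -scaleN1r emb_lin scaleN1r addNr. Qed.

Lemma embB x y : emb (x - y) = emb x - emb y.
Proof. by rewrite addrC -scaleN1r emb_lin scaleN1r addrC. Qed.

Lemma hdot_emb x y : hdot (emb x) (emb y) = dot x y +i* dot x ('i *: y).
Proof.
rewrite /hdot !coefs_emb; apply: (@cvg_lim R[i]^o); first exact: norm_hausdorff.
apply/cvgC_ReIm; split => /=.
  by have := dot_cvg x y; rewrite /series /=; under [in X in _ -> X]eq_fun do rewrite Re_sum.
have := dot_cvg x ('i *: y); rewrite /series /=.
under [in X in _ -> X]eq_fun do rewrite Im_sum.
rewrite (_ : (fun n => \sum_(0 <= k < n) Im (cvdot (x k) (y k))) =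
  (fun n => \sum_(0 <= k < n) Re (cvdot (x k) (('i *: y) k))))//.
by apply/funext => n; apply: eq_bigr => k _; rewrite Im_cvdot l2Z.
Qed.

Lemma hnorm_emb x : hnorm (emb x) = nrm x.
Proof. by rewrite /hnorm hdot_emb. Qed.

Lemma mulz_emb x : mulz (emb x) = emb (Sh x).
Proof.
apply/esym; apply: (power_series_inj (@emb_series _) _) => w i.
rewrite -(cvg_shiftS (series _)) /mulz mxE.
rewrite (_ : (fun n => _) = fun N => sval w * series (fun n => x n i 0 * sval w ^+ n : R[i]^o) N).
  by apply: cvgM (@emb_series x w i); exact: cvg_cst.
apply/funext => N; rewrite /series /= big_nat_recl// [Sh x 0%N]Sh0 mxE mul0r add0r mulr_sumr.
by apply: eq_bigr => k _; rewrite ShS exprS mulrCA.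
Qed.

End embedding.

Arguments emb {R p} x.

(** * The model operator on coefficients *)

Section model.
Variables (R : realType) (p : nat).
Local Notation l2 := (l2 R p).
Variables (Theta : R[i] -> 'M[R[i]]_p) (Theta_inner : inner_multiplier Theta).
Variables (A : nat -> 'M[R[i]]_p) (A_psums : mx_psums A Theta).
Local Notation Q2 := (Q2 Theta_inner A_psums).
Local Notation P2 := (P2 Theta_inner A_psums).
Local Notation Mul := (Mul Theta_inner A_psums).
Local Notation Sop := (Sop Theta_inner A_psums).
Local Notation Q := (model_space Theta).
Implicit Types (x y z : l2) (f g h : discfun R p).

Lemma mul_by_emb x : mul_by Theta (emb x) = emb (Mul x).
Proof.
apply/esym; apply: (power_series_inj (@emb_series _ _ _) _) => w i.
exact: (@conv_psums _ _ A Theta x (psum_of x) A_psums (@psum_ofP _ _ x) i _ (cabs_disc w)).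
Qed.

Lemma hdot_emb_eq0 x y : dot x y = 0 -> dot x ('i *: y) = 0 -> hdot (emb x) (emb y) = 0.
Proof. by move=> h1 h2; rewrite hdot_emb h1 h2. Qed.

Lemma model_space_emb x : Q (emb x) <-> Q2 x.
Proof.
split=> [[_ h] y|h].
  by have := h _ (hardy2_emb y); rewrite mul_by_emb hdot_emb => -[].
split; first exact: hardy2_emb.
move=> _ /hardy2P[y ->]; rewrite mul_by_emb; apply: hdot_emb_eq0; first exact: h.
by rewrite -MulZ; exact: h.
Qed.

Lemma model_spaceP f : Q f -> exists2 x, Q2 x & f = emb x.
Proof.
by move=> hf; have [x fx] := hardy2P hf.1; exists x => //; apply/model_space_emb; rewrite -fx.
Qed.

(** Orthogonality for the Hermitian product is orthogonality for [dot] to [y] and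
    to ['i *: y]. *)
Lemma orth_proj_emb x : orth_proj Q (emb x) = emb (P2 x).
Proof.
apply: xget_unique.
  split; first by apply/model_space_emb; exact: P2_in.
  move=> _ /model_spaceP[y Qy ->]; rewrite -embB.
  by apply: hdot_emb_eq0; apply: P2_orth => //; exact: Q2_Z.
move=> _ [/model_spaceP[y Qy ->] ho]; congr emb; apply/esym; apply: P2_uniq => // h Qh.
have := ho (emb h) ((model_space_emb h).2 Qh).
by rewrite -embB hdot_emb => -[].
Qed.

Lemma model_operator_emb x : model_operator Theta (emb x) = emb (Sop x).
Proof. by rewrite /model_operator mulz_emb orth_proj_emb. Qed.

Lemma dot_Sop x y : Q2 y -> dot (Sop x) y = dot x (Bk y).
Proof.
move=> hy; rewrite -dot_ShBk; apply/eqP; rewrite eq_sym -subr_eq0 -dotBl.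
by rewrite P2_orth.
Qed.

(** On [Q2] the projection in [Sop] can be dropped from products, and the adjoint
    of the shift is the backward shift, which preserves [Q2]. *)
Lemma adjoint_emb x : Q2 x -> adjoint Q (model_operator Theta) (emb x) = emb (Bk x).
Proof.
move=> hx; apply: xget_unique.
  split; first by apply/model_space_emb; exact: Q2_Bk.
  move=> _ /model_spaceP[y Qy ->]; rewrite model_operator_emb !hdot_emb.
  by rewrite !dot_Sop ?BkZ//; exact: Q2_Z.
move=> _ [/model_spaceP[z Qz ->] h]; congr emb; apply/eqP; rewrite -subr_eq0; apply/eqP.
have Qd : Q2 (z - Bk x) by apply: Q2_B => //; exact: Q2_Bk.
apply: dot_sqr_eq0; rewrite dotBr.
have := h (emb (z - Bk x)) ((model_space_emb _).2 Qd).
by rewrite model_operator_emb !hdot_emb dot_Sop// => -[-> _]; rewrite subrr.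
Qed.

Lemma iter_model_operator_emb m x :
  iter m (model_operator Theta) (emb x) = emb (iter m Sop x).
Proof. by elim: m => //= m ->; rewrite model_operator_emb. Qed.

Lemma iter_adjoint_emb m x : Q2 x ->
  iter m (adjoint Q (model_operator Theta)) (emb x) = emb (iter m Bk x).
Proof.
by move=> hx; elim: m => //= m ->; rewrite adjoint_emb//; exact: Q2_iter_Bk.
Qed.

(** Off [Q2] the values of the lift are arbitrary. *)
Lemma operator_lift (T : discfun R p -> discfun R p) : (forall f, Q f -> Q (T f)) ->
  exists T2 : l2 -> l2, forall x, Q2 x -> Q2 (T2 x) /\ T (emb x) = emb (T2 x).
Proof.
move=> hT; have hex x : exists y, Q2 x -> Q2 y /\ T (emb x) = emb y.
  have [hx|hx] := pselect (Q2 x); last by exists 0.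
  by have /hT/model_spaceP[y Qy e] := (model_space_emb x).2 hx; exists y.
by have [T2 h] := boolp.choice hex; exists T2.
Qed.

Lemma compact_operator_emb (T : discfun R p -> discfun R p) (T2 : l2 -> l2) :
  (forall x, Q2 x -> Q2 (T2 x) /\ T (emb x) = emb (T2 x)) ->
  compact_operator Q T <-> compact2 Theta_inner A_psums T2.
Proof.
move=> hT; split=> [cT u Qu [B hB]|cT u Qu [B hB]].
  have [n||k hk [g Qg hg]] := cT (emb \o u).
  - exact/model_space_emb.
  - by exists B => n; rewrite /= hnorm_emb.
  exists k => //; have [y Qy gy] := model_spaceP Qg; exists y => //.
  rewrite (_ : (fun n => _) = fun n => hnorm (T (emb (u (k n))) - g)); first exact: hg.
  by apply/funext => n; rewrite (hT _ (Qu _)).2 gy -embB hnorm_emb.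
have [v hv] := boolp.choice (fun n => (fun '(ex_intro2 x a b) =>
  ex_intro (fun x => Q2 x /\ u n = emb x) x (conj a b)) (model_spaceP (Qu n))).
have [n||k hk [g Qg hg]] := cT v.
- by case: (hv n).
- by exists B => n; rewrite -hnorm_emb -(hv n).2.
exists k => //; exists (emb g); first exact/model_space_emb.
rewrite (_ : (fun n => _) = fun n => nrm (T2 (v (k n)) - g)); first exact: hg.
by apply/funext => n; rewrite (hv (k n)).2 (hT _ (hv _).1).2 -embB hnorm_emb.
Qed.

Lemma opnorm_cvg0P (B : nat -> discfun R p -> discfun R p) (B2 : nat -> l2 -> l2) :
  (forall m x, Q2 x -> B m (emb x) = emb (B2 m x)) ->
  opnorm Q (B m) @[m --> \oo] --> 0%E <->
  (forall e, 0 < e -> exists N, forall m x, (N <= m)%N -> Q2 x -> nrm x <= 1 ->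
     nrm (B2 m x) <= e).
Proof.
move=> hB.
have ge m x : Q2 x -> nrm x <= 1 -> ((nrm (B2 m x))%:E <= opnorm Q (B m))%E.
  move=> Qx x1; apply: ereal_sup_ubound; exists (emb x); last by rewrite hB// hnorm_emb.
  by split; [exact/model_space_emb|rewrite hnorm_emb].
have ge0 m : (0 <= opnorm Q (B m))%E.
  apply: le_trans (ge m 0 (Q2_0 _ _) _); first by rewrite lee_fin nrm_ge0.
  by rewrite nrm0 ler01.
split=> [/fine_cvgP[fin h] e e0|h].
  have /cvgrPdist_le /(_ _ e0) h' := h.
  have [N _ hN] := filterI fin h'; exists N => m x Nm Qx x1.
  have [f1 f2] := hN m Nm; rewrite -lee_fin; apply: le_trans (ge m x Qx x1) _.
  rewrite -(fineK f1) lee_fin; move: f2; rewrite /= sub0r normrN.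
  exact: le_trans (ler_norm _).
have le e : 0 < e -> exists N, forall m, (N <= m)%N -> (opnorm Q (B m) <= e%:E)%E.
  move=> e0; have [N hN] := h e e0; exists N => m Nm; apply: ge_ereal_sup.
  move=> _ [f [/model_spaceP[x Qx ->] x1] <-]; rewrite hB// hnorm_emb lee_fin.
  by apply: hN => //; rewrite -hnorm_emb.
have fin m e : (opnorm Q (B m) <= e%:E)%E -> opnorm Q (B m) \is a fin_num.
  by move=> he; rewrite ge0_fin_numE// (le_lt_trans he)// ltry.
apply/fine_cvgP; split.
  by have [N hN] := le 1 ltr01; exists N => // m Nm; exact: fin (hN m Nm).
apply/cvgrPdist_le => e e0; have [N hN] := le e e0; exists N => // m Nm /=.
rewrite sub0r normrN ger0_norm ?fine_ge0// -lee_fin fineK; first exact: hN.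
exact: fin (hN m Nm).
Qed.

End model.

Theorem theorem5p6 (R : realType) (p : nat) (p_ge1 : (1 <= p)%N)
    (Theta : R[i] -> 'M[R[i]]_p) (Theta_inner : inner_multiplier Theta)
    (T : discfun R p -> discfun R p)
    (T_bounded : bounded_operator (model_space Theta) T) :
  let Q := model_space Theta in
  let S := model_operator Theta in
  compact_operator Q T <->
  opnorm_cvg Q (fun m f => iter m (adjoint Q S) (T (iter m S f))).
Proof.
move=> Q S; have [A A_psums] := inner_psums Theta_inner.
have [T_in T_lin [M T_M]] := T_bounded.
have [T2 hT2] := operator_lift Theta_inner A_psums T_in.
pose C := compression Theta_inner A_psums T2.
have Q_emb x := model_space_emb Theta_inner A_psums x.
have C_emb m x : Q2 Theta_inner A_psums x ->
    iter m (adjoint Q S) (T (iter m S (emb x))) = emb (C m x).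
  move=> hx; have hm := Q2_iter_Sop m hx; have [h1 h2] := hT2 _ hm.
  by rewrite (iter_model_operator_emb Theta_inner A_psums) h2 (iter_adjoint_emb _ h1).
have T2_in x hx := (hT2 x hx).1.
split=> [/(compact_operator_emb hT2) cT|[L [L_in _ _] hL]].
  exists (fun=> 0).
    split=> [f _|c f g _ _|]; first by rewrite -emb0; apply/Q_emb; exact: Q2_0.
      by rewrite scaler0 addr0.
    by exists 0 => f _; rewrite mul0r -emb0 hnorm_emb nrm0.
  apply/(@opnorm_cvg0P _ _ _ Theta_inner _ A_psums _ C) => [m x hx|e e0].
    by rewrite subr0 C_emb.
  have := compact2_compression cT e0; exact.
have [L2 hL2] := operator_lift Theta_inner A_psums L_in.
apply/(compact_operator_emb hT2).
have T2_lin c x y : Q2 Theta_inner A_psums x -> Q2 Theta_inner A_psums y ->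
    T2 (c *: x + y) = c *: T2 x + T2 y.
  move=> hx hy; apply: emb_inj; rewrite -(hT2 _ (Q2_lin c hx hy)).2 !emb_lin.
  by rewrite T_lin ?(hT2 _ hx).2 ?(hT2 _ hy).2//; apply/Q_emb.
have T2_M x : Q2 Theta_inner A_psums x -> nrm (T2 x) <= Num.max M 0 * nrm x.
  move=> hx; rewrite -!hnorm_emb -(hT2 _ hx).2; apply: le_trans (T_M _ _) _; first exact/Q_emb.
  by rewrite ler_wpM2r ?hnorm_emb ?nrm_ge0// le_max lexx.
apply: (@compression_compact2 _ _ _ _ _ _ _ T2_in T2_lin (Num.max M 0) _ T2_M L2) => //.
  by rewrite le_max lexx orbT.
apply/(@opnorm_cvg0P _ _ _ Theta_inner _ A_psums
   (fun m f => iter m (adjoint Q S) (T (iter m S f)) - L f) (fun m x => C m x - L2 x)) => //.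
by move=> m x hx; rewrite C_emb// (hL2 _ hx).2 embB.
Qed.
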